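(* Fix a positive integer $N$. Consider the poset $\mathrm{Supp}_N$ of support-equivalence classes of skew shapes with $N$ boxes (defined in the context), and its subposet consisting of the classes of connected skew shapes. (a) This subposet has exactly $N$ maximal elements. More specifically, for each $l=1,\ldots,N$ there is a unique maximal element (of the subposet of connected elements) whose skew shapes have $l$ nonempty rows. (b) For each such $l$, the corresponding maximal element is the equivalence class consisting of exactly those ribbons $R$ with $l$ nonempty rows such that the lengths of any two nonempty rows of $R$ differ by at most one and the lengths of any two nonempty columns of $R$ differ by at most one. (c) For such a ribbon $R$ (with $N$ boxes), a partition $\lambda$ lies in the support of $s_R$ if and only if $\lambda$ is a partition of $N$ whose Young diagram has no more nonempty rows than $R$ and no more nonempty columns than $R$.
   Context: A skew shape $\lambda/\mu$ (for partitions $\mu\subseteq\lambda$) is the set of boxes of the Young diagram of $\lambda$ (English notation) not in that of $\mu$; its size is its number of boxes. A skew shape is disconnected if it can be partitioned into two nonempty skew shapes $B$, $C$ such that no box of $B$ shares a row or column with a box of $C$; otherwise it is connected. A ribbon is a connected skew shape containing no $2\times 2$ block of boxes. For a skew shape $A$, $s_A$ denotes its skew Schur function, $s_A=\sum_T x^{c(T)}$ over semistandard Young tableaux $T$ of shape $A$. The support of $s_A$ (or of $A$) is the set of partitions $\lambda$ such that $s_\lambda$ has nonzero coefficient in the expansion of $s_A$ in the Schur basis. Two skew shapes with $N$ boxes are support-equivalent if their supports are equal; $\mathrm{Supp}_N$ is the set of support-equivalence classes of skew shapes with $N$ boxes, partially ordered by $[B]\le [A]$ iff the support of $B$ is contained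 in the support of $A$. Support-equivalent skew shapes have the same number of nonempty rows, nonempty columns and connected components, so it makes sense to speak of the number of rows of a class and whether it is connected. *)

(* Defs.v *)
From HB Require Import structures.
From mathcomp Require Import all_boot all_order all_algebra.
From mathcomp Require Import finmap mpoly boolp.

Set Implicit Arguments.
Unset Strict Implicit.
Unset Printing Implicit Defensive.

Import Order.TTheory GRing.Theory.

Local Open Scope nat_scope.

Definition is_intpart (s : seq nat) : bool := sorted geq s && (0 \notin s).

Record intpart := IntPart { parts :> seq nat; _ : is_intpart parts }.

HB.instance Definition _ := [isSub for parts].
HB.instance Definition _ := [Choice of intpart by <:].

Definition intpart0 : intpart := @IntPart [::] isT.

(* Boxes are 0-indexed pairs (row, column) in English notation. *)
Definition intpart_incl (mu lam : intpart) : bool :=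
  all (fun i => nth 0 mu i <= nth 0 lam i) (iota 0 (size mu)).

Record skew_shape := SkewShape {
  outer_inner : intpart * intpart;
  _ : intpart_incl outer_inner.2 outer_inner.1 }.

HB.instance Definition _ := [isSub for outer_inner].
HB.instance Definition _ := [Choice of skew_shape by <:].

Definition outer (A : skew_shape) : intpart := (outer_inner A).1.
Definition inner (A : skew_shape) : intpart := (outer_inner A).2.

Definition boxes (A : skew_shape) : seq (nat * nat) :=
  [seq (i, j) | i <- iota 0 (size (outer A)),
                j <- iota (nth 0 (inner A) i)
                          (nth 0 (outer A) i - nth 0 (inner A) i)].

Definition straight (lam : intpart) : skew_shape :=
  @SkewShape (lam, intpart0) isT.

Definition row_length (A : skew_shape) (i : nat) : nat :=
  count (fun b => b.1 == i) (boxes A).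
Definition col_length (A : skew_shape) (j : nat) : nat :=
  count (fun b => b.2 == j) (boxes A).

(* Only nonempty rows and columns are counted. *)
Definition nrows (A : skew_shape) : nat :=
  size (undup [seq b.1 | b <- boxes A]).
Definition ncols (A : skew_shape) : nat :=
  size (undup [seq b.2 | b <- boxes A]).

(* [boxes] is duplicate-free, so [perm_eq] says that the boxes of [B] and [C]
   partition those of [A]. *)
Definition disconnected (A : skew_shape) : Prop :=
  exists B C : skew_shape,
    [/\ boxes B != [::], boxes C != [::],
        perm_eq (boxes A) (boxes B ++ boxes C)
      & forall b c, b \in boxes B -> c \in boxes C ->
          b.1 != c.1 /\ b.2 != c.2].

Definition connected (A : skew_shape) : Prop := ~ disconnected A.

Definition ribbon (A : skew_shape) : Prop :=
  connected A /\
  ~ exists i j, [/\ (i, j) \in boxes A, (i, j.+1) \in boxes A,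
                    (i.+1, j) \in boxes A & (i.+1, j.+1) \in boxes A].

Definition equitable_ribbon (A : skew_shape) : Prop :=
  [/\ ribbon A,
      forall i i', 0 < row_length A i -> 0 < row_length A i' ->
        row_length A i <= (row_length A i').+1
    & forall j j', 0 < col_length A j -> 0 < col_length A j' ->
        col_length A j <= (col_length A j').+1].

Definition filling (A : skew_shape) (n : nat) :=
  {ffun seq_sub (boxes A) -> 'I_n}.

Definition semistandard (A : skew_shape) (n : nat) (T : filling A n) : bool :=
  [forall b, forall c,
     (((val b).1 == (val c).1) && ((val b).2 <= (val c).2) ==> (T b <= T c)) &&
     (((val b).2 == (val c).2) && ((val b).1 < (val c).1) ==> (T b < T c))].

Definition content (A : skew_shape) (n : nat) (T : filling A n) : 'X_{1..n} :=
  [multinom #|[set b | T b == i]| | i < n].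

(* A symmetric function in infinitely many variables is represented by the
   family, over all n, of its specializations to n variables.  Thus
   [skew_schur A n] is s_A(x_1, ..., x_n), the sum over the semistandard
   tableaux with entries among n letters. *)
Definition skew_schur (A : skew_shape) (n : nat) : {mpoly int[n]} :=
  (\sum_(T : filling A n | semistandard T) 'X_[content T])%R.

(* s_A = \sum_lam a_lam s_lam.  The finitely supported coefficient family [a]
   does not depend on the number n of variables, so that this is an identity
   between symmetric functions in infinitely many variables. *)
Definition schur_expansion (A : skew_shape) (a : {fsfun intpart -> int with 0%R})
    : Prop :=
  forall n, skew_schur A n =
    (\sum_(lam <- finsupp a) a lam *: skew_schur (straight lam) n)%R.

Definition in_support (A : skew_shape) (lam : intpart) : Prop :=
  exists2 a, schur_expansion A a & a lam != 0%R.

Definition supp_incl (B A : skew_shape) : Prop :=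
  forall lam, in_support B lam -> in_support A lam.

Record skew_of_size (N : nat) := SkewOfSize {
  shape :> skew_shape;
  _ : size (boxes shape) == N }.

HB.instance Definition _ (N : nat) := [isSub for @shape N].
HB.instance Definition _ (N : nat) := [Choice of skew_of_size N by <:].

Section SuppPoset.
Variable N : nat.

Definition supp_equiv : rel (skew_of_size N) :=
  fun A B => `[< forall lam, in_support A lam <-> in_support B lam >].

Lemma supp_equiv_refl : reflexive supp_equiv.
Proof. by move=> A; apply/asboolP. Qed.

Lemma supp_equiv_sym : ssrbool.symmetric supp_equiv.
Proof.
by move=> A B; apply: asbool_equiv_eq; split=> h lam; split=> /h.
Qed.

Lemma supp_equiv_trans : transitive supp_equiv.
Proof.
move=> B A C /asboolP AB /asboolP BC; apply/asboolP => lam.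
by split=> [/AB /BC | /BC /AB].
Qed.

Canonical supp_equiv_rel :=
  EquivRel supp_equiv supp_equiv_refl supp_equiv_sym supp_equiv_trans.

Definition Supp := {eq_quot supp_equiv_rel}%qT.

HB.instance Definition _ := Choice.on Supp.
HB.instance Definition _ := EqQuotient.on Supp.

Definition supp_class (A : skew_of_size N) : Supp := (\pi_Supp A)%qT.

Lemma supp_class_eqP (A B : skew_of_size N) :
  supp_class A = supp_class B <->
  (forall lam, in_support A lam <-> in_support B lam).
Proof.
by split=> [/eqmodP /asboolP // | h]; apply/eqmodP/asboolP.
Qed.

Lemma supp_class_surj (x : Supp) : exists A, x = supp_class A.
Proof. by exists (repr x)%qT; rewrite /supp_class reprK. Qed.

Definition supp_le : rel Supp :=
  fun x y => `[< supp_incl (repr x)%qT (repr y)%qT >].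

Lemma supp_le_refl : reflexive supp_le.
Proof. by move=> x; apply/asboolP. Qed.

Lemma supp_le_anti : antisymmetric supp_le.
Proof.
move=> x y /andP[/asboolP xy /asboolP yx].
rewrite -[x]reprK -[y]reprK; apply/eqmodP/asboolP => lam.
by split; [apply: xy | apply: yx].
Qed.

Lemma supp_le_trans : transitive supp_le.
Proof.
move=> y x z /asboolP xy /asboolP yz; apply/asboolP => lam.
by move/xy/yz.
Qed.

Fact supp_display : Order.disp_t. Proof. exact: (Order.Disp tt tt). Qed.

HB.instance Definition _ := Order.Le_isPOrder.Build supp_display Supp
  supp_le_refl supp_le_anti supp_le_trans.

(* The order does not depend on the representatives used in [supp_le]. *)
Lemma supp_class_leP (A B : skew_of_size N) :
  (supp_class A <= supp_class B)%O <-> supp_incl A B.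
Proof.
have E (C : skew_of_size N) lam :
    in_support (repr (supp_class C))%qT lam <-> in_support C lam.
  by move: lam; apply/supp_class_eqP; rewrite /supp_class reprK.
split=> [/asboolP h lam /E /h /E // | h]; apply/asboolP => lam /E /h.
by move/E.
Qed.

Definition connected_class (x : Supp) : Prop :=
  exists2 A : skew_of_size N, x = supp_class A & connected A.

Definition class_nrows (x : Supp) (l : nat) : Prop :=
  forall A : skew_of_size N, x = supp_class A -> nrows A = l.

Definition max_connected (x : Supp) : Prop :=
  connected_class x /\
  forall y, connected_class y -> (x <= y)%O -> y = x.

End SuppPoset.

(* Main.v *)
(** By the Littlewood-Richardson rule, [lam] lies in the support of [A] exactly
    when there is a semistandard filling of [A] of weight [lam] that is lattice:
    in the columns from [j] on, [v.+1] never occurs more often than [v].  The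
    rule is proved by Stembridge's involution: in the expansion of the alternant
    of the staircase times [s_A], a filling that is not lattice cancels against
    its image under the Bender-Knuth move applied to the columns to the left of
    the last failure.

    Lattice fillings bound the rows and columns of [lam] by those of [A], and a
    connected shape with [N] boxes has at most [N + 1] rows and columns in
    total, so that the support of a connected shape with [l] rows is contained
    in the set of partitions of [N] with at most [l] rows and [N - l + 1]
    columns.  An equitable ribbon attains this set: reading its boxes from top
    right to bottom left, a lattice filling is a ballot word that ascends exactly
    at the steps down.  When all rows have length at least two, such a word is
    built by peeling off one row of the ribbon after the other, each time
    removing a box from suitable columns of [lam]; the case of columns of length
    at least two follows by transposing ballot words.  Conversely, if the support
    of [A] is this set, the hook of the set excludes 2 x 2 squares, two explicit
    fillings fix the numbers of rows and columns, whence [A] is a ribbon, and the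
    most balanced partitions of the set force its rows and columns to be
    equitable. *)

Require Import Defs.
From mathcomp Require Import all_boot all_order all_algebra fingroup perm.
From mathcomp Require Import finmap mpoly boolp zify.

Set Implicit Arguments.
Unset Strict Implicit.
Unset Printing Implicit Defensive.

Import GRing.Theory.

Local Open Scope nat_scope.

(** * Boxes of a skew shape *)

(** The obstacle is the construction of the ballot word: each pair of consecutive blocks must meet
    in an ascent. This is enforced by letting the two blocks share a column of [lam], from which the
    later one takes a box one row lower. The shared column is fixed before the earlier block is
    chosen, so the peeling carries a designated column and an invariant. Full columns, which need
    every remaining label, must fit into the next block beside the designated column, and the number
    of boxes below the first row must not drop under the number of ascents still to come. Row
    lengths of at least two give the slack for this. An equitable ribbon with both a row and a
    column of length one is a zigzag; up to transposition its blocks are 2, ..., 2, 1, and the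
    single last box is peeled by hand. The Bender-Knuth move is set up on Gelfand-Tsetlin patterns:
    it reflects one threshold of each row between the bounds imposed by its neighbours, so that no
    matching of letters is needed and cutting at a column means truncating the thresholds. *)

Notation inn A i := (nth 0 (inner A) i).
Notation out A i := (nth 0 (outer A) i).

Lemma part_sorted (l : intpart) : sorted geq l.
Proof. by case: l => s /= /andP[]. Qed.

Lemma part_notin0 (l : intpart) : 0 \notin (l : seq nat).
Proof. by case: l => s /= /andP[]. Qed.

Lemma part_nth_anti (l : intpart) i j : i <= j -> nth 0 l j <= nth 0 l i.
Proof.
move=> ij; case: (ltnP j (size l)) => [jl|]; last by move=> /(nth_default 0) ->.
have tr : transitive geq by move=> x y z /= xy yz; apply: leq_trans yz xy.
have rf : reflexive geq by move=> x; apply: leqnn.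
by apply: (sorted_leq_nth tr rf 0 (part_sorted l)) => //; rewrite inE //; lia.
Qed.

Lemma part_nth_gt0 (l : intpart) i : (0 < nth 0 l i) = (i < size l).
Proof.
case: (ltnP i (size l)) => [il|/(nth_default 0) -> //].
rewrite lt0n; apply: contraNneq (part_notin0 l) => <-; exact: mem_nth.
Qed.

Lemma part_ext (l m : intpart) : (forall i, nth 0 l i = nth 0 m i) -> l = m.
Proof.
move=> lm; have E i : (i < size l) = (i < size m) by rewrite -!part_nth_gt0 lm.
have := E (size l); have := E (size m); rewrite !ltnn => h1 h2.
by apply: val_inj; apply: (@eq_from_nth _ 0) => //; move: h1 h2; rewrite /=; lia.
Qed.

Lemma inn_le_out A i : inn A i <= out A i.
Proof.
have H : intpart_incl (inner A) (outer A) := valP A.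
case: (ltnP i (size (inner A))) => [il|/(nth_default 0) -> //].
by move/allP: H => /(_ i); apply; rewrite mem_iota.
Qed.

Lemma inn_anti A i j : i <= j -> inn A j <= inn A i.
Proof. exact: part_nth_anti. Qed.

Lemma out_anti A i j : i <= j -> out A j <= out A i.
Proof. exact: part_nth_anti. Qed.

Lemma mem_boxes A i j : ((i, j) \in boxes A) = (inn A i <= j < out A i).
Proof.
apply/allpairsPdep/idP.
  move=> [x [y [+ + [-> ->]]]]; rewrite !mem_iota => _.
  by have := inn_le_out A x; lia.
move=> H; exists i, j; rewrite !mem_iota; split=> //; last lia.
by rewrite -part_nth_gt0; lia.
Qed.

Lemma mem_boxesE A b : (b \in boxes A) = (inn A b.1 <= b.2 < out A b.1).
Proof. by case: b => i j; rewrite mem_boxes. Qed.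

Lemma boxes_uniq A : uniq (boxes A).
Proof.
apply: allpairs_uniq_dep; first exact: iota_uniq.
  by move=> *; exact: iota_uniq.
by move=> [x1 y1] [x2 y2] _ _ /= [-> ->].
Qed.

Lemma sum_boxes A (F : nat * nat -> nat) :
  \sum_(x <- boxes A) F x =
  \sum_(i < size (outer A)) \sum_(inn A i <= c < out A i) F (nat_of_ord i, c).
Proof.
rewrite big_allpairs_dep /= -{1}[size _]subn0 big_mkord; apply: eq_bigr => i _.
by rewrite /index_iota.
Qed.

Lemma count_boxes A (P : pred (nat * nat)) :
  count P (boxes A) =
  \sum_(i < size (outer A)) \sum_(inn A i <= c < out A i) P (nat_of_ord i, c).
Proof.
rewrite -(sum_boxes A (fun x => nat_of_bool (P x))) -sum1_count big_mkcond.
by apply: eq_bigr => i _; case: (P _).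
Qed.

Lemma sum_seq_sub (T : choiceType) (s : seq T) (P : pred T) :
  uniq s -> #|[set b : seq_sub s | P (val b)]| = count P s.
Proof.
move=> us; rewrite cardsE cardE /enum_mem size_filter.
have -> : count P s = count P (map val (enum {: seq_sub s})).
  apply/seq.permP/uniq_perm => //; first by rewrite map_inj_uniq ?enum_uniq //; exact: val_inj.
  move=> x; apply/idP/mapP => [xs|[y _ ->]]; last exact: valP.
  by exists (SeqSub xs); rewrite ?mem_enum.
by rewrite count_map enumT; apply: eq_count => x.
Qed.

Lemma sum_range (P : pred nat) a b u v : a <= u -> u <= v -> v <= b ->
  (forall c, a <= c < b -> P c = (u <= c < v)) -> \sum_(a <= c < b) P c = v - u.
Proof.
move=> au uv vb HP.
rewrite (big_cat_nat (n := u)) //=; last lia.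
rewrite (big_cat_nat (n := v) (m := u)) //=.
rewrite [X in X + _]big_nat_cond big1 ?add0n; last first.
  by move=> c; rewrite andbT => H; rewrite HP; [have -> : (u <= c < v) = false by lia|lia].
rewrite [X in _ + X]big_nat_cond [X in _ + X]big1 ?addn0; last first.
  by move=> c; rewrite andbT => H; rewrite HP; [have -> : (u <= c < v) = false by lia|lia].
rewrite (eq_big_nat _ _ (F2 := fun=> 1)) ?sum_nat_const_nat ?muln1 //.
by move=> c H; rewrite HP; [have -> : (u <= c < v) = true by lia|lia].
Qed.

(** * The Bender-Knuth move on row thresholds *)

Definition ssyt (A : skew_shape) (f : nat * nat -> nat) : Prop :=
  forall b c, b \in boxes A -> c \in boxes A ->
    (b.1 = c.1 -> b.2 <= c.2 -> f b <= f c) /\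
    (b.2 = c.2 -> b.1 < c.1 -> f b < f c).

Definition right_count (A : skew_shape) (f : nat * nat -> nat) (j v : nat) : nat :=
  count (fun b => (j <= b.2) && (f b == v)) (boxes A).
Definition left_count (A : skew_shape) (f : nat * nat -> nat) (j v : nat) : nat :=
  count (fun b => (b.2 < j) && (f b == v)) (boxes A).
Definition weight (A : skew_shape) (f : nat * nat -> nat) (v : nat) : nat :=
  count (fun b => f b == v) (boxes A).

Lemma weight_split A f j v : weight A f v = right_count A f j v + left_count A f j v.
Proof.
rewrite /weight /right_count /left_count -count_predUI.
rewrite [X in _ + X](eq_count (a2 := pred0)) ?count_pred0 ?addn0.
  by apply: eq_count => b /=; case: leqP; case: (f b == v).
by move=> b /=; case: leqP; rewrite ?andbF.
Qed.

(* [p m i] is the column where the entries of row [i] that are less than [m] end. *)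
Definition threshold (A : skew_shape) (f : nat * nat -> nat) (m i : nat) : nat :=
  inn A i + \sum_(inn A i <= c < out A i) (f (i, c) < m).

(** Detaches the thresholds from the filling that defines them: a modified array is the threshold
    array of a modified filling as soon as this holds, by [matches_uniq]. *)
Definition matches (A : skew_shape) (f : nat * nat -> nat) (p : nat -> nat -> nat) :=
  (forall m i, inn A i <= p m i <= out A i) /\
  (forall b m, b \in boxes A -> (f b < m) = (b.2 < p m b.1)).

(** The Gelfand-Tsetlin condition; the second inequality encodes column strictness. *)
Definition interlacing (p : nat -> nat -> nat) :=
  forall m i, p m i <= p m.+1 i /\ p m.+1 i.+1 <= p m i.

Lemma initial_segment (P : pred nat) a b : a <= b ->
  (forall c d, a <= c -> c <= d -> d < b -> P d -> P c) ->
  exists2 t, a <= t <= b & forall c, a <= c < b -> P c = (c < t).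
Proof.
elim: b => [|b IH] ab H; first by exists a; [lia | move=> c; lia].
case: (ltnP b a) => ba; first by exists a; [lia | move=> c; lia].
have [t tab Ht] := IH ba (fun c d h1 h2 h3 => H c d h1 h2 (ltnW h3)).
case Pb: (P b).
  exists b.+1; first lia.
  move=> c cb; rewrite (H c b) //; lia.
exists t; first lia.
move=> c cb; case: (ltnP c b) => cb'; first by rewrite Ht //; lia.
have -> : c = b by lia.
by rewrite Pb; lia.
Qed.

Lemma threshold_matches A f : ssyt A f -> matches A f (threshold A f).
Proof.
move=> ss.
have H m i : exists2 t, inn A i <= t <= out A i &
    (forall c, inn A i <= c < out A i -> (f (i, c) < m) = (c < t)).
  apply: (initial_segment (P := fun c => f (i, c) < m) (inn_le_out A i)).
  move=> c d h1 h2 h3 h4.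
  have B1 : (i, c) \in boxes A by rewrite mem_boxes; lia.
  have B2 : (i, d) \in boxes A by rewrite mem_boxes; lia.
  by have [h _] := ss _ _ B1 B2; move: (h erefl h2); lia.
have E m i : inn A i <= threshold A f m i <= out A i /\
    (forall c, inn A i <= c < out A i -> (f (i, c) < m) = (c < threshold A f m i)).
  have [t ht Ht] := H m i.
  have -> : threshold A f m i = t.
    rewrite /threshold (sum_range (u := inn A i) (v := t)) //; try lia.
    by move=> c hc; rewrite Ht //; lia.
  by split.
split=> [m i|[i c] m]; first by case: (E m i).
by rewrite mem_boxes => /= h; case: (E m i) => _; apply.
Qed.

Lemma matches_mono A f p m m' i : matches A f p -> m <= m' -> p m i <= p m' i.
Proof.
move=> [pb pm] mm; rewrite leqNgt; apply/negP => h.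
have hb : (i, p m' i) \in boxes A.
  by rewrite mem_boxes; move: (pb m i) (pb m' i); lia.
move: (pm _ m hb) (pm _ m' hb) => /=; lia.
Qed.

Lemma matches_uniq A f p q : matches A f p -> matches A f q -> forall m i, p m i = q m i.
Proof.
suff H p' q' m i : matches A f p' -> matches A f q' -> p' m i <= q' m i.
  by move=> h1 h2 m i; apply/eqP; rewrite eqn_leq !H.
move=> [b1 h1] [b2 h2]; rewrite leqNgt; apply/negP => h.
have hb : (i, q' m i) \in boxes A.
  by rewrite mem_boxes; move: (b1 m i) (b2 m i); lia.
move: (h1 _ m hb) (h2 _ m hb) => /=; lia.
Qed.

Lemma ssyt_interlacing A f p : ssyt A f -> matches A f p -> interlacing p.
Proof.
move=> ss mt m i; split; first exact: (matches_mono _ mt).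
case: mt => [pb pm]; rewrite leqNgt; apply/negP => h.
have := pb m i; have := pb m.+1 i.+1; have := inn_anti A (leqnSn i).
have := out_anti A (leqnSn i) => h1 h2 h3 h4.
have B1 : (i.+1, p m i) \in boxes A by rewrite mem_boxes; lia.
have B2 : (i, p m i) \in boxes A by rewrite mem_boxes; lia.
have [_ /(_ erefl (ltnSn i))] := ss _ _ B2 B1.
move: (pm _ m.+1 B1) (pm _ m B2) => /=; lia.
Qed.

Lemma interlacing_anti p m i i' : interlacing p -> i <= i' -> p m i' <= p m i.
Proof.
move=> H; elim: i' => [|i' IH]; first by rewrite leqn0 => /eqP ->.
rewrite leq_eqVlt ltnS => /predU1P [-> //|/IH]; apply: leq_trans.
by have [_ h] := H m i'; apply: leq_trans h; case: (H m i'.+1).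
Qed.

Lemma interlacing_ssyt A f p : interlacing p -> matches A f p -> ssyt A f.
Proof.
move=> H [pb pm] [i c] [i' c'] hb hc /=; split=> [e1 l2|e2 l1].
  subst i'; have := pm _ (f (i, c')).+1 hb; have := pm _ (f (i, c')).+1 hc => /=; lia.
subst c'; have := pm _ (f (i', c)).+1 hc; rewrite ltnSn /= => /esym h.
rewrite (pm _ _ hb) /=; apply: leq_trans h _.
apply: leq_trans (interlacing_anti _ H l1) _.
by case: (H (f (i', c)) i).
Qed.

Lemma left_count_threshold A f p j v : matches A f p ->
  left_count A f j v =
  \sum_(i < size (outer A)) (minn (p v.+1 i) j - minn (p v i) j).
Proof.
move=> mt; rewrite /left_count count_boxes; apply: eq_bigr => i _.
have h0 := matches_mono i mt (leqnSn v); case: mt => [pb pm].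
have h1 := pb v i; have h2 := pb v.+1 i.
case: (leqP (inn A i) j) => ji; last first.
  rewrite big_nat_cond big1; first lia.
  by move=> c /=; lia.
case: (leqP j (out A i)) => jo.
  rewrite (sum_range (u := minn (p v i) j) (v := minn (p v.+1 i) j)) //; try lia.
  move=> c hc; have hb : (val i, c) \in boxes A by rewrite mem_boxes.
  have := pm _ v hb; have := pm _ v.+1 hb => /=; lia.
rewrite (sum_range (u := p v i) (v := p v.+1 i)) //; try lia.
move=> c hc; have hb : (val i, c) \in boxes A by rewrite mem_boxes.
have := pm _ v hb; have := pm _ v.+1 hb => /=; lia.
Qed.

Section BenderKnuth.
Variables (k j : nat).

(** [bk_lo] and [bk_hi] are the bounds that interlacing with the thresholds [k] and [k.+2] imposes
    on the threshold [k.+1] of row [i], truncated at column [j]. Row 0 has no row above to bound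
    it. *)
Definition bk_lo (p : nat -> nat -> nat) i :=
  maxn (minn (p k i) j) (minn (p k.+2 i.+1) j).
Definition bk_hi (p : nat -> nat -> nat) i :=
  if i is i'.+1 then minn (minn (p k.+2 i) j) (minn (p k i') j)
  else minn (p k.+2 0) j.
(** The truncated threshold is reflected in the interval from [bk_lo] to [bk_hi]; the last summand
    restores the part beyond column [j], which must not move. *)
Definition bk_mid (p : nat -> nat -> nat) i :=
  bk_lo p i + bk_hi p i - minn (p k.+1 i) j + (p k.+1 i - j).
Definition bk_thr (p : nat -> nat -> nat) m i :=
  if m == k.+1 then bk_mid p i else p m i.

Lemma bk_bounds p i : interlacing p -> bk_lo p i <= minn (p k.+1 i) j <= bk_hi p i.
Proof.
move=> H; have := H k i; have := H k.+1 i; rewrite /bk_lo /bk_hi.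
case: i => [|i]; first lia.
have := H k i; have := H k.+1 i; lia.
Qed.

(** No entry [k] stands in column [j]. Hence a row whose threshold [k.+1] exceeds [j] has only
    entries below [k] up to column [j], and the reflection leaves it alone. *)
Definition bk_free (p : nat -> nat -> nat) := forall i, ~~ (p k i <= j < p k.+1 i).

Lemma bk_hi_leS p i : bk_hi p i.+1 <= minn (p k i) j.
Proof. by rewrite /bk_hi geq_minr. Qed.

Lemma bk_hi_le p i : bk_hi p i <= minn (p k.+2 i) j.
Proof. by rewrite /bk_hi; case: i => // i; rewrite geq_minl. Qed.

Lemma bk_mid_cases p i : interlacing p -> bk_free p ->
  (p k.+1 i <= j /\ bk_lo p i <= bk_mid p i <= bk_hi p i) \/
  (j < p k i /\ bk_mid p i = p k.+1 i).
Proof.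
move=> H F; have := bk_bounds i H; have := F i; have [h1 _] := H k i.
rewrite /bk_mid; case: (leqP (p k.+1 i) j) => yj; first by left; lia.
right; have hl : minn (p k i) j <= bk_lo p i by rewrite /bk_lo leq_maxl.
have := bk_hi_le p i; lia.
Qed.

Lemma bk_mid_bounds p i : interlacing p -> bk_free p ->
  [/\ p k i <= bk_mid p i, bk_mid p i <= p k.+2 i,
      p k.+2 i.+1 <= bk_mid p i & bk_mid p i.+1 <= p k i].
Proof.
move=> H F; have h1 := H k i; have h2 := H k.+1 i.
have l1 : minn (p k i) j <= bk_lo p i by rewrite /bk_lo leq_maxl.
have l2 : minn (p k.+2 i.+1) j <= bk_lo p i by rewrite /bk_lo leq_maxr.
have u1 := bk_hi_le p i; have u2 := bk_hi_leS p i.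
have c1 := bk_mid_cases i H F; have c2 := bk_mid_cases i.+1 H F.
by split; case: c1 => c1; case: c2 => c2; lia.
Qed.

Lemma bk_thr_interlacing p : interlacing p -> bk_free p -> interlacing (bk_thr p).
Proof.
move=> H F m i; rewrite /bk_thr.
have [a1 a2 a3 a4] := bk_mid_bounds i H F.
case: (eqVneq m k.+1) => [->|mk].
  by have -> : (k.+2 == k.+1) = false by lia.
case: eqP => [[e]|]; last by have := H m i.
by subst m.
Qed.

(** Both bounds depend on the thresholds [k] and [k.+2] only, which do not change, so the same
    reflection is applied twice. *)
Lemma bk_thrK p : interlacing p -> bk_free p ->
  forall i, bk_mid (bk_thr p) i = p k.+1 i.
Proof.
move=> H F i.
have el : bk_lo (bk_thr p) i = bk_lo p i.
  by rewrite /bk_lo /bk_thr; do 2 (case: eqP => [|_]; first lia).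
have eh : bk_hi (bk_thr p) i = bk_hi p i.
  rewrite /bk_hi /bk_thr; case: i {el} => [|i]; first by case: eqP => [|_]; first lia.
  by do 2 (case: eqP => [|_]; first lia).
have e1 : bk_thr p k.+1 i = bk_mid p i by rewrite /bk_thr eqxx.
have -> : bk_mid (bk_thr p) i =
  bk_lo p i + bk_hi p i - minn (bk_mid p i) j + (bk_mid p i - j).
  by rewrite {1}/bk_mid el eh e1.
have := bk_mid_cases i H F; have := bk_bounds i H; have [h _] := H k i.
rewrite /bk_mid; have := bk_hi_le p i.
have : minn (p k i) j <= bk_lo p i by rewrite /bk_lo leq_maxl.
by move=> *; lia.
Qed.

(** Telescoping: the lower bound of a row and the upper bound of the next row are the maximum and
    the minimum of the same two numbers. The term left over at row [L] vanishes. *)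
Lemma bk_lohi_sum p L : interlacing p -> p k.+2 L = 0 ->
  \sum_(i < L) (bk_lo p i + bk_hi p i) =
  \sum_(i < L) (minn (p k i) j + minn (p k.+2 i) j).
Proof.
move=> H; case: L => [|L] HL; first by rewrite !big_ord0.
suff E l : \sum_(i < l.+1) (bk_lo p i + bk_hi p i) +
     minn (minn (p k.+2 l.+1) j) (minn (p k l) j) =
  \sum_(i < l.+1) (minn (p k i) j + minn (p k.+2 i) j) + minn (p k.+2 l.+1) j.
  by have := E L; rewrite HL; lia.
elim: l => [|l IH]; first by rewrite !big_ord1 /bk_lo /bk_hi /=; lia.
rewrite big_ord_recr [in RHS]big_ord_recr /= .
move: IH; set X := \sum_(i < _) _; set Y := \sum_(i < _) _.
have -> : bk_lo p l.+1 = maxn (minn (p k l.+1) j) (minn (p k.+2 l.+2) j) by [].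
lia.
Qed.

Definition bk_fun (f : nat * nat -> nat) (p : nat -> nat -> nat) (b : nat * nat) : nat :=
  if (b.2 < j) && ((f b == k) || (f b == k.+1)) then
    if b.2 < bk_mid p b.1 then k else k.+1
  else f b.

Lemma bk_fun_matches A f p : matches A f p -> interlacing p -> bk_free p ->
  matches A (bk_fun f p) (bk_thr p).
Proof.
move=> [pb pm] H F.
have B i : p k i <= bk_mid p i <= p k.+2 i.
  by have [h1 h2 _ _] := bk_mid_bounds i H F; rewrite h1 h2.
split=> [m i|[i c] m hb].
  rewrite /bk_thr; case: eqP => // _.
  by have := B i; have := pb k i; have := pb k.+2 i; lia.
have := pm _ k hb; have := pm _ k.+1 hb; have := pm _ k.+2 hb; have := pm _ m hb.
rewrite /bk_fun /bk_thr /=.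
have := B i.
have := bk_mid_cases i H F; have := H k i; have := H k.+1 i.
have : bk_hi p i <= j by have := bk_hi_le p i; lia.
move: (bk_mid p i) (bk_lo p i) (bk_hi p i) => y lo hi.
case: (eqVneq m k.+1) => [->|mk]; last first.
  case: ifP => //; case: ifP => //; lia.
case: ifP; last lia.
case: ifP; lia.
Qed.
End BenderKnuth.

Lemma bk_fun_right A k j f p j' v : j <= j' ->
  right_count A (bk_fun k j f p) j' v = right_count A f j' v.
Proof.
move=> jj; apply: eq_count => b; rewrite /bk_fun.
case: (leqP j' b.2) => //= h; have -> : (b.2 < j) = false by lia.
by [].
Qed.

Section BenderKnuthCount.
Variables (A : skew_shape) (k j : nat) (f : nat * nat -> nat) (p : nat -> nat -> nat).
Hypotheses (ft : matches A f p) (ip : interlacing p) (fp : bk_free k j p).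

Lemma bk_fun_left_other v : v != k -> v != k.+1 ->
  left_count A (bk_fun k j f p) j v = left_count A f j v.
Proof.
move=> vk vk1; apply: eq_count => b; rewrite /bk_fun.
case: (b.2 < j) => //=; case: ifP => // /orP[] /eqP ->; case: ifP => _; lia.
Qed.

Lemma bk_min_mid i : minn (bk_mid k j p i) j = bk_lo k j p i + bk_hi k j p i - minn (p k.+1 i) j.
Proof.
have := bk_mid_cases i ip fp; have := bk_bounds k j i ip; have [h _] := ip k i.
have : bk_hi k j p i <= j by have := bk_hi_le k j p i; lia.
have : minn (p k i) j <= bk_lo k j p i by rewrite /bk_lo leq_maxl.
by rewrite /bk_mid; lia.
Qed.

(** By [bk_lohi_sum], reflecting every row replaces the sum of the middle thresholds by its
    reflection between the sums of the outer ones, which exchanges the two counts. *)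
Lemma bk_fun_left : left_count A (bk_fun k j f p) j k = left_count A f j k.+1 /\
  left_count A (bk_fun k j f p) j k.+1 = left_count A f j k.
Proof.
have mt := bk_fun_matches ft ip fp.
rewrite !(left_count_threshold j _ mt) !(left_count_threshold j _ ft).
have [pb _] := ft; set L := size (outer A).
have HL : p k.+2 L = 0 by have := pb k.+2 L; rewrite /L (nth_default 0 (leqnn _)); lia.
have E := bk_lohi_sum j ip HL.
have e1 i : bk_thr k j p k.+1 i = bk_mid k j p i by rewrite /bk_thr eqxx.
have e2 i : bk_thr k j p k.+2 i = p k.+2 i by rewrite /bk_thr; case: eqP => //; lia.
have e0 i : bk_thr k j p k i = p k i by rewrite /bk_thr; case: eqP => //; lia.
have B i := bk_bounds k j i ip.
have L1 i : minn (p k i) j <= bk_lo k j p i by rewrite /bk_lo leq_maxl.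
have L2 i := bk_hi_le k j p i.
have M1 := matches_mono _ ft (leqnSn k); have M2 := matches_mono _ ft (leqnSn k.+1).
rewrite !big_split /= in E.
pose a (i : 'I_L) := minn (p k i) j; pose y (i : 'I_L) := minn (p k.+1 i) j.
pose c (i : 'I_L) := minn (p k.+2 i) j.
pose s (i : 'I_L) := bk_lo k j p i + bk_hi k j p i.
have Bl i : a i <= y i by rewrite /a /y; have := M1 i; lia.
have Bu i : y i <= c i by rewrite /c /y; have := M2 i; lia.
have Bs i : y i <= s i by have := B i; rewrite /y /s; lia.
have Bt i : a i <= s i - y i by have := B i; have := L1 i; rewrite /a /y /s; lia.
have Bv i : s i - y i <= c i.
  have h1 : bk_hi k j p i <= c i by exact: L2.
  by move: (B i); rewrite -/(y i) /s; lia.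
(* Every difference has to be a true one before truncated subtraction can be moved out of the
   sums. *)
have sumB (F G : 'I_L -> nat) : (forall i, F i <= G i) ->
    \sum_i (G i - F i) = \sum_i G i - \sum_i F i /\ \sum_i F i <= \sum_i G i.
  by move=> FG; split; [rewrite sumnB | apply: leq_sum].
have [s1 s1'] := sumB _ _ Bl; have [s2 s2'] := sumB _ _ Bu; have [s3 s3'] := sumB _ _ Bs.
have [s4 s4'] := sumB _ _ Bt; have [s5 s5'] := sumB _ _ Bv.
cbv beta in s1, s2, s3, s4, s5, s1', s2', s3', s4', s5'.
have E' : \sum_i s i = \sum_i a i + \sum_i c i.
  by rewrite /s big_split /= E -big_split /= -/L /a /c big_split.
split; under eq_bigr => i _ do rewrite ?e1 ?e2 ?e0 bk_min_mid.
- rewrite -[LHS]/(\sum_(i < L) ((s i - y i) - a i)) -[RHS]/(\sum_(i < L) (c i - y i)).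
  by rewrite s4 s3 E' s2 -subnDA [X in _ - X]addnC subnDl.
- rewrite -[LHS]/(\sum_(i < L) (c i - (s i - y i))) -[RHS]/(\sum_(i < L) (y i - a i)).
  rewrite s5 s3 E' s1; move: s1' s2' {s1 s2 s3 s3' s4 s4' s5 s5' E'}.
  by move: (\sum_i a i) (\sum_i y i) (\sum_i c i) => x1 x2 x3; lia.
Qed.

Lemma bk_funK b : b \in boxes A -> bk_fun k j (bk_fun k j f p) (bk_thr k j p) b = f b.
Proof.
move=> hb; rewrite {1}/bk_fun bk_thrK //.
have [_ pm] := ft; have h1 := pm _ k.+1 hb; have h0 := pm _ k hb.
rewrite /bk_fun; case: (ltnP b.2 j) => //= bj.
have E : let x := if b.2 < bk_mid k j p b.1 then k else k.+1 in (x == k) || (x == k.+1).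
  by case: ifP => _ /=; rewrite eqxx ?orbT.
case: (eqVneq (f b) k) => [e|n1] /=.
  by rewrite E -h1 e ltnSn.
case: (eqVneq (f b) k.+1) => [e|n2] /=.
  by rewrite E -h1 e ltnn.
by rewrite (negPf n1) (negPf n2).
Qed.
End BenderKnuthCount.

(** * Lattice fillings and their failures *)

Definition lattice (A : skew_shape) (f : nat * nat -> nat) : Prop :=
  forall j v, right_count A f j v.+1 <= right_count A f j v.

(** The greatest failing column and the least letter failing there. This canonical choice depends
    only on the columns from [j] on, so a move to the left of [j] preserves it. *)
Definition first_failure (A : skew_shape) (n : nat) (f : nat * nat -> nat) (j k : nat) : Prop :=
  [/\ k.+1 < n, right_count A f j k < right_count A f j k.+1,
      (forall j' k', j < j' -> k'.+1 < n -> right_count A f j' k'.+1 <= right_count A f j' k')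
    & (forall k', k' < k -> right_count A f j k'.+1 <= right_count A f j k')].

Lemma right_count_far A f j v : out A 0 <= j -> right_count A f j v = 0.
Proof.
move=> h; apply/eqP; rewrite -leqn0 leqNgt -has_count; apply/hasP => -[[i c]].
by rewrite mem_boxes /= => hb; have := out_anti A (leq0n i); lia.
Qed.

Lemma first_failure_ex A n f :
  (exists j k, k.+1 < n /\ right_count A f j k < right_count A f j k.+1) ->
  exists j k, first_failure A n f j k.
Proof.
move=> [j0 [k0 [k0n h0]]].
pose P j := has (fun k => (k.+1 < n) && (right_count A f j k < right_count A f j k.+1)) (iota 0 n).
have PE j k : k.+1 < n -> right_count A f j k < right_count A f j k.+1 -> P j.
  by move=> h1 h2; apply/hasP; exists k; rewrite ?mem_iota ?h1 //; lia.
have exP : exists j, P j by exists j0; apply: PE h0.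
have bP j : P j -> j <= out A 0.
  move=> /hasP [k _ /andP[_]]; case: (leqP j (out A 0)) => // h; rewrite !right_count_far //; lia.
case: (ex_maxnP exP bP) => j Pj maxj.
have exk : exists k, (k.+1 < n) && (right_count A f j k < right_count A f j k.+1).
  by case/hasP: Pj => k _ h; exists k.
case: (ex_minnP exk) => k /andP[kn hk] mink.
exists j, k; split=> // [j' k' jj kn'|k' kk].
  rewrite leqNgt; apply/negP => h; have := maxj j' (PE _ _ kn' h); lia.
rewrite leqNgt; apply/negP => h; have := mink k'; rewrite h; lia.
Qed.

Lemma first_failure_uniq A n f j k j' k' :
  first_failure A n f j k -> first_failure A n f j' k' -> j = j' /\ k = k'.
Proof.
move=> [kn h hj hk] [kn' h' hj' hk'].
have e : j = j'.
  case: (ltngtP j j') => // l.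
  - by have := hj _ _ l kn'; lia.
  - by have := hj' _ _ l kn; lia.
subst j'; split=> //; case: (ltngtP k k') => // l.
- by have := hk' _ l; lia.
- by have := hk _ l; lia.
Qed.

Lemma right_countS A f j v :
  right_count A f j v = right_count A f j.+1 v + count (fun b => (b.2 == j) && (f b == v)) (boxes A).
Proof.
rewrite /right_count -count_predUI.
rewrite [X in _ + X](eq_count (a2 := pred0)) ?count_pred0 ?addn0.
  by apply: eq_count => b /=; case: (ltngtP j b.2) => //= h; case: (f b == v).
by move=> b /=; case: (ltngtP j b.2); rewrite ?andbF.
Qed.

Lemma col_count_le1 A f j v : ssyt A f ->
  count (fun b => (b.2 == j) && (f b == v)) (boxes A) <= 1.
Proof.
move=> ss; rewrite -size_filter.
have U : uniq (filter (fun b => (b.2 == j) && (f b == v)) (boxes A)).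
  by rewrite filter_uniq ?boxes_uniq.
case E : (filter _ _) U => [|b [|c s]] //= /andP[]; rewrite inE negb_or => /andP[bc _] _.
have : b \in filter (fun b => (b.2 == j) && (f b == v)) (boxes A) by rewrite E inE eqxx.
have : c \in filter (fun b => (b.2 == j) && (f b == v)) (boxes A) by rewrite E !inE eqxx orbT.
rewrite !mem_filter => /andP[/andP[/eqP c2 /eqP fc] hc] /andP[/andP[/eqP b2 /eqP fb] hb].
have [_ h1] := ss _ _ hb hc; have [_ h2] := ss _ _ hc hb.
have e2 : b.2 = c.2 by rewrite b2.
case: (ltngtP b.1 c.1) => h.
- by have := h1 e2 h; lia.
- by have := h2 (esym e2) h; lia.
- by move: bc; rewrite [b]surjective_pairing [c]surjective_pairing h e2 eqxx.
Qed.

(** The columns after [j] do not fail and column [j] contains each letter at most once. So it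
    contains [k.+1] but not [k], and the excess is exactly one. *)
Lemma first_failure_free A n f p j k : ssyt A f -> matches A f p ->
  first_failure A n f j k ->
  bk_free k j p /\ right_count A f j k.+1 = (right_count A f j k).+1.
Proof.
move=> ss [pb pm] [kn h hj hk].
have := hj _ _ (ltnSn j) kn; have := col_count_le1 j k.+1 ss.
move: h; rewrite !(right_countS _ f j) => h c1 h2; split; last lia.
move=> i; apply/negP => hi.
have hb : (i, j) \in boxes A by rewrite mem_boxes; have := pb k i; have := pb k.+1 i; lia.
have : 0 < count (fun b => (b.2 == j) && (f b == k)) (boxes A).
  rewrite -has_count; apply/hasP; exists (i, j) => //=; rewrite eqxx /=.
  by have := pm _ k hb; have := pm _ k.+1 hb => /=; lia.
lia.
Qed.

(** * Alternants *)

(** Tableaux become functions on all pairs, to which the counts above apply without reference to [n]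
    or to the finite type of boxes; the value 0 off the shape is a dummy. *)
Definition entry (A : skew_shape) (n : nat) (T : filling A n) (x : nat * nat) : nat :=
  if insub x is Some b then T b else 0.

Lemma entryE A n (T : filling A n) b : entry T (val b) = T b.
Proof. by rewrite /entry valK. Qed.

Lemma entry_inj A n (T U : filling A n) :
  {in boxes A, entry T =1 entry U} -> T = U.
Proof. by move=> h; apply/ffunP => b; apply: ord_inj; rewrite -!entryE; apply: h; exact: valP. Qed.

Lemma semistandardP A n (T : filling A n) : reflect (ssyt A (entry T)) (semistandard T).
Proof.
apply: (iffP forallP) => [H b c hb hc|H b].
  have /forallP /(_ (SeqSub hc)) /andP[] := H (SeqSub hb).
  have := entryE T (SeqSub hb); have := entryE T (SeqSub hc) => /= -> ->.
  by move=> /implyP h1 /implyP h2; split=> e l; [apply: h1|apply: h2]; rewrite e eqxx.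
apply/forallP => c; have [h1 h2] := H _ _ (valP b) (valP c).
rewrite -!entryE; apply/andP; split; apply/implyP => /andP[/eqP e l]; first exact: h1.
exact: h2.
Qed.

Lemma weightE A n (T : filling A n) (i : 'I_n) : content T i = weight A (entry T) i.
Proof.
rewrite mnmE /weight -(sum_seq_sub (fun b => entry T b == i) (boxes_uniq A)).
by apply: eq_card => b; rewrite !inE entryE.
Qed.

Section AgreeOnBoxes.
Variables (A : skew_shape) (f g : nat * nat -> nat).
Hypothesis fg : {in boxes A, f =1 g}.

Lemma right_count_agree j v : right_count A f j v = right_count A g j v.
Proof. by apply: eq_in_count => b /fg ->. Qed.
Lemma left_count_agree j v : left_count A f j v = left_count A g j v.
Proof. by apply: eq_in_count => b /fg ->. Qed.
Lemma weight_agree v : weight A f v = weight A g v.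
Proof. by apply: eq_in_count => b /fg ->. Qed.
Lemma ssyt_agree : ssyt A f -> ssyt A g.
Proof. by move=> h b c hb hc; rewrite -!fg //; apply: h. Qed.
Lemma lattice_agree : lattice A f -> lattice A g.
Proof. by move=> h j v; rewrite -!right_count_agree. Qed.
Lemma matches_agree p : matches A f p -> matches A g p.
Proof. by move=> [h1 h2]; split=> // b m hb; rewrite -fg // h2. Qed.
End AgreeOnBoxes.

(** * The Bender-Knuth move on tableaux *)

Section BenderKnuthFilling.
Variables (A : skew_shape) (n k j : nat).
Hypothesis kn : k.+1 < n.

Definition bk (T : filling A n) : filling A n :=
  [ffun b => insubd (T b) (bk_fun k j (entry T) (threshold A (entry T)) (val b))].

Lemma entry_bk T : {in boxes A, entry (bk T) =1 bk_fun k j (entry T) (threshold A (entry T))}.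
Proof.
move=> b hb; rewrite -[b]/(val (SeqSub hb)) entryE ffunE val_insubd.
suff -> : bk_fun k j (entry T) (threshold A (entry T)) (val (SeqSub hb)) < n by [].
rewrite /bk_fun; case: ifP => _; last by rewrite entryE.
by case: ifP => _ //; apply: ltnW.
Qed.

Section OneFilling.
Variable T : filling A n.
Hypotheses (ssT : semistandard T) (free : bk_free k j (threshold A (entry T))).

Let mt : matches A (entry T) (threshold A (entry T)).
Proof. by apply: threshold_matches; apply/semistandardP. Qed.
Let it : interlacing (threshold A (entry T)).
Proof. by apply: ssyt_interlacing mt; apply/semistandardP. Qed.

Lemma bk_matches : matches A (entry (bk T)) (bk_thr k j (threshold A (entry T))).
Proof.
apply: (matches_agree (f := bk_fun k j (entry T) (threshold A (entry T)))).
  by move=> b hb; rewrite entry_bk.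
exact: bk_fun_matches.
Qed.

Lemma bk_semistandard : semistandard (bk T).
Proof.
by apply/semistandardP; apply: interlacing_ssyt bk_matches; apply: bk_thr_interlacing.
Qed.

Lemma threshold_bk : threshold A (entry (bk T)) = bk_thr k j (threshold A (entry T)).
Proof.
apply/funext => m; apply/funext => i; apply: (matches_uniq _ bk_matches).
by apply: threshold_matches; apply/semistandardP/bk_semistandard.
Qed.

Lemma bkK : bk (bk T) = T.
Proof.
apply: entry_inj => b hb; rewrite entry_bk // threshold_bk.
rewrite -[RHS](bk_funK mt it free hb) /bk_fun entry_bk //.
Qed.

Lemma right_count_bk j' v : j <= j' ->
  right_count A (entry (bk T)) j' v = right_count A (entry T) j' v.
Proof. by move=> jj; rewrite (right_count_agree (@entry_bk T)) bk_fun_right. Qed.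

Lemma weight_bk v :
  weight A (entry (bk T)) v = right_count A (entry T) j v +
   left_count A (entry T) j (if v == k then k.+1 else if v == k.+1 then k else v).
Proof.
rewrite (weight_split _ _ j) right_count_bk // (left_count_agree (@entry_bk T)).
have [h1 h2] := bk_fun_left mt it free.
case: (eqVneq v k) => [->|n1]; first by rewrite h1.
case: (eqVneq v k.+1) => [->|n2]; first by rewrite h2.
by rewrite bk_fun_left_other.
Qed.
End OneFilling.
End BenderKnuthFilling.

Local Open Scope ring_scope.

Section Alternants.
Variable n : nat.

Local Notation "m # s" := [multinom m (s i) | i < n] (at level 40, left associativity, format "m # s").

Definition alternant (m : 'X_{1..n}) : {mpoly int[n]} :=
  \sum_(s : 'S_n) (-1) ^+ s *: 'X_[m#s].

Definition staircase : 'X_{1..n} := [multinom (n - i.+1)%N | i < n].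

Lemma alternant_tperm (m : 'X_{1..n}) (i j : 'I_n) : i != j ->
  alternant (m#(tperm i j)) = - alternant m.
Proof.
move=> ij; rewrite /alternant -sumrN (reindex_inj (mulIg (tperm i j))) /=.
apply: eq_bigr => s _; rewrite -mpermM odd_permM odd_tperm ij.
rewrite -mulgA tperm2 mulg1 signr_addb expr1 mulrN1 scaleNr //.
Qed.

(** Conjugation by an adjacent transposition shortens the distance of the two transposed indices,
    and transpositions generate the symmetric group. *)
Lemma symmetric_adjacent (p : {mpoly int[n]}) :
  (forall i j : 'I_n, j = i.+1 :> nat -> msym (tperm i j) p = p) ->
  forall s : 'S_n, msym s p = p.
Proof.
move=> H.
have Ht d (i j : 'I_n) : (j = i + d.+1 :> nat)%N -> msym (tperm i j) p = p.
  elim: d i j => [|d IH] i j e; first by apply: H; lia.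
  have hk : (i + d.+1 < n)%N by have := ltn_ord j; lia.
  pose k := Ordinal hk.
  have -> : tperm i j = (tperm k j * tperm i k * tperm k j)%g.
    rewrite -{1}(tpermV k j) -mulgA -/(conjg _ _) tpermJ tpermL tpermD //.
      by rewrite -val_eqE /=; lia.
    by rewrite -val_eqE /=; lia.
  have hkj : j = k.+1 :> nat by rewrite e /= addnS.
  by rewrite !msymMm (H k j hkj) (IH i k erefl) (H k j hkj).
have Ht' (i j : 'I_n) : msym (tperm i j) p = p.
  case: (ltngtP i j) => h.
  - by apply: (Ht (j - i).-1); lia.
  - by rewrite tpermC; apply: (Ht (i - j).-1); lia.
  - by rewrite (val_inj h) tperm1 msym1m.
move=> s; have [ts -> _] := prod_tpermP s.
elim: ts => [|t ts IH]; first by rewrite big_nil msym1m.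
by rewrite big_cons msymMm Ht'.
Qed.

(** By symmetry, the second factor may be permuted along with each monomial of the alternant. *)
Lemma alternant_mul_symmetric (I : finType) (P : pred I) (w : I -> 'X_{1..n}) (m : 'X_{1..n}) :
  (forall s : 'S_n, msym s (\sum_(t | P t) 'X_[w t]) = \sum_(t | P t) 'X_[w t] :> {mpoly int[n]}) ->
  alternant m * \sum_(t | P t) 'X_[w t] = \sum_(t | P t) alternant (m + w t)%MM.
Proof.
move=> H; rewrite /alternant exchange_big mulr_suml; apply: eq_bigr => s _.
rewrite -[X in _ * X](H s^-1%g) raddf_sum /= mulr_sumr; apply: eq_bigr => t _.
rewrite msymX invgK -scalerAl -mpolyXD; congr (_ *: 'X_[_]).
by apply/mnmP => i; rewrite !mnmE.
Qed.

Lemma msymX_sum (I : finType) (P : pred I) (w : I -> 'X_{1..n}) (s : 'S_n) :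
  msym s (\sum_(t | P t) 'X_[w t]) = \sum_(t | P t) 'X_[(w t)#(s^-1)%g] :> {mpoly int[n]}.
Proof. by rewrite raddf_sum; apply: eq_bigr => t _; rewrite /= msymX. Qed.

Definition decreasing (m : 'X_{1..n}) := forall i j : 'I_n, (i < j)%N -> (m j < m i)%N.

(** [s] preserves the order of the indices, hence so does its inverse, and a map that strictly
    preserves the order lowers no index. *)
Lemma decreasing_perm (m m' : 'X_{1..n}) (s : 'S_n) : decreasing m -> decreasing m' ->
  m#s = m' -> s = 1%g.
Proof.
move=> dm dm' E.
have mono (i j : 'I_n) : (i < j)%N -> (s i < s j)%N.
  move=> ij; have := dm' _ _ ij; rewrite -E !mnmE ltnNge => h.
  case: (ltngtP (s i) (s j)) => // h'.
    by have := dm _ _ h'; lia.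
  by move: h; rewrite (val_inj h') leqnn.
have ge (t : 'S_n) : (forall i j : 'I_n, (i < j)%N -> (t i < t j)%N) -> forall i : 'I_n, (i <= t i)%N.
  move=> mt [i hi]; elim: i hi => [|i IH] hi //.
  by apply: leq_ltn_trans (mt (Ordinal (ltnW hi)) (Ordinal hi) (ltnSn i)); apply: IH.
have mono' (i j : 'I_n) : (i < j)%N -> (s^-1%g i < s^-1%g j)%N.
  move=> ij; case: (ltngtP (s^-1%g i) (s^-1%g j)) => // h.
    by have := mono _ _ h; rewrite !permKV; lia.
  by move: ij; rewrite (perm_inj (val_inj h)) ltnn.
apply/perm.permP => i; rewrite perm1; apply/val_inj/eqP; rewrite eqn_leq (ge _ mono) andbT.
by have := ge _ mono' (s i); rewrite permK.
Qed.

(** An orbit of exponents contains at most one strictly decreasing one, so these coefficients tell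
    alternants apart. *)
Lemma alternant_coeff (m m' : 'X_{1..n}) : decreasing m -> decreasing m' ->
  (alternant m)@_m' = (m == m')%:R.
Proof.
move=> dm dm'; rewrite /alternant raddf_sum /= (bigD1 1%g) //= big1 ?addr0.
  by rewrite mcoeffZ odd_perm1 expr0 mul1r mcoeffX mperm1.
move=> s s1; rewrite mcoeffZ mcoeffX; case: eqP => [E|]; last by rewrite mulr0.
by rewrite (decreasing_perm dm dm' E) eqxx in s1.
Qed.

Lemma staircase_decreasing (m : 'X_{1..n}) :
  (forall i j : 'I_n, (i <= j)%N -> (m j <= m i)%N) -> decreasing (staircase + m)%MM.
Proof.
move=> H i j ij; rewrite !mnmDE !mnmE; have := H i j (ltnW ij); have := ltn_ord j; lia.
Qed.

Lemma alternant_staircase_neq0 : alternant staircase != 0.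
Proof.
apply/eqP => E.
have h0 : decreasing (staircase + 0)%MM by apply: staircase_decreasing => i j _; rewrite !mnmE.
rewrite addm0 in h0.
by have := alternant_coeff h0 h0; rewrite E mcoeff0 eqxx.
Qed.
End Alternants.

Local Close Scope ring_scope.

(** * Lattice fillings and the partitions they define *)

Lemma ssyt_se A f i j i' j' : ssyt A f -> (i, j) \in boxes A -> (i', j') \in boxes A ->
  i <= i' -> j <= j' -> f (i, j) <= f (i', j').
Proof.
move=> ss hb hc ii jj; have hd : (i, j') \in boxes A.
  by move: hb hc; rewrite !mem_boxes; have := out_anti A ii; lia.
have [/(_ erefl jj) h1 _] := ss _ _ hb hd; apply: leq_trans h1 _.
case: (ltngtP i i') ii => // [l _|<- //].
by have [_ /(_ erefl l)] := ss _ _ hd hc; apply: ltnW.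
Qed.

(** Take the leftmost column [j] in which rows up to [i] contain a [v.+1], and compare the letters
    from [j] on. An entry [v] there lies strictly above row [i], because everything weakly
    south-east of that [v.+1] is at least [v.+1]. *)
Lemma lattice_rows A f i v : ssyt A f -> lattice A f ->
  count (fun b => (b.1 <= i) && (f b == v.+1)) (boxes A) <=
  count (fun b => (b.1 < i) && (f b == v)) (boxes A).
Proof.
move=> ss la; set P := fun b => _.
case: (boolP (has P (boxes A))) => [/hasP [b hb Pb]|]; last by rewrite has_count -leqNgt leqn0 => /eqP ->.
have exj : exists j, has (fun b => P b && (b.2 == j)) (boxes A).
  by exists b.2; apply/hasP; exists b; rewrite ?Pb ?eqxx.
case: (ex_minnP exj) => j /hasP [[i0 j0] hb0 /andP[/andP[/= i0i /eqP f0] /eqP e]] minj.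
subst j0; apply: (@leq_trans (right_count A f j v.+1)).
  rewrite /right_count -!size_filter.
  apply: uniq_leq_size; first by rewrite filter_uniq ?boxes_uniq.
  move=> c; rewrite !mem_filter => /andP[Pc hc]; rewrite hc andbT.
  case/andP: (Pc) => _ ->; rewrite andbT; apply: minj.
  by apply/hasP; exists c; rewrite ?Pc ?eqxx.
apply: leq_trans (la j v) _.
rewrite /right_count -!size_filter.
apply: uniq_leq_size; first by rewrite filter_uniq ?boxes_uniq.
move=> [i' j']; rewrite !mem_filter /= => /andP[/andP[jj /eqP fv] hc]; rewrite hc andbT fv eqxx andbT.
rewrite ltnNge; apply/negP => ii.
by have := ssyt_se ss hb0 hc (leq_trans i0i ii) jj; rewrite f0 fv ltnn.
Qed.

(** By [lattice_rows], an entry [v.+1] requires an entry [v] in a strictly higher row. *)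
Lemma lattice_entry_le A f b : ssyt A f -> lattice A f -> b \in boxes A -> f b <= b.1.
Proof.
move=> ss la; move: {2}(f b) (erefl (f b)) => v; elim: v b => [|v IH] b fb hb; first by rewrite fb.
have : 0 < count (fun c => (c.1 <= b.1) && (f c == v.+1)) (boxes A).
  by rewrite -has_count; apply/hasP; exists b; rewrite ?leqnn ?fb ?eqxx.
move=> /leq_trans /(_ (lattice_rows b.1 v ss la)); rewrite -has_count => /hasP [c hc /andP[cb /eqP fc]].
by rewrite fb; apply: leq_ltn_trans cb; rewrite -fc; apply: IH.
Qed.

Lemma weight_right0 A f v : weight A f v = right_count A f 0 v.
Proof. by apply: eq_count => b. Qed.

Lemma lattice_weight_anti A f u v : lattice A f -> u <= v -> weight A f v <= weight A f u.
Proof.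
move=> la; elim: v => [|v IH]; first by rewrite leqn0 => /eqP ->.
rewrite leq_eqVlt ltnS => /predU1P [-> //|/IH]; apply: leq_trans.
by rewrite !weight_right0.
Qed.

Lemma box_row_lt A b : b \in boxes A -> b.1 < size (outer A).
Proof. by rewrite mem_boxesE -part_nth_gt0; lia. Qed.

Lemma lattice_weight_far A f v : ssyt A f -> lattice A f -> size (outer A) <= v -> weight A f v = 0.
Proof.
move=> ss la h; apply/eqP; rewrite -leqn0 leqNgt -has_count; apply/hasP => -[b hb /eqP fb].
by have := lattice_entry_le ss la hb; have := box_row_lt hb; lia.
Qed.

(** Meant for antitone [g] with [g m = 0]; for other [g] the list need not be a partition, and
    [insubd] then returns the empty one. *)
Definition part_of (g : nat -> nat) (m : nat) : intpart :=
  insubd intpart0 [seq g i | i <- iota 0 m & 0 < g i].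

Lemma nth_part_of g m i : (forall i j, i <= j -> g j <= g i) -> g m = 0 ->
  nth 0 (part_of g m) i = g i.
Proof.
move=> anti gm.
have [l lm Hl] : exists2 l, l <= m & forall i, (0 < g i) = (i < l).
  have ex : exists l, g l == 0 by exists m; rewrite gm.
  case: (ex_minnP ex) => l /eqP gl minl; exists l; first by apply: minl; rewrite gm.
  move=> k; case: (ltnP k l) => kl.
    by rewrite lt0n; apply/negP => /minl; rewrite leqNgt kl.
  by have := anti _ _ kl; rewrite gl; lia.
have E : [seq g i | i <- iota 0 m & 0 < g i] = [seq g i | i <- iota 0 l].
  congr map; rewrite -(subnKC lm) iotaD filter_cat add0n.
  rewrite (_ : filter _ (iota l _) = [::]) ?cats0.
    by apply/all_filterP/allP => k; rewrite mem_iota Hl.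
  by apply/eqP; rewrite -[_ == _]negbK -has_filter; apply/hasP => -[k]; rewrite mem_iota Hl; lia.
rewrite /part_of val_insubd E.
have -> : is_intpart [seq g i | i <- iota 0 l].
  apply/andP; split; last first.
    by apply/mapP => -[k]; rewrite mem_iota add0n /= -Hl; lia.
  apply/(sortedP 0) => k; rewrite size_map size_iota => kl.
  by rewrite !(nth_map 0) ?size_iota ?nth_iota //; try lia; apply: anti.
case: (ltnP i l) => il; first by rewrite (nth_map 0) ?size_iota // nth_iota.
rewrite nth_default ?size_map ?size_iota //.
by apply/esym/eqP; rewrite -leqn0 leqNgt Hl -leqNgt.
Qed.

Definition lr_shape (A : skew_shape) (f : nat * nat -> nat) : intpart :=
  part_of (weight A f) (size (outer A)).

Lemma nth_lr_shape A f i : ssyt A f -> lattice A f -> nth 0 (lr_shape A f) i = weight A f i.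
Proof.
move=> ss la; apply: nth_part_of; last exact: lattice_weight_far.
by move=> u v; apply: lattice_weight_anti.
Qed.

Lemma lr_shape_agree A f g : {in boxes A, f =1 g} -> lr_shape A f = lr_shape A g.
Proof. by move=> h; congr part_of; apply/funext => v; apply: weight_agree. Qed.

Section Straight.
Variable lam : intpart.

Lemma mem_straight b : (b \in boxes (straight lam)) = (b.2 < nth 0 lam b.1).
Proof. by rewrite mem_boxesE /= nth_nil. Qed.

Lemma straight_entry_ge f b : ssyt (straight lam) f -> b \in boxes (straight lam) -> b.1 <= f b.
Proof.
move=> ss; case: b => i j /=; elim: i => // i IH hb.
have hc : (i, j) \in boxes (straight lam).
  by move: hb; rewrite !mem_straight /= => /leq_trans; apply; apply: part_nth_anti.
by have [_ /(_ erefl (ltnSn i))] := ss _ _ hc hb; apply: leq_ltn_trans; apply: IH.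
Qed.

Lemma count_straight j v :
  count (fun b => (j <= b.2) && (b.1 == v)) (boxes (straight lam)) = nth 0 lam v - j.
Proof.
rewrite count_boxes /=.
case: (ltnP v (size lam)) => vl; last first.
  rewrite big1 => [|i _]; first by rewrite nth_default.
  rewrite big1 // => c _; have : nat_of_ord i != v by apply: contraTneq vl => <-; rewrite -ltnNge; exact: ltn_ord.
  by move=> /negPf ->; rewrite andbF.
rewrite (bigD1 (Ordinal vl)) //= [X in _ + X]big1 ?addn0 => [|i iv]; last first.
  by rewrite big1 // => c _; rewrite -val_eqE in iv; rewrite (negPf iv) andbF.
rewrite nth_nil; case: (leqP j (nth 0 lam v)) => h.
  by rewrite (sum_range (u := j) (v := nth 0 lam v)) // => c /=; rewrite eqxx andbT => /= ->; rewrite andbT.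
rewrite big_nat_cond big1; first lia.
by move=> c /andP[/= hc _]; rewrite eqxx andbT leqNgt (ltn_trans hc h).
Qed.

Definition superstandard (b : nat * nat) : nat := b.1.

Lemma superstandard_ssyt : ssyt (straight lam) superstandard.
Proof. by move=> b c _ _; rewrite /superstandard; split=> [->|]. Qed.

Lemma superstandard_right j v : right_count (straight lam) superstandard j v = nth 0 lam v - j.
Proof. exact: count_straight. Qed.

Lemma superstandard_weight v : weight (straight lam) superstandard v = nth 0 lam v.
Proof. by rewrite weight_right0 superstandard_right subn0. Qed.

Lemma superstandard_lattice : lattice (straight lam) superstandard.
Proof. by move=> j v; rewrite !superstandard_right leq_sub2r // part_nth_anti. Qed.

(** Column strictness bounds each entry below by its row, the lattice condition bounds it above. *)
Lemma straight_lattice_uniq f : ssyt (straight lam) f -> lattice (straight lam) f ->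
  {in boxes (straight lam), f =1 superstandard}.
Proof.
move=> ss la b hb; apply/eqP; rewrite eqn_leq (straight_entry_ge ss hb) andbT.
exact: (lattice_entry_le ss la hb).
Qed.
End Straight.

(** * The Littlewood-Richardson rule *)

Definition lr_filling (A : skew_shape) (n : nat) (T : filling A n) : bool :=
  semistandard T && `[< lattice A (entry T) >].

Lemma lr_fillingP A n (T : filling A n) :
  reflect (ssyt A (entry T) /\ lattice A (entry T)) (lr_filling T).
Proof.
apply: (iffP andP) => [[/semistandardP ? /asboolP ?]|[? ?]]; first by [].
by split; [apply/semistandardP|apply/asboolP].
Qed.

Lemma weight_filling_far A n (T : filling A n) v : n <= v -> weight A (entry T) v = 0.
Proof.
move=> nv; apply/eqP; rewrite -leqn0 leqNgt -has_count; apply/hasP => -[b hb /eqP fb].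
by have := ltn_ord (T (SeqSub hb)); rewrite -entryE /= fb ltnNge nv.
Qed.

Lemma right_filling_far A n (T : filling A n) j v : n <= v -> right_count A (entry T) j v = 0.
Proof.
move=> nv; have := weight_split A (entry T) j v; rewrite weight_filling_far //; lia.
Qed.

Local Open Scope ring_scope.

Section Straightening.
Variables (A : skew_shape) (n : nat).

Local Notation "m # s" := [multinom m (s i) | i < _] (at level 40, left associativity, format "m # s").

Lemma content_bk (T : filling A n) (k : nat) j (i1 i2 : 'I_n) :
  (k.+1 < n)%N -> semistandard T -> bk_free k j (threshold A (entry T)) ->
  i1 = k :> nat -> i2 = k.+1 :> nat ->
  right_count A (entry T) j k = right_count A (entry T) j k.+1 ->
  content (bk k j T) = (content T)#(tperm i1 i2).
Proof.
move=> kn ss fr e1 e2 E; apply/mnmP => i; rewrite weightE weight_bk // mnmE weightE.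
rewrite (weight_split _ _ j).
case: tpermP => [->|->|n1 n2].
- by rewrite e1 e2 eqxx E.
- by rewrite e1 e2 eqxx; case: eqP => [|_]; [lia|rewrite -E].
- have /negPf -> : nat_of_ord i != k by apply/eqP => e; apply: n1; apply: ord_inj; rewrite e1.
  by have /negPf -> : nat_of_ord i != k.+1 by apply/eqP => e; apply: n2; apply: ord_inj; rewrite e2.
Qed.

Lemma involution_reindex (P : pred (filling A n)) (h : filling A n -> filling A n)
    (V : zmodType) (F : filling A n -> V) :
  (forall T, P T -> P (h T)) -> (forall T, P T -> h (h T) = T) ->
  \sum_(T | P T) F T = \sum_(T | P T) F (h T).
Proof.
move=> hP hK; rewrite (reindex_onto h h) => [|T]; last exact: hK.
apply: eq_bigl => T; apply/andP/idP => [[h1 /eqP h2]|PT]; first by rewrite -h2; apply: hP.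
by split; [exact: hP|rewrite hK].
Qed.

(** With the cut at column [out A 0], beyond all boxes, the move is the ordinary Bender-Knuth
    involution and exchanges the full multiplicities of two adjacent letters. *)
Lemma skew_schur_symmetric s : msym s (skew_schur A n) = skew_schur A n.
Proof.
move: s; apply: symmetric_adjacent => i1 i2 e2.
have kn : (i1.+1 < n)%N by rewrite -e2.
have fr (T : filling A n) : semistandard T -> bk_free i1 (out A 0) (threshold A (entry T)).
  move=> /semistandardP /threshold_matches [pb _] i; have := pb i1.+1 i.
  by have := out_anti A (leq0n i); lia.
rewrite /skew_schur msymX_sum tpermV [RHS](@involution_reindex _ (bk i1 (out A 0))).
- apply: eq_bigr => T ss; congr 'X_[_].
  have E : right_count A (entry T) (out A 0) i1 = right_count A (entry T) (out A 0) i1.+1.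
    by rewrite !right_count_far.
  by rewrite (content_bk kn ss (fr T ss) erefl e2 E).
- by move=> T ss; exact: (bk_semistandard kn ss (fr T ss)).
- by move=> T ss; exact: (bkK kn ss (fr T ss)).
Qed.

(** In the columns from [j] on there is one more [k.+1] than [k], and the staircase drops by one
    from [k] to [k.+1]. Swapping the counts to the left of [j] therefore transposes the exponent,
    which changes the sign of the alternant. *)
Lemma failure_cancels (j k : nat) :
  \sum_(T : filling A n | semistandard T && `[< first_failure A n (entry T) j k >])
    alternant (staircase n + content T)%MM = 0.
Proof.
pose P (T : filling A n) := semistandard T && `[< first_failure A n (entry T) j k >].
rewrite -/(\sum_(T | P T) alternant (staircase n + content T)%MM).
case: (ltnP k.+1 n) => kn; last first.
  by rewrite big1 // => T /andP[_ /asboolP [h _ _ _]]; lia.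
have Pfree T : P T -> bk_free k j (threshold A (entry T)) /\
    right_count A (entry T) j k.+1 = (right_count A (entry T) j k).+1.
  move=> /andP[/semistandardP ss /asboolP ff].
  by apply: first_failure_free ff => //; apply: threshold_matches.
have Pss T : P T -> semistandard T by case/andP.
have E : \sum_(T | P T) alternant (staircase n + content T)%MM =
   - \sum_(T | P T) alternant (staircase n + content T)%MM.
  rewrite {1}(@involution_reindex P (bk k j)).
  - rewrite -sumrN; apply: eq_bigr => T PT; have [fr rc] := Pfree T PT.
    have kn' : (k < n)%N by apply: ltnW.
    pose i1 := Ordinal kn'; pose i2 := Ordinal kn.
    rewrite -(@alternant_tperm _ _ i1 i2); last by rewrite -val_eqE /=; lia.
    congr alternant; apply/mnmP => i; rewrite mnmDE [RHS]mnmE mnmDE !weightE.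
    rewrite (weight_bk kn (Pss T PT) fr) (weight_split _ _ j) /staircase !mnmE; case: tpermP => [->|->|n1 n2] /=.
    + by rewrite eqxx rc; lia.
    + by rewrite eqxx rc; case: eqP => [|_]; lia.
    + have /negPf -> : nat_of_ord i != k by apply/eqP => e; apply: n1; apply: ord_inj; rewrite e.
      by have /negPf -> : nat_of_ord i != k.+1 by apply/eqP => e; apply: n2; apply: ord_inj; rewrite e.
  - move=> T PT; have [fr rc] := Pfree T PT; apply/andP; split; first exact: (bk_semistandard kn (Pss T PT) fr).
    case/andP: (PT) => _ /asboolP [h1 h2 h3 h4]; apply/asboolP; split => //.
    + by rewrite !right_count_bk ?Pss.
    + by move=> j' k' jj kk; rewrite !right_count_bk ?Pss ?h3 //; apply: ltnW.
    + by move=> k' kk; rewrite !right_count_bk ?Pss ?h4.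
  - by move=> T PT; have [fr rc] := Pfree T PT; exact: (bkK kn (Pss T PT) fr).
apply/mpolyP => m; have := congr1 (mcoeff m) E; rewrite mcoeffN mcoeff0.
by move: (mcoeff m _) => x; lia.
Qed.

Lemma alternant_mul_skew :
  alternant (staircase n) * skew_schur A n =
  \sum_(T : filling A n | lr_filling T) alternant (staircase n + content T)%MM.
Proof.
rewrite alternant_mul_symmetric; last exact: skew_schur_symmetric.
rewrite (bigID (@lr_filling A n)) /= [X in _ + X](_ : _ = 0) ?addr0.
  by apply: eq_bigl => T; rewrite /lr_filling andbA andbb.
pose J := (out A 0).+1; pose W := ('I_J * 'I_n)%type.
have ffb (T : filling A n) j k : first_failure A n (entry T) j k -> (j < J)%N /\ (k < n)%N.
  case=> kn h _ _; split; last exact: ltnW.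
  by rewrite ltnNge; apply/negP => hj; move: h; rewrite !right_count_far // ltnW.
(* The inner sum has exactly one term; inserting it allows the fillings to be grouped by their first
   failure. *)
transitivity (\sum_(T : filling A n | semistandard T && ~~ lr_filling T)
   \sum_(x : W | `[< first_failure A n (entry T) x.1 x.2 >]) alternant (staircase n + content T)%MM).
  apply: eq_bigr => T /andP[ss nl].
  have [j [k ff]] : exists j k, first_failure A n (entry T) j k.
    apply: first_failure_ex; apply: contrapT => H; move/negP: nl; apply.
    rewrite /lr_filling ss; apply/asboolP => j v; rewrite leqNgt; apply/negP => h.
    apply: H; exists j, v; split=> //; rewrite ltnNge; apply/negP => nv.
    by move: h; rewrite (right_filling_far T j nv).
  have [hj hk] := ffb _ _ _ ff.
  rewrite (big_pred1 ((Ordinal hj, Ordinal hk) : W)) // => -[j' k'] /=.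
  apply/asboolP/eqP => [ff'|[-> ->] //].
  by have [e1 e2] := first_failure_uniq ff' ff; congr (_, _); apply: ord_inj.
rewrite (exchange_big_dep xpredT) //= big1 // => -[j k] _ /=.
rewrite -[RHS](failure_cancels j k); apply: eq_bigl => T.
case: (boolP (semistandard T)) => ss //=; rewrite andb_idl // => /asboolP [kn h _ _].
by apply/negP => /lr_fillingP [_ /(_ j k)]; rewrite leqNgt h.
Qed.
End Straightening.

Local Close Scope ring_scope.

Lemma filling_of_fun A n (f : nat * nat -> nat) :
  (forall b, b \in boxes A -> f b < n) ->
  exists T : filling A n, {in boxes A, entry T =1 f}.
Proof.
move=> H; exists [ffun b => Ordinal (H (val b) (valP b))] => b hb.
by rewrite -[b]/(val (SeqSub hb)) entryE ffunE.
Qed.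

Lemma lr_filling_agree A n (T : filling A n) f : {in boxes A, entry T =1 f} ->
  ssyt A f -> lattice A f -> lr_filling T.
Proof.
move=> h ss la; have h' : {in boxes A, f =1 entry T} by move=> b hb; rewrite h.
by apply/lr_fillingP; split; [apply: ssyt_agree ss|apply: lattice_agree la].
Qed.

Local Open Scope ring_scope.

Definition part_exponent n (lam : intpart) : 'X_{1..n} := [multinom nth 0%N lam i | i < n].

Lemma part_exponent_decreasing n lam : decreasing (staircase n + part_exponent n lam)%MM.
Proof. by apply: staircase_decreasing => i j ij; rewrite !mnmE part_nth_anti. Qed.

Lemma part_exponent_inj n (lam mu : intpart) : (size lam <= n)%N -> (size mu <= n)%N ->
  part_exponent n lam = part_exponent n mu -> lam = mu.
Proof.
move=> ln mn E; apply: part_ext => i; case: (ltnP i n) => hi.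
  by have := congr1 (fun m : 'X_{1..n} => m (Ordinal hi)) E; rewrite !mnmE.
by rewrite !nth_default //; apply: leq_trans hi.
Qed.

(** The bialternant formula: the only lattice tableau of a straight shape is the superstandard
    one. *)
Lemma alternant_mul_schur n (lam : intpart) : (size lam <= n)%N ->
  alternant (staircase n) * skew_schur (straight lam) n =
  alternant (staircase n + part_exponent n lam)%MM.
Proof.
move=> ln; rewrite alternant_mul_skew.
have [T0 h0] : exists T : filling (straight lam) n, {in boxes (straight lam), entry T =1 superstandard}.
  apply: filling_of_fun => b; rewrite mem_straight /superstandard => hb; apply: leq_trans ln.
  by rewrite -part_nth_gt0; apply: leq_ltn_trans hb.
rewrite (big_pred1 T0) => [|T].
  congr alternant; congr (_ + _)%MM; apply/mnmP => i.
  by rewrite weightE (weight_agree h0) superstandard_weight mnmE.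
apply/lr_fillingP/eqP => [[ss la]|->].
  by apply: entry_inj => b hb; rewrite h0 // (straight_lattice_uniq ss la hb).
apply/lr_fillingP; apply: lr_filling_agree h0 _ _; first exact: superstandard_ssyt.
exact: superstandard_lattice.
Qed.

Lemma schur_eq0 n (lam : intpart) : (n < size lam)%N -> skew_schur (straight lam) n = 0.
Proof.
move=> nl; rewrite /skew_schur big_pred0 // => T; apply/negP => /semistandardP ss.
have hb : (n, 0%N) \in boxes (straight lam) by rewrite mem_straight /= part_nth_gt0.
have := straight_entry_ge ss hb; rewrite -[(n, 0%N)]/(val (SeqSub hb)) entryE /=.
by rewrite leqNgt ltn_ord.
Qed.

Lemma skew_schur_lr A n :
  skew_schur A n = \sum_(T : filling A n | lr_filling T)
    skew_schur (straight (lr_shape A (entry T))) n.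
Proof.
apply: (mulfI (alternant_staircase_neq0 n)); rewrite alternant_mul_skew mulr_sumr.
apply: eq_bigr => T /lr_fillingP [ss la].
rewrite alternant_mul_schur.
  congr alternant; congr (_ + _)%MM; apply/mnmP => i.
  by rewrite weightE mnmE nth_lr_shape.
rewrite leqNgt; apply/negP => h.
move: (part_nth_gt0 (lr_shape A (entry T)) n); rewrite h nth_lr_shape //.
by rewrite weight_filling_far.
Qed.

(** * One expansion for all numbers of variables *)

Section Expansion.
Variable A : skew_shape.

(** Values in [nat], so that fillings with different alphabets can be compared. *)
Let nat_filling := {ffun seq_sub (boxes A) -> nat}.

Let nat_of_filling n (T : filling A n) : nat_filling := [ffun b => nat_of_ord (T b)].

Let nat_entry (t : nat_filling) (x : nat * nat) : nat :=
  if insub x is Some b then t b else 0%N.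

Let nat_entryE t b : nat_entry t (val b) = t b.
Proof. by rewrite /nat_entry valK. Qed.

Let nat_entry_of n (T : filling A n) : nat_entry (nat_of_filling T) = entry T.
Proof.
by apply/funext => x; rewrite /nat_entry /entry; case: insubP => // b _ _; rewrite ffunE.
Qed.

Let lr_list n : seq nat_filling := [seq nat_of_filling T | T <- enum (@lr_filling A n)].

Let lr_list_uniq n : uniq (lr_list n).
Proof.
rewrite map_inj_uniq ?enum_uniq // => T U E; apply/ffunP => b; apply: ord_inj.
by have := congr1 (fun t : nat_filling => t b) E; rewrite !ffunE.
Qed.

Let mem_lr_list n t : t \in lr_list n <->
  [/\ ssyt A (nat_entry t), lattice A (nat_entry t) & forall b, (t b < n)%N].
Proof.
split=> [/mapP [T + ->]|[ss la tn]].
  rewrite mem_enum => /lr_fillingP [ss la]; rewrite nat_entry_of; split=> // b.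
  by rewrite ffunE.
have [T hT] : exists T : filling A n, {in boxes A, entry T =1 nat_entry t}.
  by apply: filling_of_fun => b hb; rewrite -[b]/(val (SeqSub hb)) nat_entryE.
apply/mapP; exists T; first by rewrite mem_enum; apply: lr_filling_agree hT _ _.
by apply/ffunP => b; rewrite ffunE -entryE hT ?nat_entryE //; exact: valP.
Qed.

Let shape_of t := lr_shape A (nat_entry t).

Let N0 := size (outer A).

Let big_lr_list n (V : zmodType) (F : intpart -> V) :
  \sum_(T : filling A n | lr_filling T) F (lr_shape A (entry T)) =
  \sum_(t <- lr_list n) F (shape_of t).
Proof.
rewrite big_map -big_enum; apply: eq_bigr => T _.
by rewrite /shape_of nat_entry_of.
Qed.

(** The alphabet of size [N0] serves every [n]: lattice entries are bounded by the row index, and a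
    filling with an entry at least [n] has a shape with more than [n] rows, whose Schur polynomial
    in [n] variables is zero. *)
Let skew_schur_lr_list n : skew_schur A n =
  \sum_(t <- lr_list N0) skew_schur (straight (shape_of t)) n.
Proof.
rewrite skew_schur_lr (big_lr_list n (fun l => skew_schur (straight l) n)).
rewrite [RHS](bigID (fun t : nat_filling => [forall b, (t b < n)%N])) /=.
rewrite [X in _ = _ + X]big_seq_cond [X in _ = _ + X]big1 ?addr0 => [|t].
  rewrite -[RHS]big_filter; apply: perm_big; apply: uniq_perm.
  - exact: lr_list_uniq.
  - by rewrite filter_uniq ?lr_list_uniq.
  move=> t; rewrite mem_filter; apply/idP/andP.
    move=> /mem_lr_list [ss la tn]; split; first exact/forallP.
    apply/mem_lr_list; split=> // b; rewrite -nat_entryE.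
    apply: leq_ltn_trans (lattice_entry_le ss la (valP b)) (box_row_lt (valP b)).
  by move=> [/forallP tn /mem_lr_list [ss la _]]; apply/mem_lr_list.
move=> /andP[/mem_lr_list [ss la _]] /forallPn [b]; rewrite -leqNgt => nb.
apply: schur_eq0; apply: leq_ltn_trans nb _.
rewrite -part_nth_gt0 nth_lr_shape // /weight -has_count; apply/hasP; exists (val b); first exact: valP.
by rewrite nat_entryE.
Qed.

Let shapes := [seq shape_of t | t <- lr_list N0].

Definition lr_coeff : {fsfun intpart -> int with 0} :=
  [fsfun lam in [fset lam in shapes]%fset => (count_mem lam shapes)%:Z].

Let lr_coeffE lam : lr_coeff lam = (count_mem lam shapes)%:Z.
Proof.
rewrite fsfun_fun in_fset; case: ifP => // /negbT h.
by rewrite (count_memPn h).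
Qed.

Lemma lr_expansion : schur_expansion A lr_coeff.
Proof.
move=> n; rewrite skew_schur_lr_list -(big_map shape_of xpredT (fun l => skew_schur (straight l) n)).
rewrite -/shapes -big_undup_iterop_count; apply: etrans.
  apply: (perm_big (finsupp lr_coeff)); apply: uniq_perm; rewrite ?undup_uniq ?fset_uniq // => l.
  rewrite mem_undup mem_finsupp lr_coeffE.
  by rewrite -has_pred1 has_count lt0n; case: count.
apply: eq_bigr => l _; rewrite lr_coeffE -[LHS]/(_ *+ _).
by rewrite -scaler_nat natz.
Qed.

Lemma lr_coeff_neq0 f (lam : intpart) : ssyt A f -> lattice A f ->
  (forall v, weight A f v = nth 0%N lam v) -> lr_coeff lam != 0.
Proof.
move=> ss la wl; rewrite lr_coeffE.
have [T hT] : exists T : filling A N0, {in boxes A, entry T =1 f}.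
  apply: filling_of_fun => b hb; apply: leq_ltn_trans (lattice_entry_le ss la hb) (box_row_lt hb).
suff : lam \in shapes by rewrite -has_pred1 has_count lt0n; case: count.
apply/mapP; exists (nat_of_filling T).
  by apply/mapP; exists T => //; rewrite mem_enum; apply: lr_filling_agree hT _ _.
rewrite /shape_of nat_entry_of (lr_shape_agree hT).
by apply: part_ext => i; rewrite nth_lr_shape.
Qed.
End Expansion.

Lemma in_support_lr A (lam : intpart) : in_support A lam <->
  exists f, [/\ ssyt A f, lattice A f & forall v, weight A f v = nth 0%N lam v].
Proof.
split=> [[a aA al]|[f [ss la wl]]]; last first.
  by exists (lr_coeff A); [exact: lr_expansion|exact: lr_coeff_neq0 ss la wl].
(* Enough variables for all Schur polynomials of the given expansion to be nonzero and distinct. *)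
pose n := (\max_(mu <- finsupp a) size mu)%N.
have ns mu : mu \in finsupp a -> (size mu <= n)%N by move=> h; apply: leq_bigmax_seq.
have lfin : lam \in finsupp a by rewrite mem_finsupp.
(* This coefficient is [a lam] on the expansion side and counts the lattice fillings of weight [lam]
   on the other. *)
have := congr1 (fun p => (alternant (staircase n) * p)@_(staircase n + part_exponent n lam)%MM) (aA n).
rewrite alternant_mul_skew mulr_sumr !raddf_sum /=.
rewrite [RHS](_ : _ = a lam) => [E|]; last first.
  rewrite (perm_big (lam :: rem lam (finsupp a))) /=; last exact: perm_to_rem.
  rewrite big_cons -scalerAr mcoeffZ alternant_mul_schur ?ns //.
  rewrite alternant_coeff ?eqxx ?mulr1; try exact: part_exponent_decreasing.
  rewrite big_seq big1 ?addr0 // => mu.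
  rewrite mem_rem_uniq ?fset_uniq // inE => /andP[ml mfin].
  rewrite -scalerAr mcoeffZ alternant_mul_schur ?ns //.
  rewrite alternant_coeff; try exact: part_exponent_decreasing.
  case: eqP => [/addmI e|]; last by rewrite mulr0.
  by rewrite (part_exponent_inj (ns _ mfin) (ns _ lfin) e) eqxx in ml.
have [T lrT hT] : exists2 T : filling A n, lr_filling T & content T = part_exponent n lam.
  apply: contrapT => H; move/eqP: al; apply; rewrite -E big1 // => T lrT.
  rewrite alternant_coeff; last exact: part_exponent_decreasing; last first.
    apply: staircase_decreasing => i j ij; rewrite !weightE; apply: lattice_weight_anti ij.
    by case/lr_fillingP: lrT.
  by case: eqP => // /addmI e; case: H; exists T.
case/lr_fillingP: lrT => ss la; exists (entry T); split=> // v.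
case: (ltnP v n) => vn; last by rewrite weight_filling_far // nth_default //; apply: leq_trans (ns _ lfin) vn.
by have := congr1 (fun m : 'X_{1..n} => m (Ordinal vn)) hT; rewrite weightE mnmE.
Qed.

Local Close Scope ring_scope.

(** * Ballot words with prescribed ascents *)

Lemma subset_between (T : finType) (U V : {set T}) k :
  U \subset V -> #|U| <= k <= #|V| -> exists K : {set T}, [/\ U \subset K, K \subset V & #|K| = k].
Proof.
elim: k => [|k IH] UV /andP[Uk kV].
  by exists U; split=> //; apply/eqP; rewrite -leqn0.
case: (ltnP #|U| k.+1) => h; last by exists U; split=> //; apply/eqP; rewrite eqn_leq Uk h.
have [|K [UK KV Kk]] := IH UV; first by apply/andP; split; [exact: h|exact: ltnW].
have : K \proper V by rewrite properEcard KV Kk.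
case/properP => _ [x xV xK]; exists (x |: K); split.
- by apply: subset_trans UK _; apply: subsetU1.
- by rewrite subUset sub1set xV.
- by rewrite cardsU1 xK Kk.
Qed.

(** * Counting boxes in columns of prescribed sizes *)

Section ColumnSizes.
Variables (m : nat) (c : 'I_m -> nat).

Lemma sum_ge_card (F : 'I_m -> nat) (G : {set 'I_m}) k :
  (forall j, j \in G -> k <= F j) -> k * #|G| <= \sum_j F j.
Proof.
move=> H; rewrite (bigID (mem G)) /= mulnC -sum_nat_const.
by apply: leq_trans (leq_addr _ _); apply: leq_sum.
Qed.

Lemma sum_ge_card1 (F : 'I_m -> nat) (G : {set 'I_m}) k x :
  (forall j, j \in G -> k <= F j) -> x \notin G -> k * #|G| + F x <= \sum_j F j.
Proof.
move=> H xG; rewrite (bigID (mem G)) /= mulnC -sum_nat_const.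
apply: leq_add; first exact: leq_sum.
by rewrite (bigD1 x) //= leq_addr.
Qed.

Lemma sum_sizes : \sum_j c j =
  \sum_j (c j - 1) + #|[set j | 2 <= c j]| + #|[set j | c j == 1]|.
Proof.
rewrite -!sum1_card ![\sum_(j in _) 1]big_mkcond -!big_split /=.
by apply: eq_bigr => j _; rewrite !inE; case: (c j) => [|[|x]] //=; lia.
Qed.

Lemma sum_excess_ge : #|[set j | 2 <= c j]| <= \sum_j (c j - 1).
Proof.
rewrite -[X in X <= _]mul1n; apply: sum_ge_card => j; rewrite inE; lia.
Qed.

Lemma sum_excess_remove (J : {set 'I_m}) :
  \sum_j (c j - 1) = \sum_j (c j - (j \in J) - 1) + #|J :&: [set j | 2 <= c j]|.
Proof.
rewrite -sum1_card [\sum_(j in _) 1]big_mkcond -big_split /=.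
by apply: eq_bigr => j _; rewrite !inE; case: (j \in J); case: (c j) => [|[|x]] //=; lia.
Qed.

Lemma sum_remove (J : {set 'I_m}) : (forall j, j \in J -> 1 <= c j) ->
  \sum_j c j = \sum_j (c j - (j \in J)) + #|J|.
Proof.
move=> H; rewrite -sum1_card [\sum_(j in _) 1]big_mkcond -big_split /=.
by apply: eq_bigr => j _; case: (j \in J) (H j) => [/(_ isT)|_] /=; lia.
Qed.
End ColumnSizes.

Definition block_start (alpha : nat -> nat) (l : nat) : nat := \sum_(i < l) alpha i.

Lemma block_startS alpha l : block_start alpha l.+1 = block_start alpha l + alpha l.
Proof. by rewrite /block_start big_ord_recr. Qed.

Lemma block_start_mono alpha i l : i <= l -> block_start alpha i <= block_start alpha l.
Proof.
elim: l => [|l IH]; first by rewrite leqn0 => /eqP ->.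
rewrite leq_eqVlt ltnS => /predU1P [-> //|/IH h].
by rewrite block_startS; apply: leq_trans h (leq_addr _ _).
Qed.

Lemma block_start_bounds alpha q l : (forall i, i < l -> q <= alpha i <= q.+1) ->
  q * l <= block_start alpha l <= q.+1 * l.
Proof.
elim: l => [|l IH] H; first by rewrite /block_start big_ord0 !muln0.
have := IH (fun i h => H i (ltnW h)); have := H l (ltnSn l).
by rewrite block_startS !mulnS; lia.
Qed.

(* The size bookkeeping for peeling the last label off a family of [m] columns
   of sizes [c], labelled by [l] labels; the last label has to be put in column [x]. *)
Definition peelable (m : nat) (alpha : nat -> nat) (l : nat) (c : 'I_m -> nat) (x : 'I_m) : Prop :=
  [/\ \sum_j c j = block_start alpha l, forall j, c j <= l, l <= (\sum_j (c j - 1)).+1 & 1 <= c x] /\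
  (c x = l \/ #|[set j | c j == l]| < alpha l.-1) /\
  ((\sum_j (c j - 1)).+1 = l \/
     (forall j, c j <= (c x).+1) /\ (2 <= c x \/ 2 <= #|[set j | c j == 1]|)).

(** One peeling step: [J] receives the last label and [y] is the column it shares with the label
    before. Removing a box from a column of size at least two lowers the excess, the number of boxes
    below the first row; removing one from a column of size one does not. As many columns of size at
    least two are used as the excess permits, with preference to [x] and to the largest ones, so
    that either the excess becomes tight or [y] is a largest column. *)
Lemma choose_block m alpha q l (c : 'I_m -> nat) (x : 'I_m) :
  2 <= q -> (forall i, i < l.+2 -> q <= alpha i <= q.+1) -> peelable alpha l.+2 c x ->
  exists (J : {set 'I_m}) (y : 'I_m),
    [/\ #|J| = alpha l.+1, x \in J, y \in J & forall j, j \in J -> 1 <= c j] /\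
    peelable alpha l.+1 (fun j => c j - (j \in J)) y.
Proof.
(* The dummy [unit] arguments keep disjunctions and products away from [lia]. *)
move=> q2 Ha [[sumc cl ex cx] [invA0 invB0]].
have {invA0} invA : unit -> _ := fun _ => invA0.
have {invB0} invB : unit -> _ := fun _ => invB0.
pose A2 := [set j | 2 <= c j]; pose S1 := [set j | c j == 1].
pose F := [set j | c j == l.+2].
set e := \sum_j (c j - 1) in ex invB *.
pose a := alpha l.+1; pose a' := alpha l.
have ha : q <= a <= q.+1 by apply: Ha.
have ha' : q <= a' <= q.+1 by apply: Ha; lia.
pose N' := block_start alpha l.+1; pose N'' := block_start alpha l.
have hN' : q * l.+1 <= N' <= q.+1 * l.+1 by apply: block_start_bounds => i hi; apply: Ha; lia.
have hN'' : q * l <= N'' <= q.+1 * l by apply: block_start_bounds => i hi; apply: Ha; lia.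
have NE : \sum_j c j = N' + a by rewrite sumc block_startS.
have N'E : N' = N'' + a' by rewrite /N' block_startS.
pose p := #|A2|; pose s := #|S1|.
have Neps : N' + a = e + p + s by rewrite -NE (sum_sizes c).
have ep : p <= e := sum_excess_ge c.
(* [B] bounds the number of columns of size at least two that may be used: the [l.+1] labels that
   remain need an excess of at least [l]. *)
have [B BE] : exists B, e = B + l by exists (e - l); lia.
have Bge : 1 <= B by lia.
have pge : 1 <= p.
  rewrite lt0n; apply/eqP => p0.
  have : e <= 0; last by lia.
  rewrite leqn0 sum_nat_eq0; apply/forallP => j /=.
  by have := cards0_eq p0 => /setP /(_ j); rewrite !inE; lia.
(* Otherwise fewer than [a] columns, each of size at most [l.+2], could not hold all the boxes. *)
have avail1 : a <= p + s.
  rewrite leqNgt; apply/negP => h.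
  have : \sum_j c j <= l.+2 * (p + s).
    have -> : p + s = #|[set j | 1 <= c j]|.
      rewrite /p /s -cardsUI [A2 :&: S1](_ : _ = set0) ?cards0 ?addn0.
        by apply: eq_card => j; rewrite !inE; case: (c j) => [|[|?]].
      by apply/setP => j; rewrite !inE; case: (c j) => [|[|?]].
    rewrite mulnC -sum_nat_const [X in _ <= X]big_mkcond; apply: leq_sum => j _.
    by rewrite inE; have := cl j; case: (c j) => [|n] //=; lia.
  rewrite NE => h2; have : l.+2 * (p + s) <= l.+2 * a.-1 by rewrite leq_mul2l; lia.
  have : l.+1 * a.-1 <= l.+1 * q by rewrite leq_mul2l; lia.
  rewrite (mulnC q) in hN'; rewrite !mulSn in hN' *; lia.
(* Columns of size one have to fill what the excess does not pay for; here [2 <= q] is essential. *)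
have avail2 : B < p -> a <= B + s.
  have : 2 * l + q <= q * l.+1 by rewrite mulnS addnC leq_add2l leq_mul2r q2 orbT.
  by lia.
(* [sigma] reserves a place for [x] among the columns of size one. *)
have [sigma sigmaE sa] : exists2 sigma : nat, unit -> sigma = (c x == 1) & sigma <= 1.
  by exists (nat_of_bool (c x == 1)) => //; case: (_ == _).
have sigs : sigma <= s.
  rewrite (sigmaE tt); case: eqP => // h; rewrite card_gt0; apply/set0Pn.
  by exists x; rewrite inE h.
have us0 : B <= p -> a <= B + s.
  by rewrite leq_eqVlt => /predU1P [->|/avail2].
(* [t] columns of size at least two and [u] of size one, with [t] as large as possible; the last
   clause records which bound stopped it. *)
have [t [u [[tge tB tp tu] [sigu us tcase]]]] : exists t u,
    [/\ 1 <= t, t <= B, t <= p & t + u = a] /\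
    [/\ sigma <= u, u <= s & unit -> [\/ t = B, t = p | u = sigma]].
  case: (leqP B p) => h1.
    have h0 := us0 h1; case: (leqP B (a - sigma)) => h2.
      by exists B, (a - B); do 2 (split; try lia); move=> _; constructor 1.
    by exists (a - sigma), sigma; do 2 (split; try lia); move=> _; constructor 3.
  case: (leqP p (a - sigma)) => h2.
    by exists p, (a - p); do 2 (split; try lia); move=> _; constructor 2.
  by exists (a - sigma), sigma; do 2 (split; try lia); move=> _; constructor 3.
clear us0.
clear avail1 avail2.
have {hN'} hN' : unit -> _ := fun _ => hN'.
have {hN''} hN'' : unit -> _ := fun _ => hN''.
pose U0 := [set x] :&: A2.
have U0le : #|U0| <= 1 by rewrite (leq_trans (subset_leq_card (subsetIl _ _))) ?cards1.
have U0A : U0 \subset A2 := subsetIr _ _.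
pose M := \max_j c j.
pose Mx := [set j | c j == M].
have cM j : c j <= M by apply: leq_bigmax.
have [j0 j0M] : exists j0, c j0 = M.
  have : 0 < #|'I_m| by apply/card_gt0P; exists x.
  by move/eq_bigmax => /(_ c) [j0 h]; exists j0; rewrite /M h.
have M2 : 2 <= M.
  have : A2 != set0 by rewrite -card_gt0.
  by case/set0Pn => j; rewrite inE => /leq_trans; apply.
have MxA : Mx \subset A2 by apply/subsetP => j; rewrite !inE => /eqP ->.
have XA : U0 :|: Mx \subset A2 by rewrite subUset U0A.
(* [K] contains [x], when it has size at least two. It contains all columns of maximal size if there
   is room for them, and otherwise nothing but them and [x]. *)
have [K [U0K KA Kt] [XK KX]] : exists2 K : {set 'I_m}, [/\ U0 \subset K, K \subset A2 & #|K| = t]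
    & (#|U0 :|: Mx| <= t -> U0 :|: Mx \subset K) /\ (t < #|U0 :|: Mx| -> K \subset U0 :|: Mx).
  case: (leqP #|U0 :|: Mx| t) => h.
    have [|K [h1 h2 h3]] := subset_between XA (k := t); first by rewrite h.
    by exists K; split=> //; apply: subset_trans h1; apply: subsetUl.
  have [|K [h1 h2 h3]] := subset_between (subsetUl U0 Mx) (k := t); first by apply/andP; split; lia.
  by exists K; split=> //; apply: subset_trans h2 XA.
pose V0 := [set x] :&: S1.
have V0S : V0 \subset S1 := subsetIr _ _.
have V0E : #|V0| = sigma.
  rewrite /V0 (sigmaE tt); case: eqP => h.
    by rewrite (setIidPl _) ?cards1 // sub1set inE h.
  by apply/eqP; rewrite cards_eq0; apply/eqP/setP => j; rewrite !inE; case: eqP => //= ->; apply/eqP.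
have [|Sg [V0Sg SgS SgE]] := subset_between V0S (k := u); first by rewrite V0E sigu.
have dis : K :&: Sg = set0.
  apply/setP => j; rewrite !inE; apply/negP => /andP[/(subsetP KA) + /(subsetP SgS)].
  by rewrite !inE; clear; lia.
pose J := K :|: Sg.
have Ja : #|J| = a by rewrite /J cardsU dis cards0 subn0 Kt SgE.
have Jge j : j \in J -> 1 <= c j.
  by rewrite inE => /orP[/(subsetP KA)|/(subsetP SgS)]; rewrite inE; clear; lia.
have xJ : x \in J.
  rewrite inE; case: (ltnP 1 (c x)) => h.
    by rewrite (subsetP U0K) // !inE eqxx h.
  by rewrite (subsetP V0Sg) ?orbT // !inE eqxx /=; move: h cx; clear; lia.
have JA : J :&: A2 = K.
  apply/setP => j; rewrite !inE; case: (boolP (j \in K)) => [/(subsetP KA)|_] /=; first by rewrite inE => ->.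
  by apply/negP => /andP[/(subsetP SgS)]; rewrite inE; clear; lia.
have K0 : exists y, y \in K by apply/set0Pn; rewrite -card_gt0 Kt.
(* A largest column of [K] is shared with the previous label; it keeps at least one box. *)
have [y yK ymax] : exists2 y, y \in K & forall j, j \in K -> c j <= c y.
  have [y0 y0K] := K0; case: (@arg_maxnP _ y0 (mem K) c y0K) => y yK ym.
  by exists y.
exists J, y; split; first by split=> //; rewrite inE yK.
have yA : 2 <= c y by have := subsetP KA _ yK; rewrite inE.
have yJ : y \in J by rewrite inE yK.
have eJ := sum_excess_remove c J; rewrite JA Kt -/e in eJ.
(* Columns of size [l.+2] need every label, hence must all be used now; the counts show that [t] is
   large enough for them and for [x]. *)
have FX : F != set0 -> M = l.+2 /\ U0 :|: Mx \subset K.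
  case/set0Pn => f; rewrite inE => /eqP cf.
  have ML : M = l.+2 by apply/eqP; rewrite eqn_leq -j0M cl j0M -cf cM.
  split=> //; apply: XK.
  have FE : Mx = F by rewrite /F -ML.
  rewrite FE.
  have F1 : 1 <= #|F| by rewrite card_gt0; apply/set0Pn; exists f; rewrite inE cf.
  have Fp : #|U0 :|: F| <= p by apply: subset_leq_card; rewrite -FE.
  have Fe : l.+1 * #|F| <= e by apply: sum_ge_card => j; rewrite inE => /eqP ->; rewrite subn1.
  have FN : l.+2 * #|F| <= N' + a by rewrite -NE; apply: sum_ge_card => j; rewrite inE => /eqP ->.
  case: (boolP (x \in F)) => xF.
    have -> : U0 :|: F = F by apply/setUidPr/subsetP => j; rewrite !inE => /andP[/eqP -> _]; rewrite inE in xF.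
    have sig0 : sigma = 0 by rewrite (sigmaE tt); rewrite inE in xF; rewrite (eqP xF).
    have h1 : #|F| <= B by move: (#|F|) F1 Fe BE => [|n] // _; rewrite mulSn !mulnS; clear; lia.
    have h2 : #|F| <= a.
      rewrite leqNgt; apply/negP => h.
      have : l.+2 * a.+1 <= l.+2 * #|F| by rewrite leq_mul2l h orbT.
      have : l.+1 * q <= l.+1 * a by rewrite leq_mul2l; case/andP: ha => -> _; rewrite orbT.
      have := hN' tt; move: ha FN; rewrite (mulnC q.+1) (mulnC q) !mulnS !mulSn; clear; lia.
    have h3 : #|F| <= p by apply: leq_trans Fp; apply: subset_leq_card; apply: subsetUr.
    by move: h1 h2 h3 tu sig0; case: (tcase tt) => ->; clear; lia.
  have h1 : #|F| < a by case: (invA tt) => // h; move: xF; rewrite inE h eqxx.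
  have Fe1 : l.+1 * #|F| + (c x - 1) <= e by apply: sum_ge_card1 => // j; rewrite inE => /eqP ->; rewrite subn1.
  have U1 : #|U0 :|: F| <= #|F| + (1 - sigma).
    apply: leq_trans (leq_card_setU _ _).1 _; rewrite addnC leq_add2l.
    rewrite (sigmaE tt); case: eqP => h; last by rewrite subn0.
    by rewrite leqn0 cards_eq0; apply/eqP/setP => j; rewrite !inE; case: eqP => //= ->; rewrite h.
  have h2 : #|F| + (1 - sigma) <= B.
    rewrite (sigmaE tt); move: (#|F|) F1 Fe1 BE => [|n] // _; rewrite mulSn !mulnS.
    by move: cx; case: (c x) => [|[|z]] //= _; clear; lia.
  by move: h1 h2 Fp U1 tu sigu sa; case: (tcase tt) => ->; clear; lia.
(* Columns of size one after the removal: those left out of [Sg], and those of [K] if the maximal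
   size is two. *)
have sumC1 : #|[set j | c j - (j \in J) == 1]| >= t * (M == 2) + (s - u).
  have h : (if M == 2 then K else set0) :|: (S1 :\: Sg) \subset [set j | c j - (j \in J) == 1].
    apply/subsetP => j; rewrite !inE => /orP[|/andP[jS c1]].
      case: eqP => [M2'|_]; last by rewrite inE.
      move=> jK; rewrite jK /=; have := subsetP KA _ jK; rewrite inE; have := cM j; rewrite M2'; clear; lia.
    by rewrite (negPf jS) orbF; case: (boolP (j \in K)) => [/(subsetP KA)|_]; rewrite ?inE; move: c1; clear; lia.
  apply: leq_trans (subset_leq_card h); rewrite cardsU cardsD (setIidPr SgS) SgE -/s.
  rewrite [X in _ <= _ - X](_ : _ = 0).
    by case: (M == 2); rewrite /= ?cards0 ?Kt subn0 ?muln1 ?muln0.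
  apply/eqP; rewrite cards_eq0; apply/eqP/setP => j; rewrite !inE.
  apply/negP => /andP[jK /andP[_]]; case: eqP jK => [_ /(subsetP KA)|_]; rewrite inE //; clear; lia.
have sJ := sum_remove Jge.
split; [split|split].
- by move: sJ; rewrite Ja NE -/N' => /eqP; rewrite eqn_add2r => /eqP ->.
- move=> j; case: (eqVneq (c j) l.+2) => cj.
    have [|_ /subsetP h] := FX; first by apply/set0Pn; exists j; rewrite inE cj.
    by rewrite inE h ?inE ?cj /=; [rewrite subn1|rewrite -(FX _).1 ?eqxx ?orbT //; apply/set0Pn; exists j; rewrite inE cj].
  by move: cj (cl j) => /=; clear; lia.
- by move: eJ BE tB => /=; move: (\sum_(j < m) (_ - _ - 1)) => z; clear; lia.
- by rewrite yJ; move: yA; clear; lia.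
(* If some column was full, so was [y], and it is full again for one label fewer. Otherwise, too
   many columns of size [l.+1] outside [J] would exceed the number of boxes or the excess. *)
- rewrite yJ /=.
  case: (eqVneq F set0) => [F0|Fn]; last first.
    left; have [ML XK'] := FX Fn.
    have j0K : j0 \in K by apply: (subsetP XK'); rewrite !inE j0M eqxx orbT.
    by have := ymax _ j0K; have := cl y; rewrite j0M ML; clear; lia.
  right; rewrite ltnNge; apply/negP => Gbig.
  have F0' j : c j <= l.+1.
    have := cl j; rewrite leq_eqVlt => /predU1P [h|//].
    by move/setP: F0 => /(_ j); rewrite !inE h eqxx.
  pose G := [set j | c j == l.+1].
  have GE : [set j | c j - (j \in J) == l.+1] = G :\: J.
    apply/setP => j; have jG : (j \in G) = (c j == l.+1) by rewrite inE.
    by rewrite in_setD jG in_set; have := F0' j; case: (j \in J) => /=; clear; lia.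
  rewrite GE -/a' in Gbig.
  have [g gG] : exists g, g \in G :\: J by apply/set0Pn; rewrite -card_gt0; apply: leq_trans Gbig; move: ha' q2; clear; lia.
  have ML : M = l.+1.
    apply/eqP; rewrite eqn_leq -{1}j0M F0' /=.
    by move: gG; rewrite !inE => /andP[_ /eqP <-].
  have GM : Mx = G by rewrite /G -ML.
  have tX : t < #|U0 :|: Mx|.
    rewrite ltnNge; apply/negP => /XK /subsetP /(_ g); rewrite GM.
    by move: gG; rewrite !inE => /andP[/norP [/negPf -> _] /eqP ->]; rewrite eqxx orbT => /(_ isT).
  have {KX} KX := KX tX; rewrite GM in KX.
  pose delta := nat_of_bool ((2 <= c x) && (x \notin G)).
  have KG : #|K :\: G| <= delta.
    rewrite /delta; case: (boolP (_ && _)) => [_|h].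
      apply: leq_trans U0le; apply: subset_leq_card; apply/subsetP => j; rewrite inE => /andP[jG jK].
      by have := subsetP KX _ jK; rewrite inE (negPf jG) orbF.
    rewrite leqn0 cards_eq0; apply/eqP/setP => j; rewrite !inE; apply/negP => /andP[jG jK].
    have := subsetP KX _ jK; rewrite inE => /orP[|]; last by rewrite inE (negPf jG).
    by rewrite !inE => /andP[/eqP jx c2]; subst j; move: h; rewrite c2 inE jG.
  have Gt : a' + t <= #|G| + delta.
    have h1 : #|G :\: J| <= #|G :\: K| by apply: subset_leq_card; apply: setDS; apply: subsetUl.
    have h2 : a' <= #|G :\: K| := leq_trans Gbig h1.
    have e1 := cardsID K G; have e2 := cardsID G K; rewrite setIC Kt in e2.
    by rewrite -e1 -e2 addnCA -addnA leq_add2l leq_add.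
  have l1 : 1 <= l.
    by case: (l) ML M2 => [->|].
  have Ge : l * #|G| + delta <= e.
    rewrite /delta; case: (boolP (_ && _)) => [/andP[c2 xG]|_].
      apply: leq_trans (_ : l * #|G| + (c x - 1) <= _); first by rewrite leq_add2l; move: c2; clear; lia.
      by apply: sum_ge_card1 => // j; rewrite inE => /eqP ->; rewrite subn1.
    by rewrite addn0; apply: sum_ge_card => j; rewrite inE => /eqP ->; rewrite subn1.
  case: (eqVneq t B) => tB'.
    rewrite tB' in Gt; have : 1 * (#|G| - 1) <= l * (#|G| - 1) by rewrite leq_mul2r l1 orbT.
    have G1 : 1 <= #|G| by move: Gt ha' q2 Bge; rewrite /delta; case: (_ && _); clear; lia.
    rewrite mulnBr muln1; have : l * 1 <= l * #|G| by rewrite leq_mul2l G1 orbT.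
    rewrite muln1; move: Gt Ge BE ha' q2 G1; clear; lia.
  have tE : u = sigma.
    have : #|U0 :|: Mx| <= p := subset_leq_card XA.
    by case: (tcase tt) => h; [case/eqP: tB' | move: tX; rewrite h ltnNge => /negP | ].
  have sd : sigma + delta <= 1 by rewrite (sigmaE tt) /delta; case: eqP => [->|_] //=; case: (_ && _).
  have GN : l.+1 * #|G| <= N' + a by rewrite -NE; apply: sum_ge_card => j; rewrite inE => /eqP ->.
  case: (posnP (sigma + delta)) => sd0.
    have : l.+1 * (a + a') <= l.+1 * #|G| by rewrite leq_mul2l; move: Gt tu tE sd0; clear; lia.
    have : l * (q.+1 + 1) <= l * (a + a') by rewrite leq_mul2l; move: ha ha' q2; clear; lia.
    have := hN'' tt; rewrite mulnDr muln1 mulSn (mulnC l q.+1); move: GN N'E l1; clear; lia.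
  have xG : x \notin G.
    apply/negP => xG; move: sd0; rewrite /delta (sigmaE tt) xG andbF addn0.
    by move: xG; rewrite inE => /eqP ->; case: (l) l1.
  have [C1 C2] : (forall j, c j <= (c x).+1) /\ (2 <= c x \/ 2 <= s).
    by case: (invB tt) => [h|//]; move/eqP: tB'; move: h BE tB tge; clear; lia.
  have cxl : l <= c x by have := C1 j0; rewrite j0M ML.
  have GN1 : l.+1 * #|G| + c x <= N' + a by rewrite -NE; apply: sum_ge_card1 => // j; rewrite inE => /eqP ->.
  have : l.+1 * (a + a' - 1) <= l.+1 * #|G| by rewrite leq_mul2l; move: Gt tu tE sd; clear; lia.
  rewrite mulnBr muln1 mulSn => h1.
  have h2 : l * (q.+1 + 1) <= l * (a + a') by rewrite leq_mul2l; move: ha ha' q2; clear; lia.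
  rewrite mulnDr muln1 (mulnC l q.+1) in h2.
  have l1' : l = 1 by have := hN'' tt; move: h1 h2 GN1 N'E l1 cxl; clear; lia.
  case: C2 => C2; first by have := hN'' tt; move: h1 h2 GN1 N'E l1 C2 l1'; clear; lia.
  have : #|G| <= p by apply: subset_leq_card; rewrite -GM.
  move: h1 h2 (hN'' tt) ep Neps GN1 N'E C2; rewrite l1'; clear; lia.
(* For [t = B] the excess becomes tight. Otherwise it was not tight before, [y] has maximal size,
   and only maximal size two requires a second column of size one. *)
- case: (eqVneq t B) => tB'; first by left; move: eJ BE tB' => /=; move: (\sum_(j < m) (_ - _ - 1)) => z; clear; lia.
  right.
  have [C1 C2] : (forall j, c j <= (c x).+1) /\ (2 <= c x \/ 2 <= s).
    by case: (invB tt) => [h|//]; move/eqP: tB'; move: h BE tB tge; clear; lia.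
  have p2 : M = 2 -> 2 <= p.
    move=> M2'; rewrite ltnNge; apply/negP => p1.
    have : e <= p.
      rewrite /e /p -sum1_card [X in _ <= X]big_mkcond; apply: leq_sum => j _.
      by rewrite inE; have := cM j; case: (ltnP 1 (c j)) => //=; rewrite ?M2'; clear; lia.
    by move/eqP: tB'; move: BE tB tge pge p1; clear; lia.
  have yM : c y = M.
    apply/eqP; rewrite eqn_leq cM /=.
    suff [j jK jM] : exists2 j, j \in K & c j = M by rewrite -jM; apply: ymax.
    case: (leqP #|U0 :|: Mx| t) => h.
      by exists j0 => //; apply: (subsetP (XK h)); rewrite !inE j0M eqxx orbT.
    have KX' := KX h.
    case: (boolP (K \subset U0)) => KU; last first.
      case/subsetPn: KU => j jK jU; exists j => //.
      by have := subsetP KX' _ jK; rewrite inE (negPf jU) /= inE => /eqP.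
    have t1 : t = 1.
      have := subset_leq_card KU; rewrite Kt => h'; apply/eqP; rewrite eqn_leq tge andbT.
      exact: leq_trans h' U0le.
    have xU : x \in U0.
      have [z zK] := K0; have := subsetP KU _ zK; rewrite !inE => /andP[/eqP <-] ->; by rewrite eqxx.
    have xA : 2 <= c x by move: xU; rewrite !inE eqxx.
    have sig0 : sigma = 0 by rewrite (sigmaE tt); case: eqP xA => // ->.
    have p1 : p = 1 by move/eqP: tB'; move: t1 sig0 tu ha q2; case: (tcase tt) => ->; clear; lia.
    have : j0 \in A2 by rewrite (subsetP MxA) // inE j0M.
    have /cards1P [z AE] : #|A2| == 1 by rewrite -/p p1.
    have : x \in A2 by rewrite inE.
    rewrite AE !inE => /eqP xz /eqP jz; exists x; last by rewrite xz -jz.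
    exact: (subsetP U0K).
  rewrite yJ; split; first by move=> j; have := cM j; rewrite yM; clear; lia.
  case: (ltnP 2 M) => M3; [left; rewrite yM; move: M3; clear; lia|right].
  have M2' : M = 2 by move: M2 M3; clear; lia.
  apply: leq_trans sumC1; rewrite M2' eqxx muln1.
  case: (ltnP 1 t) => t1; first by move: t1; clear; lia.
  have te : t = 1 by move: tge t1; clear; lia.
  have := p2 M2'; move/eqP: tB'; move: te tu us ha q2 C2 tp cx (sigmaE tt); case: (tcase tt) => ->; clear; lia.
Qed.

(** * Ballot words from peeled blocks *)

Definition ballot (w : seq nat) : Prop :=
  forall k v, count_mem v.+1 (take k w) <= count_mem v (take k w).


Definition block_word (alpha : nat -> nat) (l : nat) (w : seq nat) : Prop :=
  size w = block_start alpha l /\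
  forall t, t.+1 < size w ->
    (nth 0 w t < nth 0 w t.+1) = [exists i : 'I_l, t.+1 == block_start alpha i].

Definition column_word (m : nat) (alpha : nat -> nat) (l : nat) (c : 'I_m -> nat) (w : seq nat) : Prop :=
  [/\ block_word alpha l w, ballot w & forall v, count_mem v w = #|[set j | v < c j]|].

Lemma last_sorted_geq (x : nat) s : sorted geq s -> x \in s -> last 0 s <= x.
Proof.
elim: s => // y s IH /= ps; rewrite inE => /predU1P [->|xs].
  have tr : transitive geq by move=> a b d /= h1 h2; apply: leq_trans h2 h1.
  have := order_path_min tr ps => /allP h.
  case: s {IH ps} h => [//|z s] h /=; apply: (h (last z s)); exact: mem_last.
by have := IH (path_sorted ps) xs; case: s {IH ps} xs.
Qed.

Lemma first_sorted_geq (x : nat) s : sorted geq s -> x \in s -> x <= nth 0 s 0.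
Proof.
case: s => // y s /= ps; rewrite inE => /predU1P [->//|xs].
have tr : transitive geq by move=> a b d /= h1 h2; apply: leq_trans h2 h1.
by have := order_path_min tr ps => /allP /(_ x xs).
Qed.

(** Each column of [J] contributes the row of its lowest box, in decreasing order. The boundary with
    [w] is an ascent because of the letter [c y - 1]; the letter [c x - 1] bounds the new last
    letter, for the sake of the block to come. *)
Lemma column_word_extend m alpha l (c : 'I_m -> nat) (J : {set 'I_m}) (x y : 'I_m) w :
  #|J| = alpha l -> (forall j, j \in J -> 1 <= c j) -> x \in J -> y \in J ->
  column_word alpha l (fun j => c j - (j \in J)) w ->
  (w = [::] \/ last 0 w < c y - 1) ->
  exists w', column_word alpha l.+1 c w' /\ (0 < size w' /\ last 0 w' < c x).
Proof.
move=> Ja Jc xJ yJ [[wsz wst] wb wc] wl.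
pose b := sort geq [seq c j - 1 | j <- enum J].
have bs : sorted geq b by apply: sort_sorted => a d; exact: leq_total.
have bE v : (v \in b) = (v \in [seq c j - 1 | j <- enum J]) by rewrite mem_sort.
have bsz : size b = alpha l by rewrite size_sort size_map -cardE.
have bc v : count_mem v b = #|[set j in J | c j - 1 == v]|.
  rewrite /b (seq.permP (permEl (perm_sort _ _))) count_map -sum1_count big_enum_cond /=.
  by rewrite sum1dep_card; apply: eq_card => j; rewrite !inE.
have wbc v : count_mem v (w ++ b) = #|[set j | v < c j]|.
  rewrite count_cat wc bc -cardsUI [X in _ + X](_ : _ = 0) ?addn0.
    apply: eq_card => j; rewrite !inE; have := Jc j; case: (j \in J) => [/(_ isT)|_] /=; lia.
  apply/eqP; rewrite cards_eq0; apply/eqP/setP => j; rewrite !inE; case: (j \in J) => /=; lia.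
have mx : c x - 1 \in b by rewrite bE; apply/mapP; exists x; rewrite ?mem_enum.
have my : c y - 1 \in b by rewrite bE; apply/mapP; exists y; rewrite ?mem_enum.
exists (w ++ b); split; [split|].
- split; first by rewrite size_cat wsz bsz block_startS.
  move=> t; rewrite size_cat => ht.
  have E : [exists i : 'I_l.+1, t.+1 == block_start alpha i] =
           [exists i : 'I_l, t.+1 == block_start alpha i] || (t.+1 == block_start alpha l).
    apply/existsP/orP => [[i]|[/existsP [i]|]].
    - case: (unliftP ord_max i) => [i' ->|->]; last by right.
      by rewrite lift_max => h; left; apply/existsP; exists i'.
    - by move=> h; exists (widen_ord (leqnSn l) i).
    - by move=> h; exists ord_max.
  rewrite E -wsz !nth_cat; case: (ltngtP t.+1 (size w)) => h.
  - by rewrite orbF wst.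
  - rewrite orbF.
    have -> : [exists i : 'I_l, t.+1 == block_start alpha i] = false.
      apply/negbTE/negP => /existsP [i /eqP e]; have := block_start_mono alpha (ltnW (ltn_ord i)); lia.
    apply/negbTE; rewrite -leqNgt; have -> : t.+1 - size w = (t - size w).+1 by lia.
    apply: (sortedP 0 bs); lia.
  - rewrite orbT -h subnn; have -> : nth 0 w t = last 0 w by rewrite -nth_last -h.
    case: wl => [w0|wl]; first by rewrite w0 in h.
    by apply: leq_trans wl (first_sorted_geq bs my).
- move=> k v; case: (leqP k (size w)) => h; first by rewrite takel_cat.
  (* A column loses at most one box, so one that reaches row [v.+1] in the end has reached row [v]
     already in [w]. Thus [w] alone has enough letters [v]. *)
  apply: (@leq_trans (count_mem v.+1 (w ++ b))).
    by rewrite -{2}(cat_take_drop k (w ++ b)) count_cat leq_addr.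
  apply: (@leq_trans (count_mem v w)).
    rewrite wbc wc; apply: subset_leq_card; apply/subsetP => j; rewrite !inE; case: (j \in J) => /=; lia.
  by rewrite take_cat ltnNge (ltnW h) /= count_cat leq_addr.
- exact: wbc.
- have b0 : 0 < size b by case: (b) mx.
  split; first by rewrite size_cat; lia.
  have -> : last 0 (w ++ b) = last 0 b by rewrite last_cat; case: (b) b0.
  by have := last_sorted_geq bs mx; have := Jc x xJ; lia.
Qed.

Lemma column_word0 m alpha (c : 'I_m -> nat) : (forall j, c j = 0) -> column_word alpha 0 c [::].
Proof.
move=> c0; split; first by split; rewrite // /block_start big_ord0.
  by [].
by move=> v; apply/esym/eqP; rewrite cards_eq0; apply/eqP/setP => j; rewrite !inE c0.
Qed.

Lemma column_word_one m alpha (c : 'I_m -> nat) (x : 'I_m) : (forall j, c j <= 1) ->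
  \sum_j c j = alpha 0 -> 1 <= c x ->
  exists w, column_word alpha 1 c w /\ (0 < size w /\ last 0 w < c x).
Proof.
move=> c1 sc cx; pose J := [set j | c j == 1].
have xJ : x \in J by rewrite inE; have := c1 x; lia.
apply: (@column_word_extend _ _ _ _ J x x [::]) => //.
- rewrite -sc -sum1_card big_mkcond; apply: eq_bigr => j _; rewrite inE.
  by have := c1 j; case: (c j) => [|[|]].
- by move=> j; rewrite inE => /eqP ->.
- apply: column_word0 => j; rewrite inE; have := c1 j; case: (c j) => [|[|]] //.
- by left.
Qed.

Lemma peelable_word m alpha q l (c : 'I_m -> nat) (x : 'I_m) :
  2 <= q -> (forall i, i < l.+1 -> q <= alpha i <= q.+1) -> peelable alpha l.+1 c x ->
  exists w, column_word alpha l.+1 c w /\ (0 < size w /\ last 0 w < c x).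
Proof.
move=> q2; elim: l c x => [|l IH] c x Ha pe.
  case: pe => [[sc c1 _ cx] _]; apply: column_word_one => //.
  by rewrite sc /block_start big_ord1.
have [J [y [[Ja xJ yJ Jc] pe']]] := choose_block q2 Ha pe.
have [w [cw [w0 wl]]] := IH _ _ (fun i h => Ha i (ltnW h)) pe'.
apply: (column_word_extend Ja Jc xJ yJ cw); right; move: wl; by rewrite yJ.
Qed.

Lemma sum_pos_ex m (F : 'I_m -> nat) : 0 < \sum_j F j -> exists x : 'I_m, 0 < F x /\ forall j, F j <= F x.
Proof.
move=> h; have [j0 Fj0] : exists j, 0 < F j.
  have : ~~ [forall j, F j == 0].
    apply/negP => /forallP H; move: h; rewrite big1 // => j _; exact/eqP.
  by case/forallPn => j; exists j; rewrite lt0n.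
case: (@arg_maxnP _ j0 xpredT F isT) => x _ mx; exists x; split; last by move=> j; apply: mx.
by apply: leq_trans Fj0 (mx _ _).
Qed.

(** The last block has no successor, so its designated column is free; a largest column satisfies
    the invariant. *)
Lemma balanced_word m alpha q l (c : 'I_m -> nat) :
  2 <= q -> (forall i, i < l.+1 -> q <= alpha i <= q.+1) ->
  \sum_j c j = block_start alpha l.+1 -> (forall j, c j <= l.+1) -> l <= \sum_j (c j - 1) ->
  exists w, column_word alpha l.+1 c w.
Proof.
move=> q2 Ha sc cl ex.
have pos : 0 < \sum_j c j by rewrite sc block_startS; have := Ha l (ltnSn l); lia.
have [x [x0 mx]] := sum_pos_ex pos.
suff pe : peelable alpha l.+1 c x by have [w [cw _]] := peelable_word q2 Ha pe; exists w.
split; first by split.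
split.
  case: (eqVneq (c x) l.+1) => h; [by left | right].
  rewrite (_ : [set j | _] = set0) ?cards0; first by have := Ha l (ltnSn l); rewrite /=; lia.
  by apply/setP => j; rewrite !inE; have := mx j; have := cl x; lia.
case: l ex {Ha sc cl} => [|l] ex.
  case: (posnP (\sum_j (c j - 1))) => [->|]; first by left.
  move=> hpos; have [y [y1 _]] := sum_pos_ex hpos; right; split=> [j|]; [have := mx j; lia|left; have := mx y; lia].
right; split=> [j|]; first by have := mx j; lia.
have : 0 < \sum_j (c j - 1) by lia.
move=> hpos; have [y [y1 _]] := sum_pos_ex hpos; left; have := mx y; lia.
Qed.

(** The single box of the last block is taken from a largest column [x], and [x] is also shared with
    the block before. Since there are only [2 * l + 1] boxes, what remains satisfies the invariant
    with [q = 2]. *)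
Lemma short_end_word m alpha l (c : 'I_m -> nat) :
  (forall i, i < l -> alpha i = 2) -> alpha l = 1 ->
  \sum_j c j = block_start alpha l.+1 -> (forall j, c j <= l.+1) -> l <= \sum_j (c j - 1) ->
  exists w, column_word alpha l.+1 c w.
Proof.
move=> Ha al sc cl ex.
have NE : block_start alpha l.+1 = 2 * l + 1.
  rewrite block_startS al; congr (_ + _).
  rewrite /block_start; transitivity (\sum_(i < l) 2); last by rewrite sum_nat_const card_ord mulnC.
  by apply: eq_bigr => i _; apply: Ha.
have pos : 0 < \sum_j c j by rewrite sc NE; lia.
have [x [x0 mx]] := sum_pos_ex pos.
case: l Ha al sc cl ex NE => [|l] Ha al sc cl ex NE.
  have s1 : \sum_j c j = alpha 0 by rewrite sc /block_start big_ord1.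
  by have [w [cw _]] := column_word_one cl s1 x0; exists w.
have x2 : 2 <= c x.
  have : 0 < \sum_j (c j - 1) by lia.
  move=> hpos; have [y [y1 _]] := sum_pos_ex hpos; have := mx y; lia.
pose J := [set x].
have Jc j : j \in J -> 1 <= c j by rewrite inE => /eqP ->.
have xJ : x \in J by rewrite inE.
have sJ := sum_remove Jc; have eJ := sum_excess_remove c J.
rewrite (_ : J :&: _ = J) ?cards1 in eJ; last by apply/setIidPl; rewrite sub1set inE.
rewrite cards1 sc block_startS al in sJ.
have hfull (k : nat) : k * #|[set j | c j == k] :\ x| + c x <= 2 * l.+1 + 1.
  rewrite -NE -sc; apply: sum_ge_card1; last by rewrite !inE eqxx.
  by move=> j; rewrite !inE => /andP[_ /eqP ->].
have JE j : (j \in J) = (j == x) by rewrite inE.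
suff pe : peelable alpha l.+1 (fun j => c j - (j \in J)) x.
  have Ha' i : i < l.+1 -> 2 <= alpha i <= 3 by move=> /Ha ->.
  have [w [cw [w0 wl]]] := peelable_word (leqnn 2) Ha' pe.
  have Ja : #|J| = alpha l.+1 by rewrite cards1 al.
  rewrite xJ in wl.
  by have [w' [cw' _]] := column_word_extend Ja Jc xJ xJ cw (or_intror wl); exists w'.
split; [split|split] => /=.
- by apply/eqP; rewrite -(eqn_add2r 1) -sJ.
- move=> j; rewrite JE; case: (eqVneq j x) => [->|jx]; first by have := cl x; lia.
  have := cl j; rewrite leq_eqVlt subn0 => /predU1P [cj|//].
  have := hfull l.+2; have cxl : c x = l.+2 by have := mx j; have := cl x; lia.
  have : 0 < #|[set j | c j == l.+2] :\ x|.
    by rewrite card_gt0; apply/set0Pn; exists j; rewrite !inE jx cj eqxx.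
  by case: #|_| => // n _; rewrite mulnS cxl; lia.
- by move: ex eJ; move: (\sum_j (_ - _ - _)) => z; clear; lia.
- by rewrite xJ; move: x2; clear; lia.
- rewrite xJ; case: (eqVneq (c x) l.+2) => cx; first by left; rewrite cx.
  right; rewrite Ha // ltnNge; apply/negP => big.
  have h : [set j | c j - (j \in J) == l.+1] \subset [set j | c j == l.+1] :\ x.
    apply/subsetP => j; rewrite !inE; case: (eqVneq j x) => [->|_] /=; last by rewrite subn0.
    by have := cl x; move: cx; clear; lia.
  have := leq_trans big (subset_leq_card h).
  have [j] : exists j, j \in [set j | c j == l.+1] :\ x.
    by apply/set0Pn; rewrite -card_gt0; apply: leq_trans (subset_leq_card h); apply: leq_trans big.
  rewrite !inE => /andP[_ /eqP cj]; have := mx j; rewrite cj => cxl.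
  have := hfull l.+1; move: (#|_|) => n h1 h2; have : l.+1 * 2 <= l.+1 * n by rewrite leq_mul2l h2 orbT.
  by move: h1 cxl x2 (cl x) cx; clear; lia.
- right; split=> [j|]; first by rewrite xJ; apply: leq_trans (leq_subr _ _) _; have := mx j; move: x2; clear; lia.
  case: (ltnP 2 (c x)) => h; first by left; rewrite xJ; move: h; clear; lia.
  have cx2 : c x = 2 by apply/eqP; rewrite eqn_leq h.
  right; have : #|x |: [set j | c j == 1]| <= #|[set j | c j - (j \in J) == 1]|.
    apply: subset_leq_card; apply/subsetP => j; rewrite !inE; case: (eqVneq j x) => [->|_] /=; first by rewrite cx2.
    by rewrite subn0.
  apply: leq_trans; rewrite cardsU1 inE cx2 /= add1n ltnS.
  have := sum_sizes c; rewrite sc NE.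
  have -> : \sum_j (c j - 1) = #|[set j | 2 <= c j]|.
    rewrite -sum1_card [RHS]big_mkcond; apply: eq_bigr => j _; rewrite inE.
    by have := mx j; rewrite cx2; case: (c j) => [|[|[|]]].
  by move: (#|_|) (#|_|) => u v; clear; lia.
Qed.

(** Transposition of standard tableaux: if letter [t] of a ballot word is the row of the box added
    at time [t], the number of earlier equal letters is its column. *)
Definition transpose_word (w : seq nat) : seq nat :=
  [seq count_mem (nth 0 w t) (take t w) | t <- iota 0 (size w)].

Lemma size_transpose_word w : size (transpose_word w) = size w.
Proof. by rewrite size_map size_iota. Qed.

Lemma nth_transpose_word w t : t < size w ->
  nth 0 (transpose_word w) t = count_mem (nth 0 w t) (take t w).
Proof. by move=> tw; rewrite (nth_map 0) ?size_iota // nth_iota. Qed.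

(** The occurrences of a letter [v] become 0, 1, 2, ... in turn, so [u] is produced once by each
    letter occurring more than [u] times. *)
Lemma count_take_transpose w u k K : k <= size w -> (forall x, x \in w -> x < K) ->
  count_mem u (take k (transpose_word w)) = \sum_(v < K) (u < count_mem (nat_of_ord v) (take k w)).
Proof.
move=> kw HK; elim: k kw => [|k IH] kw; first by rewrite !take0 big1.
rewrite (take_nth 0) ?size_transpose_word // (take_nth 0 kw) -cats1 count_cat IH; last exact: ltnW.
have xK : nth 0 w k < K by apply: HK; apply: mem_nth.
rewrite /= addn0 nth_transpose_word //.
rewrite (bigD1 (Ordinal xK)) //= [in RHS](bigD1 (Ordinal xK)) //= -cats1 !count_cat /= eqxx.
set n := count_mem (nth 0 w k) (take k w); rewrite addnAC; congr (_ + _); first lia.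
apply: eq_bigr => v; rewrite -val_eqE /= => vx; rewrite count_cat /=.
by rewrite [nth 0 w k == _]eq_sym (negPf vx) !addn0.
Qed.

Lemma letter_bound (w : seq nat) : exists K, forall x, x \in w -> x < K.
Proof.
exists (sumn w).+1; elim: w => [|y w IH] x //=.
by rewrite inE => /predU1P [->|/IH]; lia.
Qed.

Lemma transpose_ballot w : ballot (transpose_word w).
Proof.
have [K HK] := letter_bound w.
move=> k u; case: (leqP k (size w)) => kw.
  by rewrite !(count_take_transpose _ kw HK); apply: leq_sum => v _; lia.
rewrite !take_oversize ?size_transpose_word ?(ltnW kw) //.
have := count_take_transpose u (leqnn (size w)) HK; have := count_take_transpose u.+1 (leqnn (size w)) HK.
rewrite !take_size !take_oversize ?size_transpose_word // => -> ->.
by apply: leq_sum => v _; lia.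
Qed.

Lemma ballot_anti w k u v : ballot w -> u <= v -> count_mem v (take k w) <= count_mem u (take k w).
Proof.
move=> bw; elim: v => [|v IH]; first by rewrite leqn0 => /eqP ->.
by rewrite leq_eqVlt ltnS => /predU1P [-> //|/IH]; apply: leq_trans; apply: bw.
Qed.

(** For consecutive letters [x] and [y] with [x < y], ballotness says that [y] has not occurred more
    often than [x] before; for [y < x], that [y] has occurred at least as often as [x], the current
    one included. *)
Lemma transpose_ascent w t : ballot w -> t.+1 < size w ->
  (nth 0 (transpose_word w) t < nth 0 (transpose_word w) t.+1) =
  ~~ (nth 0 w t < nth 0 w t.+1).
Proof.
move=> bw tw; have tw' := ltnW tw; rewrite !nth_transpose_word //.
have E v : count_mem v (take t.+1 w) = count_mem v (take t w) + (nth 0 w t == v).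
  by rewrite (take_nth 0) // -cats1 count_cat /= addn0.
rewrite E; set x := nth 0 w t; set y := nth 0 w t.+1.
case: (ltngtP x y) => h /=.
- by rewrite addn0; apply/negbTE; rewrite -leqNgt; apply: ballot_anti bw (ltnW h).
- rewrite addn0; have := ballot_anti t.+1 bw (ltnW h); rewrite !E.
  have -> : (x == y) = false by lia.
  by rewrite /x eqxx addn0 addn1.
- by rewrite h addn1 ltnSn.
Qed.

Lemma transpose_count w K u : (forall x, x \in w -> x < K) ->
  count_mem u (transpose_word w) = \sum_(v < K) (u < count_mem (nat_of_ord v) w).
Proof.
move=> HK; have := count_take_transpose u (leqnn (size w)) HK.
by rewrite take_size take_oversize ?size_transpose_word.
Qed.

(** * Words for a partition and for its conjugate *)

Lemma part_conj (lam : intpart) v j :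
  (v < #|[set i : 'I_(size lam) | j < nth 0 lam i]|) = (j < nth 0 lam v).
Proof.
have [t th Ht] : exists2 t, 0 <= t <= size lam & forall i, 0 <= i < size lam -> (j < nth 0 lam i) = (i < t).
  apply: (initial_segment (P := fun i => j < nth 0 lam i)) => // c d _ cd _.
  by move=> h; apply: leq_trans h (part_nth_anti lam cd).
have -> : #|[set i : 'I_(size lam) | j < nth 0 lam i]| = t.
  rewrite -sum1dep_card big_mkcond -(big_mkord xpredT (fun i => if j < nth 0 lam i then 1 else 0)).
  rewrite (eq_bigr (fun i => nat_of_bool (j < nth 0 lam i))); last by move=> i _; case: ifP.
  rewrite (sum_range (P := fun i => j < nth 0 lam i) (u := 0) (v := t)) ?subn0 //.
case: (ltnP v (size lam)) => vl; first by rewrite Ht.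
by rewrite (nth_default _ vl) ltn0; lia.
Qed.

Lemma sumn_part (lam : intpart) : sumn lam = \sum_(i < size lam) nth 0 lam i.
Proof. by rewrite sumnE (big_nth 0) big_mkord. Qed.

Section Conjugate.
Variable lam : intpart.

Definition conj_size (j : 'I_(nth 0 lam 0)) : nat := #|[set i : 'I_(size lam) | j < nth 0 lam i]|.

Lemma card_conj v : #|[set j | v < conj_size j]| = nth 0 lam v.
Proof.
rewrite (eq_card (B := [set j : 'I_(nth 0 lam 0) | j < nth 0 lam v])); last first.
  by move=> j; rewrite !inE part_conj.
have h := part_nth_anti lam (leq0n v).
rewrite -sum1dep_card big_mkcond -(big_mkord xpredT (fun i => if i < nth 0 lam v then 1 else 0)).
rewrite (eq_bigr (fun i => nat_of_bool (i < nth 0 lam v))); last by move=> i _; case: ifP.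
by rewrite (sum_range (P := fun i => i < nth 0 lam v) (u := 0) (v := nth 0 lam v)) ?subn0.
Qed.

Lemma sum_conj : \sum_j conj_size j = sumn lam.
Proof.
rewrite sumn_part.
under eq_bigr => j _ do rewrite /conj_size -sum1dep_card big_mkcond.
rewrite exchange_big /=; apply: eq_bigr => i _.
have h := part_nth_anti lam (leq0n i).
rewrite -(big_mkord xpredT (fun j => if j < nth 0 lam i then 1 else 0)).
rewrite (eq_bigr (fun j => nat_of_bool (j < nth 0 lam i))); last by move=> j _; case: ifP.
by rewrite (sum_range (P := fun j => j < nth 0 lam i) (u := 0) (v := nth 0 lam i)) ?subn0.
Qed.

Lemma conj_le j : conj_size j <= size lam.
Proof. by apply: leq_trans (max_card _) _; rewrite card_ord. Qed.

Lemma conj_ge j : 1 <= conj_size j.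
Proof. by rewrite part_conj ltn_ord. Qed.
End Conjugate.

Lemma sum_sub1 m (c : 'I_m -> nat) : (forall j, 1 <= c j) -> \sum_j (c j - 1) + m = \sum_j c j.
Proof.
move=> H; rewrite -[X in _ + X](card_ord m) -sum1_card -big_split /=.
by apply: eq_bigr => j _; rewrite subnK.
Qed.

(** The second alternative is a zigzag whose last block is a single box. *)
Definition admissible_blocks (alpha : nat -> nat) (l : nat) : Prop :=
  (exists2 q, 2 <= q & forall i, i < l.+1 -> q <= alpha i <= q.+1) \/
  ((forall i, i < l -> alpha i = 2) /\ alpha l = 1).

Lemma admissible_word m alpha l (c : 'I_m -> nat) : admissible_blocks alpha l ->
  \sum_j c j = block_start alpha l.+1 -> (forall j, c j <= l.+1) -> l <= \sum_j (c j - 1) ->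
  exists w, column_word alpha l.+1 c w.
Proof. by case=> [[q q2 Ha]|[Ha al]]; [apply: balanced_word q2 Ha|apply: short_end_word Ha al]. Qed.

(** The columns of [lam] are peeled; the last hypothesis is the bound on the excess, which is the
    number of boxes below the first row. *)
Lemma row_word (lam : intpart) alpha l : admissible_blocks alpha l ->
  sumn lam = block_start alpha l.+1 -> size lam <= l.+1 -> l + nth 0 lam 0 <= sumn lam ->
  exists w, [/\ block_word alpha l.+1 w, ballot w & forall v, count_mem v w = nth 0 lam v].
Proof.
move=> adm sl ll lc; have [||| w [bw ba cw]] := @admissible_word _ alpha l (@conj_size lam) adm.
- by rewrite sum_conj.
- by move=> j; apply: leq_trans (conj_le _) ll.
- by have := sum_sub1 (@conj_ge lam); rewrite sum_conj; lia.
by exists w; split=> // v; rewrite cw card_conj.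
Qed.

(** Here the rows of [lam] are peeled as if they were columns. This yields a word of conjugate
    weight, and transposing it restores [lam] and exchanges ascents with their complement. *)
Lemma column_row_word (lam : intpart) beta l : admissible_blocks beta l ->
  sumn lam = block_start beta l.+1 -> nth 0 lam 0 <= l.+1 -> l + size lam <= sumn lam ->
  exists w, [/\ size w = sumn lam, ballot w, forall v, count_mem v w = nth 0 lam v &
    forall t, t.+1 < size w ->
      (nth 0 w t < nth 0 w t.+1) = ~~ [exists i : 'I_l.+1, t.+1 == block_start beta i]].
Proof.
move=> adm sl ll lc.
have [||| w [[wsz wst] ba cw]] := @admissible_word _ beta l (fun i : 'I_(size lam) => nth 0 lam i) adm.
- by rewrite -sumn_part.
- by move=> j; apply: leq_trans (part_nth_anti _ _) ll.
- have := @sum_sub1 _ (fun i : 'I_(size lam) => nth 0 lam i); rewrite -sumn_part => h.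
  have : \sum_(j < size lam) (nth 0 lam j - 1) + size lam = sumn lam.
    by apply: h => j; rewrite part_nth_gt0.
  by move: lc; move: (\sum_(j < size lam) _) => z; clear; lia.
have wlt x : x \in w -> x < nth 0 lam 0.
  move=> xw; have : 0 < count_mem x w by rewrite -has_count has_pred1.
  by rewrite cw part_conj.
exists (transpose_word w); split.
- by rewrite size_transpose_word wsz.
- exact: transpose_ballot.
- move=> u; rewrite (transpose_count u wlt).
  rewrite (eq_bigr (fun v : 'I_(nth 0 lam 0) => nat_of_bool (v < nth 0 lam u))).
    have h := part_nth_anti lam (leq0n u).
    rewrite -(big_mkord xpredT (fun i => nat_of_bool (i < nth 0 lam u))).
    by rewrite (sum_range (P := fun i => i < nth 0 lam u) (u := 0) (v := nth 0 lam u)) ?subn0.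
  by move=> v _; rewrite cw part_conj.
- by move=> t; rewrite size_transpose_word => tw; rewrite transpose_ascent // wst.
Qed.

(** * Fillings of skew shapes and connectedness *)

Definition lr_function (A : skew_shape) (lam : intpart) (f : nat * nat -> nat) : Prop :=
  [/\ ssyt A f, lattice A f & forall v, weight A f v = nth 0 lam v].

Lemma mk_skew (g h : nat -> nat) m :
  (forall i j, i <= j -> g j <= g i) -> (forall i j, i <= j -> h j <= h i) ->
  (forall i, h i <= g i) -> g m = 0 ->
  exists A : skew_shape, (forall i, out A i = g i) /\ (forall i, inn A i = h i).
Proof.
move=> ga ha hg gm; have hm : h m = 0 by have := hg m; rewrite gm leqn0 => /eqP.
have gE i := nth_part_of i ga gm; have hE i := nth_part_of i ha hm.
have incl : intpart_incl (part_of h m) (part_of g m).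
  by apply/allP => i _; rewrite gE hE.
by exists (@SkewShape (part_of g m, part_of h m) incl).
Qed.

(** * Nonempty rows and columns *)

Definition rows (A : skew_shape) : seq nat := undup [seq b.1 | b <- boxes A].
Definition cols (A : skew_shape) : seq nat := undup [seq b.2 | b <- boxes A].

Lemma mem_rows A i : (i \in rows A) = (inn A i < out A i).
Proof.
rewrite mem_undup; apply/mapP/idP => [[[k j]]|h]; first by rewrite mem_boxes => hb ->; apply: leq_ltn_trans (proj1 (andP hb)) (proj2 (andP hb)).
by exists (i, inn A i) => //; rewrite mem_boxes leqnn h.
Qed.

Lemma box_rows A b : b \in boxes A -> b.1 \in rows A.
Proof. by rewrite mem_boxesE mem_rows => /andP[]; apply: leq_ltn_trans. Qed.

Lemma box_cols A b : b \in boxes A -> b.2 \in cols A.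
Proof. by move=> hb; rewrite mem_undup; apply: map_f. Qed.

Lemma mem_cols A j : (j \in cols A) -> exists i, (i, j) \in boxes A.
Proof. by rewrite mem_undup => /mapP [[i j'] hb ->]; exists i. Qed.

Lemma rows_uniq A : uniq (rows A). Proof. exact: undup_uniq. Qed.
Lemma cols_uniq A : uniq (cols A). Proof. exact: undup_uniq. Qed.

(** A shape may have empty rows between its boxes, so a row index is no bound in terms of [nrows];
    the rank is. *)
Definition rank (A : skew_shape) (i : nat) : nat := count (fun k => k < i) (rows A).

Lemma rank_lt A i i' : i \in rows A -> i < i' -> rank A i < rank A i'.
Proof.
move=> hi ii; rewrite /rank -!size_filter -addn1 -[X in _ + X]/(size [:: i]) -size_cat.
apply: uniq_leq_size.
  rewrite cat_uniq filter_uniq ?rows_uniq //= orbF mem_filter ltnn /= .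
  by [].
move=> k; rewrite mem_cat !mem_filter inE => /orP[/andP[h ->]|/eqP ->]; last by rewrite ii hi.
by rewrite (ltn_trans h ii).
Qed.

Lemma rank_mono A i i' : i <= i' -> rank A i <= rank A i'.
Proof. by move=> ii; apply: sub_count => k /= h; apply: leq_trans h ii. Qed.

Lemma rank_inj A i i' : i \in rows A -> i' \in rows A -> rank A i = rank A i' -> i = i'.
Proof.
move=> hi hi' e; case: (ltngtP i i') => // h.
- by have := rank_lt hi h; rewrite e ltnn.
- by have := rank_lt hi' h; rewrite e ltnn.
Qed.

Lemma rank_lt_nrows A i : i \in rows A -> rank A i < nrows A.
Proof.
move=> hi; have := rank_lt hi (ltnSn i); move/leq_trans; apply.
exact: count_size.
Qed.

Lemma rank_surj A v : v < nrows A -> exists2 i, i \in rows A & rank A i = v.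
Proof.
move=> hv.
have H : perm_eq [seq rank A i | i <- rows A] (iota 0 (nrows A)).
  have U : uniq [seq rank A i | i <- rows A].
    by rewrite map_inj_in_uniq ?rows_uniq // => i i' hi hi'; apply: rank_inj.
  have S : {subset [seq rank A i | i <- rows A] <= iota 0 (nrows A)}.
    by move=> x /mapP [i hi ->]; rewrite mem_iota /= rank_lt_nrows.
  have [|_ E] := uniq_min_size U S; first by rewrite size_iota size_map; exact: leqnn.
  by apply: uniq_perm; rewrite ?iota_uniq.
have : v \in [seq rank A i | i <- rows A] by rewrite (perm_mem H) mem_iota.
by case/mapP => i hi ->; exists i.
Qed.

Lemma lattice_entry_rank A f b : ssyt A f -> lattice A f -> b \in boxes A -> f b <= rank A b.1.
Proof.
move=> ss la; move: {2}(f b) (erefl (f b)) => v; elim: v b => [|v IH] b fb hb; first by rewrite fb.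
have : 0 < count (fun c => (c.1 <= b.1) && (f c == v.+1)) (boxes A).
  by rewrite -has_count; apply/hasP; exists b; rewrite ?leqnn ?fb ?eqxx.
move=> /leq_trans /(_ (lattice_rows b.1 v ss la)); rewrite -has_count => /hasP [c hc /andP[cb /eqP fc]].
rewrite fb; apply: leq_ltn_trans (rank_lt (box_rows hc) cb).
by rewrite -fc; apply: IH.
Qed.

Lemma ssyt_col_inj A f b c : ssyt A f -> b \in boxes A -> c \in boxes A ->
  b.2 = c.2 -> f b = f c -> b = c.
Proof.
move=> ss hb hc e2 fe; have [_ h1] := ss _ _ hb hc; have [_ h2] := ss _ _ hc hb.
case: (ltngtP b.1 c.1) => h.
- by have := h1 e2 h; rewrite fe ltnn.
- by have := h2 (esym e2) h; rewrite fe ltnn.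
- by rewrite [b]surjective_pairing [c]surjective_pairing h e2.
Qed.

Lemma count_inj_le (T : eqType) (s : seq T) (P : pred T) (g : T -> nat) (r : seq nat) :
  uniq s -> {in s &, forall x y, P x -> P y -> g x = g y -> x = y} ->
  (forall x, x \in s -> P x -> g x \in r) -> count P s <= size r.
Proof.
move=> us inj sub; rewrite -size_filter -(size_map g); apply: uniq_leq_size.
  rewrite map_inj_in_uniq ?filter_uniq // => x y; rewrite !mem_filter => /andP[Px xs] /andP[Py ys].
  exact: inj.
by move=> z /mapP [x]; rewrite mem_filter => /andP[Px xs] ->; apply: sub.
Qed.

Lemma count_ge_uniq (T : eqType) (s : seq T) (P : pred T) (r : seq nat) (h : nat -> T) :
  uniq r -> {in r &, injective h} -> (forall k, k \in r -> (h k \in s) && P (h k)) ->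
  size r <= count P s.
Proof.
move=> ur inj sub; rewrite -size_filter -(size_map h); apply: uniq_leq_size.
  by rewrite map_inj_in_uniq.
by move=> z /mapP [k kr ->]; rewrite mem_filter andbC sub.
Qed.

Lemma weight_le_ncols A f v : ssyt A f -> weight A f v <= ncols A.
Proof.
move=> ss; apply: (count_inj_le (g := snd) (boxes_uniq A)).
  by move=> b c hb hc /eqP fb /eqP fc e; apply: (ssyt_col_inj ss) => //; rewrite fb fc.
by move=> b hb _; apply: box_cols.
Qed.

Lemma lr_size_le A lam f : lr_function A lam f -> size lam <= nrows A.
Proof.
move=> [ss la wl]; case E : (size lam) => [//|n].
have : 0 < weight A f n by rewrite wl part_nth_gt0 E.
rewrite -has_count => /hasP [b hb /eqP fb].
by apply: leq_ltn_trans (rank_lt_nrows (box_rows hb)); rewrite -fb lattice_entry_rank.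
Qed.

Lemma lr_head_le A lam f : lr_function A lam f -> nth 0 lam 0 <= ncols A.
Proof. by move=> [ss la wl]; rewrite -wl weight_le_ncols. Qed.

Lemma sum_count_eq (T : eqType) (s : seq T) (f : T -> nat) K :
  (forall x, x \in s -> f x < K) -> \sum_(v < K) count (fun x => f x == v) s = size s.
Proof.
elim: s => [|x s IH] H; first by rewrite big1.
rewrite /= big_split /= IH; last by move=> y ys; apply: H; rewrite inE ys orbT.
rewrite (bigD1 (Ordinal (H x (mem_head _ _)))) //= eqxx big1 ?addn0 ?add1n //.
by move=> i; rewrite -val_eqE /= eq_sym => /negPf ->.
Qed.

Lemma lr_entry_size A lam f b : lr_function A lam f -> b \in boxes A -> f b < size lam.
Proof.
move=> [ss la wl] hb; rewrite -part_nth_gt0 -wl -has_count.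
by apply/hasP; exists b; rewrite /= ?eqxx.
Qed.

Lemma lr_sumn A lam f : lr_function A lam f -> sumn lam = size (boxes A).
Proof.
move=> lr; have [ss la wl] := lr.
rewrite -(sum_count_eq (f := f) (K := size lam)); last by move=> b hb; apply: lr_entry_size lr hb.
by rewrite sumnE (big_nth 0) big_mkord; apply: eq_bigr => i _; rewrite -wl.
Qed.

Definition has_square (A : skew_shape) : Prop :=
  exists i j, [/\ (i, j) \in boxes A, (i, j.+1) \in boxes A,
                  (i.+1, j) \in boxes A & (i.+1, j.+1) \in boxes A].

Lemma lattice_present A f j u v : lattice A f -> u <= v ->
  0 < right_count A f j v -> 0 < right_count A f j u.
Proof.
move=> la; elim: v => [|v IH]; first by rewrite leqn0 => /eqP ->.
rewrite leq_eqVlt ltnS => /predU1P [-> //|uv h]; apply: IH uv _.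
exact: leq_trans h (la j v).
Qed.

(* In a lattice filling all of whose positive entries are distinct, the bottom
   row of a square cannot be filled. *)
Lemma hook_no_square A lam f : lr_function A lam f -> (forall v, nth 0 lam v.+1 <= 1) -> ~ has_square A.
Proof.
move=> [ss la wl] hk [i [j [b1 b2 b3 b4]]].
have [_ /(_ erefl (ltnSn i)) h1] := ss _ _ b1 b3.
have [_ /(_ erefl (ltnSn i)) h2] := ss _ _ b2 b4.
have [/(_ erefl (leqnSn j)) h3 _] := ss _ _ b3 b4.
have : 0 < right_count A f j.+1 (f (i.+1, j)).
  apply: (lattice_present la h3); rewrite -has_count; apply/hasP.
  by exists (i.+1, j.+1); rewrite //= leqnn eqxx.
rewrite -has_count => /hasP [c hc /andP[jc /eqP fc]].
have : 2 <= weight A f (f (i.+1, j)).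
  apply: (@leq_trans (size [:: c; (i.+1, j)])) => //.
  rewrite /weight -size_filter; apply: uniq_leq_size.
    by rewrite /= andbT inE; apply/eqP => e; move: jc; rewrite e ltnn.
  by move=> x; rewrite !inE mem_filter => /orP[] /eqP ->; rewrite /= ?fc ?eqxx.
rewrite wl; case: (f (i.+1, j)) h1 => // v _; have := hk v; lia.
Qed.

Lemma no_square_out A i : ~ has_square A -> out A i.+1 <= (inn A i).+1.
Proof.
move=> ns; rewrite leqNgt; apply/negP => h; apply: ns; exists i, (inn A i).
have := inn_anti A (leqnSn i); have := out_anti A (leqnSn i).
by rewrite !mem_boxes => h1 h2; split; lia.
Qed.

Lemma no_square_in A : (forall i, out A i.+1 <= (inn A i).+1) -> ~ has_square A.
Proof.
by move=> H [i [j []]]; rewrite !mem_boxes => b1 b2 b3 b4; have := H i; lia.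
Qed.

(** * Two explicit lattice fillings *)

Section HookFilling.
Variable A : skew_shape.
Hypothesis ns : ~ has_square A.

(** The weight is a hook with [nrows A] rows: each positive rank occurs once, at the right end of
    its row. *)
Definition hook_filling (b : nat * nat) : nat :=
  if b.2.+1 == out A b.1 then rank A b.1 else 0.

Lemma hook_filling_ssyt : ssyt A hook_filling.
Proof.
move=> [i j] [i' j']; rewrite !mem_boxes /hook_filling /= => hb hc; split.
  move=> e jj; subst i'; case: eqP => // h1; case: eqP => // h2; lia.
move=> e ii; subst j'.
(* Without squares, a box that has a box above it is the last of its row. *)
have h1 := no_square_out i ns; have h2 := out_anti A ii.
have -> : (j.+1 == out A i') by lia.
have : rank A i < rank A i' by apply: rank_lt ii; rewrite mem_rows; lia.
by case: ifP => _; lia.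
Qed.

Lemma hook_filling_lattice : lattice A hook_filling.
Proof.
move=> j v; case: (posnP (right_count A hook_filling j v.+1)) => [->//|h].
have h1 : right_count A hook_filling j v.+1 <= 1.
  apply: (@count_inj_le _ _ _ (fun=> 0) [:: 0] (boxes_uniq A)) => //.
  move=> b c hb hc /andP[_ /eqP fb] /andP[_ /eqP fc] _.
  move: fb fc; rewrite /hook_filling; case: eqP => // e1 r1; case: eqP => // e2 r2.
  have e : b.1 = c.1 by apply: (rank_inj (box_rows hb) (box_rows hc)); rewrite r1 r2.
  rewrite [b]surjective_pairing [c]surjective_pairing e; congr (_, _).
  by apply/eqP; rewrite -eqSS e1 e2 e.
apply: leq_trans h1 _.
move: h; rewrite -has_count => /hasP [b hb /andP[jb /eqP]].
rewrite /hook_filling; case: eqP => // e1 r1.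
have vr : v < nrows A by have := rank_lt_nrows (box_rows hb); rewrite r1; lia.
have [i hi ri] := rank_surj vr.
have ib : i < b.1.
  rewrite ltnNge; apply/negP => h; have := rank_mono A h; rewrite ri r1 ltnn //.
rewrite mem_rows in hi; have := out_anti A (ltnW ib).
rewrite /right_count -has_count => ob; apply/hasP; exists (i, (out A i).-1).
  by rewrite mem_boxes; lia.
have jo : j < out A i by apply: leq_trans ob; rewrite -e1 ltnS.
rewrite /= /hook_filling /= prednK ?eqxx ?ri ?eqxx ?andbT; first by rewrite -ltnS prednK //; lia.
exact: leq_ltn_trans jo.
Qed.

Lemma hook_filling_rows : 0 < size (boxes A) -> 0 < weight A hook_filling (nrows A).-1.
Proof.
move=> A0; have n0 : 0 < nrows A.
  case E : (boxes A) A0 => [//|b s] _.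
  have : b.1 \in rows A by apply: box_rows; rewrite E mem_head.
  by rewrite /nrows -/(rows A); case: (rows A).
have [|i hi ri] := @rank_surj A (nrows A).-1; first lia.
rewrite mem_rows in hi; rewrite -has_count; apply/hasP; exists (i, (out A i).-1).
  by rewrite mem_boxes; lia.
rewrite /= /hook_filling /= prednK ?eqxx ?ri ?eqxx //; exact: leq_ltn_trans hi.
Qed.
End HookFilling.

Section ColumnFilling.
Variable A : skew_shape.

(** Each column is numbered from its top, so there are [ncols A] zeros and the support reaches the
    largest possible first part. *)
Definition column_filling (b : nat * nat) : nat := count (fun i => (i, b.2) \in boxes A) (iota 0 b.1).

Lemma column_fillingS i j : (i, j) \in boxes A -> column_filling (i.+1, j) = (column_filling (i, j)).+1.
Proof.
move=> hb; have -> : column_filling (i.+1, j) = count (fun k => (k, j) \in boxes A) (iota 0 (i + 1)).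
  by rewrite addn1.
by rewrite iotaD count_cat /= add0n hb addn0 addn1.
Qed.

Lemma column_filling_ssyt : ssyt A column_filling.
Proof.
move=> [i j] [i' j']; rewrite !mem_boxes /= => hb hc; split=> [e jj|e ii].
  subst i'; rewrite /column_filling -!size_filter; apply: uniq_leq_size.
    by rewrite filter_uniq ?iota_uniq.
  move=> k; rewrite !mem_filter !mem_iota /= !add0n !mem_boxes => /andP[h ki]; rewrite ki andbT.
  by have := out_anti A (ltnW ki); lia.
subst j'; apply: (@leq_trans (column_filling (i.+1, j))).
  by rewrite column_fillingS ?mem_boxes.
by rewrite /column_filling /= -(subnKC ii) iotaD count_cat leq_addr.
Qed.

Lemma column_filling_above i j : (i, j) \in boxes A -> 0 < column_filling (i, j) ->
  0 < i /\ (i.-1, j) \in boxes A.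
Proof.
rewrite /column_filling -has_count /= => hb /hasP [k]; rewrite mem_iota /= => ki hk.
split; first lia.
move: hb hk; rewrite !mem_boxes; have ki' : k <= i.-1 by lia.
have := inn_anti A ki'; have := out_anti A (leq_pred i); lia.
Qed.

(** Each [v.+1] has a [v] directly above it, in the same column. *)
Lemma column_filling_lattice : lattice A column_filling.
Proof.
move=> j v; rewrite /right_count -!size_filter.
rewrite -(size_map (fun b : nat * nat => (b.1.-1, b.2))); apply: uniq_leq_size.
  rewrite map_inj_in_uniq ?filter_uniq ?boxes_uniq // => -[i1 j1] [i2 j2].
  rewrite !mem_filter => /andP[/andP[_ /eqP f1] h1] /andP[/andP[_ /eqP f2] h2] /= [e1 e2].
  have [|p1 _] := column_filling_above h1; first by rewrite f1.
  have [|p2 _] := column_filling_above h2; first by rewrite f2.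
  by rewrite e2; congr (_, _); lia.
move=> x /mapP [[i1 j1]]; rewrite mem_filter => /andP[/andP[/= jj /eqP f1] h1] ->.
have [|p1 h2] := column_filling_above h1; first by rewrite f1.
rewrite mem_filter h2 jj /= !andbT.
by move: f1; rewrite -{1}(prednK p1) column_fillingS // => -[->].
Qed.

Lemma column_filling_weight0 : ncols A <= weight A column_filling 0.
Proof.
have top j : j \in cols A -> exists i, ((i, j) \in boxes A) && (column_filling (i, j) == 0).
  move=> /mem_cols ex; case: (ex_minnP ex) => i hi mini; exists i; rewrite hi /=.
  rewrite -leqn0 leqNgt; apply/negP => /(column_filling_above hi) [i0 h].
  by have := mini _ h; lia.
have topW j : exists i, (j \in cols A) ==> ((i, j) \in boxes A) && (column_filling (i, j) == 0).
  by case: (boolP (j \in cols A)) => [/top //|_]; exists 0.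
pose h j := (xchoose (topW j), j).
apply: (@count_ge_uniq _ _ _ (cols A) h (cols_uniq A)) => [j1 j2 _ _ [_ ->] //|j jc].
exact: (implyP (xchooseP (topW j)) jc).
Qed.
End ColumnFilling.

(** * Connectedness by counting bottom boxes *)

Definition bottom (A : skew_shape) (b : nat * nat) : bool := (b.1.+1, b.2) \notin boxes A.

(** The columns of a skew shape are contiguous, so only the lowest box of a column has no box below
    it. *)
Lemma count_bottom A : count (bottom A) (boxes A) = ncols A.
Proof.
apply/eqP; rewrite eqn_leq; apply/andP; split.
  apply: (count_inj_le (g := snd) (boxes_uniq A)); last by move=> b hb _; apply: box_cols.
  move=> [i j] [i' j'] hb hc; rewrite /bottom /= => nb nc e; subst j'.
  case: (ltngtP i i') => h; [exfalso|exfalso|by rewrite h].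
  - move/negP: nb; apply; move: hb hc; rewrite !mem_boxes.
    by have := out_anti A h; have := inn_anti A (leqnSn i); lia.
  - move/negP: nc; apply; move: hb hc; rewrite !mem_boxes.
    by have := out_anti A h; have := inn_anti A (leqnSn i'); lia.
have bot j : exists i, (j \in cols A) ==> ((i, j) \in boxes A) && bottom A (i, j).
  case: (boolP (j \in cols A)) => [/mem_cols ex|_]; last by exists 0.
  have ub i : (i, j) \in boxes A -> i <= size (outer A) by move/box_row_lt/ltnW.
  case: (ex_maxnP ex ub) => i hi maxi; exists i; rewrite hi /bottom /=.
  by apply/negP => /maxi; rewrite ltnn.
pose h j := (xchoose (bot j), j).
apply: (@count_ge_uniq _ _ _ (cols A) h (cols_uniq A)) => [j1 j2 _ _ [_ ->] //|j jc].
exact: (implyP (xchooseP (bot j)) jc).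
Qed.

Lemma count_not_bottom A : ncols A + count (predC (bottom A)) (boxes A) = size (boxes A).
Proof. by rewrite -count_bottom count_predC. Qed.

Lemma gap_disconnected A b c i : b \in boxes A -> c \in boxes A -> b.1 <= i -> i < c.1 ->
  out A i.+1 <= inn A i -> disconnected A.
Proof.
move=> hb hc bi ic gap.
have [|||| B [Bo Bi]] := @mk_skew (fun k => if k <= i then out A k else 0)
   (fun k => if k <= i then inn A k else 0) i.+1.
- by move=> k k' kk; have := out_anti A kk; case: (leqP k i); case: (leqP k' i) => //; lia.
- by move=> k k' kk; have := inn_anti A kk; case: (leqP k i); case: (leqP k' i) => //; lia.
- by move=> k; case: (k <= i) => //; apply: inn_le_out.
- by rewrite ltnn.
(* The rows above the gap are emptied by giving both shapes the same length there, large enough for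
   them to remain partitions. *)
have [|||| C [Co Ci]] := @mk_skew (fun k => if k <= i then out A i.+1 else out A k)
   (fun k => if k <= i then out A i.+1 else inn A k) (maxn i.+1 (size (outer A))).
- move=> k k' kk; case: (leqP k i) => h1; case: (leqP k' i) => h2 //; try exact: out_anti; lia.
- move=> k k' kk; case: (leqP k i) => h1; case: (leqP k' i) => h2 //; try exact: inn_anti; try lia.
  by apply: leq_trans (inn_le_out A k') (out_anti A h2).
- by move=> k; case: (k <= i) => //; apply: inn_le_out.
- by rewrite ifF; [rewrite nth_default // leq_maxr|lia].
have memB x : (x \in boxes B) = (x \in boxes A) && (x.1 <= i).
  by rewrite !mem_boxesE Bo Bi; case: (leqP x.1 i); lia.
have memC x : (x \in boxes C) = (x \in boxes A) && (i < x.1).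
  by rewrite !mem_boxesE Co Ci; case: (leqP x.1 i); lia.
exists B, C; split.
- by apply/eqP => E; have := memB b; rewrite E hb bi.
- by apply/eqP => E; have := memC c; rewrite E hc ic.
- apply: uniq_perm; first exact: boxes_uniq.
    rewrite cat_uniq !boxes_uniq andbT /=; apply/hasPn => x; rewrite memC memB => /andP[_ h].
    by rewrite negb_and -ltnNge h orbT.
  by move=> x; rewrite mem_cat memB memC -andb_orr; case: leqP; rewrite ?andbT.
- move=> x y; rewrite memB memC => /andP[hx xi] /andP[hy iy]; split; apply/eqP => e; first lia.
  move: hx hy; rewrite !mem_boxesE; have := inn_anti A xi; have := out_anti A iy; lia.
Qed.

(** Membership in one part spreads from row to row through column [inn A i], which rows [i] and
    [i.+1] have in common. *)
Lemma no_gap_connected A :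
  (forall i b c, b \in boxes A -> c \in boxes A -> b.1 <= i -> i < c.1 -> inn A i < out A i.+1) ->
  connected A.
Proof.
move=> H [B [C [B0 C0 pAB dis]]].
have mem x : (x \in boxes A) = (x \in boxes B) || (x \in boxes C).
  by rewrite (perm_mem pAB) mem_cat.
have share x y : x \in boxes B -> y \in boxes A -> x.1 = y.1 \/ x.2 = y.2 -> y \in boxes B.
  move=> xB; rewrite mem => /orP[//|yC] [] e; have [/eqP h1 /eqP h2] := dis _ _ xB yC; [by case: h1|by case: h2].
have [b bB] : exists b, b \in boxes B by case: (boxes B) B0 => // b s _; exists b; rewrite mem_head.
have [c cC] : exists c, c \in boxes C by case: (boxes C) C0 => // c s _; exists c; rewrite mem_head.
have bA : b \in boxes A by rewrite mem bB.
have cA : c \in boxes A by rewrite mem cC orbT.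
suff cB : c \in boxes B by have [/eqP h _] := dis _ _ cB cC; case: h.
have down n : b.1 + n <= c.1 -> exists2 x, x \in boxes B & x.1 = b.1 + n.
  elim: n => [|n IH] hn; first by exists b; rewrite ?addn0.
  have [|x xB x1] := IH; first lia.
  have xA : x \in boxes A by rewrite mem xB.
  have h := H (b.1 + n) b c bA cA (leq_addr _ _) ltac:(lia).
  exists ((b.1 + n).+1, inn A (b.1 + n)); last by rewrite /= addnS.
  have yA : (b.1 + n, inn A (b.1 + n)) \in boxes A.
    by rewrite mem_boxes leqnn; apply: leq_trans h (out_anti A (leqnSn _)).
  have yB := share _ _ xB yA (or_introl x1).
  apply: (share _ _ yB); last by right.
  by rewrite mem_boxes h (inn_anti A (leqnSn _)).
have up n : n <= b.1 -> c.1 <= b.1 - n -> exists2 x, x \in boxes B & x.1 = b.1 - n.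
  elim: n => [|n IH] hn hc; first by exists b; rewrite ?subn0.
  have [||x xB x1] := IH; [lia|lia|].
  have h := H (b.1 - n.+1) c b cA bA hc ltac:(lia).
  have e : (b.1 - n.+1).+1 = b.1 - n by lia.
  rewrite e in h.
  exists (b.1 - n.+1, inn A (b.1 - n.+1)) => //.
  have yA : (b.1 - n, inn A (b.1 - n.+1)) \in boxes A.
    by rewrite mem_boxes h; rewrite inn_anti //; lia.
  have yB := share _ _ xB yA (or_introl x1).
  apply: (share _ _ yB); last by right.
  by rewrite mem_boxes leqnn; apply: leq_trans h (out_anti A _); lia.
have [x xB x1] : exists2 x, x \in boxes B & x.1 = c.1.
  case: (leqP b.1 c.1) => h.
    by have [|x xB x1] := down (c.1 - b.1); [lia|exists x => //; rewrite x1 subnKC].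
  by have [||x xB x1] := up (b.1 - c.1); [lia|lia|exists x => //; rewrite x1 subKn // ltnW].
by apply: share xB cA _; left.
Qed.

Lemma connected_no_gap A i b c : connected A -> b \in boxes A -> c \in boxes A ->
  b.1 <= i -> i < c.1 -> inn A i < out A i.+1.
Proof.
move=> cn hb hc bi ic; rewrite ltnNge; apply/negP => h; apply: cn.
exact: gap_disconnected hb hc bi ic h.
Qed.

(** In every nonempty row but the last, the leftmost box has a box below it; by [count_not_bottom]
    there are only [size (boxes A) - ncols A] such boxes. *)
Lemma connected_rows_cols A : connected A -> nrows A + ncols A <= (size (boxes A)).+1.
Proof.
move=> cn; rewrite -count_not_bottom -addnS addnC leq_add2l.
case: (posnP (nrows A)) => [->//|n0].
have [|m hm rm] := @rank_surj A (nrows A).-1; first lia.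
have mmax i : i \in rows A -> i <= m.
  move=> hi; rewrite leqNgt; apply/negP => h; have := rank_lt hm h.
  by have := rank_lt_nrows hi; rewrite rm; lia.
have -> : nrows A = (size (filter (fun i => i != m) (rows A))).+1.
  rewrite size_filter -[LHS](count_predC (pred1 m)) (_ : count _ _ = 1) ?add1n //.
  by rewrite count_uniq_mem ?rows_uniq // hm.
rewrite ltnS; apply: (@count_ge_uniq _ _ _ _ (fun i => (i, inn A i))).
- by rewrite filter_uniq ?rows_uniq.
- by move=> i i' _ _ [->].
move=> i; rewrite mem_filter => /andP[im hi].
have hb : (i, inn A i) \in boxes A by rewrite mem_boxes leqnn -mem_rows.
rewrite hb /= /bottom negbK mem_boxes /= inn_anti //=.
have hc : (m, inn A m) \in boxes A by rewrite mem_boxes leqnn -mem_rows.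
apply: (connected_no_gap cn hb hc) => //=.
by rewrite ltn_neqAle im mmax.
Qed.

(** Without squares a row has at most one box with a box below it. Sending such boxes to the next
    row misses the first nonempty row and, if there is a gap, also the first one after it, which
    leaves too few of them. *)
Lemma no_square_connected A : ~ has_square A -> nrows A + ncols A <= (size (boxes A)).+1 -> connected A.
Proof.
move=> ns le; apply: no_gap_connected => i b c hb hc bi ic; rewrite ltnNge; apply/negP => gap.
have exr : exists k, (i < k) && (k \in rows A) by exists c.1; rewrite ic box_rows.
case: (ex_minnP exr) => i2 /andP[ii2 hi2] min2.
have ex1 : exists k, k \in rows A by exists i2.
case: (ex_minnP ex1) => i1 hi1 min1.
have i1i : i1 <= i by apply: leq_trans bi; apply: min1; apply: box_rows.
have h : (count (predC (bottom A)) (boxes A)) + 2 <= nrows A.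
  rewrite -size_filter -(size_map (fun b : nat * nat => b.1.+1)).
  rewrite addn2 -[X in X <= _]/(size (i1 :: i2 :: _)); apply: uniq_leq_size.
    rewrite /= !inE negb_or; apply/and3P; split.
    - by apply/andP; split; [lia|]; apply/mapP => -[[k j]]; rewrite mem_filter => /andP[_ hk] /= e;
        have := min1 _ (box_rows hk); rewrite /= e ltnn.
    - apply/mapP => -[[k j]]; rewrite mem_filter /bottom /= negbK => /andP[hk' hk] e.
      case: (ltngtP k i) => ki; [lia| |].
        by have := min2 k; rewrite ki (box_rows hk) e ltnn => /(_ isT).
      by move: hk hk'; rewrite !mem_boxes ki; lia.
    - rewrite map_inj_in_uniq ?filter_uniq ?boxes_uniq // => -[k j] [k' j'].
      rewrite !mem_filter /bottom /= !negbK => /andP[h1 h2] /andP[h3 h4] [e]; subst k'.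
      congr (_, _); move: h1 h2 h3 h4; rewrite !mem_boxes; have := no_square_out k ns; lia.
  move=> k; rewrite !inE => /or3P [/eqP ->|/eqP ->|] //.
  by case/mapP => x; rewrite mem_filter /bottom /= negbK => /andP[h1 _] ->; apply: (box_rows h1).
have := count_not_bottom A; lia.
Qed.

(** * Ribbons as lattice paths *)

Section LengthBounds.
Variables (A : skew_shape) (lam : intpart) (f : nat * nat -> nat).
Hypothesis lr : lr_function A lam f.

Let le_count i v := count (fun b => (b.1 <= i) && (f b == v)) (boxes A).
Let lt_count i v := count (fun b => (b.1 < i) && (f b == v)) (boxes A).
Let eq_count_row i v := count (fun b => (b.1 == i) && (f b == v)) (boxes A).

Let le_split i v : le_count i v = lt_count i v + eq_count_row i v.
Proof.
rewrite /le_count /lt_count /eq_count_row -count_predUI.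
rewrite [X in _ + X](eq_count (a2 := pred0)) ?count_pred0 ?addn0.
  by apply: eq_count => b /=; case: (ltngtP b.1 i) => //=; rewrite ?orbF ?andbF.
by move=> b /=; case: (ltngtP b.1 i); rewrite ?andbF.
Qed.

(** Sum [lattice_rows] over all letters: the entries of row [i] telescope, and only the zeros in
    rows up to [i] remain. *)
Lemma row_length_le_head i : row_length A i <= nth 0 lam 0.
Proof.
have [ss la wl] := lr.
have H K : \sum_(v < K.+1) eq_count_row i v + \sum_(v < K.+1) lt_count i v <=
    le_count i 0 + \sum_(v < K) lt_count i v.
  rewrite -big_split /= big_ord_recl /= addnC -[_ + lt_count _ _]/(eq_count_row i 0 + lt_count i 0).
  rewrite [eq_count_row i 0 + _]addnC -le_split addnC leq_add2l.
  apply: leq_sum => v _; rewrite addnC -le_split; exact: lattice_rows.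
have rowE : row_length A i = \sum_(v < (size lam).+1) eq_count_row i v.
  have -> : row_length A i = size (filter (fun b => b.1 == i) (boxes A)) by rewrite size_filter.
  rewrite -(sum_count_eq (f := f) (K := (size lam).+1)); last first.
    by move=> b; rewrite mem_filter => /andP[_ hb]; apply: ltnW; apply: (lr_entry_size lr hb).
  apply: eq_bigr => v _; rewrite count_filter; apply: eq_count => b /=; exact: andbC.
have := H (size lam); rewrite -rowE big_ord_recr /= addnCA [X in _ <= X]addnC leq_add2l => h.
apply: leq_trans (_ : le_count i 0 <= _); first by apply: leq_trans h; apply: leq_addr.
by rewrite -wl; apply: sub_count => b /andP[].
Qed.

(** Going down through the letters, [lattice_rows] gives at least as many letters [r] in the rows of
    rank at most [r] as there are last letters. Rows of smaller rank cannot contain [r], so they all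
    stand in the row of rank [r]. *)
Lemma row_length_ge_last i : size lam = nrows A -> i \in rows A ->
  nth 0 lam (nrows A).-1 <= row_length A i.
Proof.
have [ss la wl] := lr; move=> sl hi; set l := nrows A.
have l0 : 0 < l by apply: leq_ltn_trans (rank_lt_nrows hi).
have rank_le k k' : k' \in rows A -> rank A k <= rank A k' -> k <= k'.
  by move=> hk' r; rewrite leqNgt; apply/negP => h; have := rank_lt hk' h; rewrite ltnNge r.
have H n : n < l -> forall k, k \in rows A -> rank A k = l.-1 - n ->
    nth 0 lam l.-1 <= le_count k (l.-1 - n).
  elim: n => [|n IH] hn k hk rk.
    rewrite subn0 in rk *; rewrite -wl; rewrite /weight /le_count -!size_filter.
    apply: uniq_leq_size; first by rewrite filter_uniq ?boxes_uniq.
    move=> b; rewrite !mem_filter => /andP[-> hb]; rewrite hb !andbT.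
    by apply: rank_le => //; rewrite rk -ltnS prednK //; exact: rank_lt_nrows (box_rows hb).
  have [|k' hk' rk'] := @rank_surj A (l.-1 - n); first by rewrite -/l; lia.
  apply: leq_trans (IH (ltnW hn) k' hk' rk') _.
  have e : l.-1 - n = (l.-1 - n.+1).+1 by lia.
  rewrite e; apply: leq_trans (lattice_rows k' _ ss la) _.
  rewrite /le_count -!size_filter; apply: uniq_leq_size; first by rewrite filter_uniq ?boxes_uniq.
  move=> b; rewrite !mem_filter => /andP[/andP[bk ->] hb]; rewrite hb !andbT.
  by apply: rank_le => //; rewrite rk -ltnS -e -rk'; exact: rank_lt (box_rows hb) bk.
have rl := rank_lt_nrows hi; rewrite -/l in rl.
have h : rank A i = l.-1 - (l.-1 - rank A i) by lia.
have := H (l.-1 - rank A i) ltac:(lia) i hi h; rewrite -h le_split.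
rewrite (_ : lt_count i _ = 0) ?add0n => [le|].
  by apply: leq_trans le _; apply: sub_count => b /andP[].
apply/eqP; rewrite -leqn0 leqNgt -has_count; apply/hasP => -[b hb /andP[bi /eqP fb]].
by have := leq_ltn_trans (lattice_entry_rank ss la hb) (rank_lt (box_rows hb) bi); rewrite fb ltnn.
Qed.

Lemma col_length_le j : col_length A j <= size lam.
Proof.
have [ss la wl] := lr.
rewrite -(size_iota 0 (size lam)); apply: (count_inj_le (g := f) (boxes_uniq A)).
  by move=> b c hb hc /eqP b2 /eqP c2 e; apply: (ssyt_col_inj ss) => //; rewrite b2 c2.
by move=> b hb _; rewrite mem_iota add0n; exact: (lr_entry_size lr hb).
Qed.

(** A letter occurs at most once per column, so one of multiplicity [ncols A] occurs in every
    column. *)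
Lemma col_length_ge q j : (forall v, v < q -> nth 0 lam v = ncols A) -> j \in cols A ->
  q <= col_length A j.
Proof.
have [ss la wl] := lr; move=> Hq hj.
have ex v : exists b : nat * nat, (v < q) ==> [&& b \in boxes A, b.2 == j & f b == v].
  case: (ltnP v q) => vq; last by exists (0, 0).
  case: (boolP (has (fun b => (b.2 == j) && (f b == v)) (boxes A))) => [/hasP [b hb h]|/hasPn no].
    by exists b; rewrite hb h.
  have : weight A f v <= size (rem j (cols A)).
    apply: (count_inj_le (g := snd) (boxes_uniq A)).
      by move=> b c hb hc /eqP fb /eqP fc e; apply: (ssyt_col_inj ss) => //; rewrite fb fc.
    move=> b hb fb; rewrite mem_rem_uniq ?cols_uniq // inE box_cols // andbT.
    by apply/negP => b2; have := no b hb; rewrite b2 fb.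
  rewrite wl Hq // size_rem // /ncols -/(cols A).
  have : 0 < size (cols A) by case: (cols A) hj.
  by case: (size _) => // n _; rewrite ltnn.
pose h v := xchoose (ex v).
have hP v : v < q -> [&& h v \in boxes A, (h v).2 == j & f (h v) == v].
  by move=> vq; apply: (implyP (xchooseP (ex v)) vq).
rewrite -(size_iota 0 q); apply: (@count_ge_uniq _ _ _ _ h (iota_uniq 0 q)).
  move=> v w; rewrite !mem_iota !add0n => /hP /and3P [_ _ /eqP e1] /hP /and3P [_ _ /eqP e2] e.
  by rewrite -e1 -e2 e.
by move=> v; rewrite mem_iota add0n => /hP /and3P [-> -> _].
Qed.
End LengthBounds.

(** * Steps and levels of a path *)

Definition steps (e : nat -> bool) (t : nat) : nat := \sum_(s < t) e s.

Lemma stepsS e t : steps e t.+1 = steps e t + e t.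
Proof. by rewrite /steps big_ord_recr. Qed.

Lemma steps0 e : steps e 0 = 0. Proof. by rewrite /steps big_ord0. Qed.

Lemma steps_mono e t u : t <= u -> steps e t <= steps e u.
Proof.
elim: u => [|u IH]; first by rewrite leqn0 => /eqP ->.
rewrite leq_eqVlt ltnS => /predU1P [-> //|/IH h].
by rewrite stepsS; apply: leq_trans h (leq_addr _ _).
Qed.

Lemma steps_compl e t : steps e t + steps (fun s => ~~ e s) t = t.
Proof. by elim: t => [|t IH]; rewrite ?steps0 // !stepsS; case: (e t) => /=; lia. Qed.

Lemma steps_surj e t i : i <= steps e t -> exists2 s, s <= t & steps e s = i.
Proof.
elim: t => [|t IH]; first by rewrite steps0 leqn0 => /eqP ->; exists 0; rewrite ?steps0.
case: (leqP i (steps e t)) => [/IH [s st es] _|h h']; first by exists s => //; apply: ltnW.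
by exists t.+1 => //; move: h h'; rewrite stepsS; case: (e t) => /=; lia.
Qed.

(** The number of boxes visited between two consecutive steps of kind [e]: a row length if these are
    the down steps, a column length if they are the left steps. *)
Definition level_size (e : nat -> bool) (N i : nat) : nat := \sum_(t < N) (steps e t == i).

Lemma block_start_level e N i : block_start (level_size e N) i = \sum_(t < N) (steps e t < i).
Proof.
rewrite /block_start /level_size exchange_big /=; apply: eq_bigr => t _.
elim: i => [|i IH]; first by rewrite big_ord0.
by rewrite big_ord_recr /= IH ltnS [steps e t <= i]leq_eqVlt; case: (ltngtP (steps e t) i).
Qed.

Lemma block_start_levelP e N i t : t < N -> (t < block_start (level_size e N) i) = (steps e t < i).
Proof.
move=> tN; rewrite block_start_level.
have [s sN Hs] := @initial_segment (fun t => steps e t < i) 0 N (leq0n N)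
  (fun c d _ cd _ h => leq_ltn_trans (steps_mono e cd) h).
rewrite -(big_mkord xpredT (fun t => nat_of_bool (steps e t < i))).
rewrite (sum_range (P := fun t => steps e t < i) (u := 0) (v := s)) ?subn0 //.
by rewrite Hs.
Qed.

Lemma block_start_full e N : 0 < N -> block_start (level_size e N) (steps e N.-1).+1 = N.
Proof.
move=> N0; rewrite block_start_level -[RHS](card_ord N) -sum1_card; apply: eq_bigr => t _.
by rewrite ltnS steps_mono //; have := ltn_ord t; lia.
Qed.

(** Translates the steps of a path into the ascents prescribed by [block_word]. *)
Lemma step_block_start e N t : t.+1 < N ->
  e t = [exists i : 'I_(steps e N.-1).+1, t.+1 == block_start (level_size e N) i].
Proof.
move=> tN; have tN' := ltnW tN; apply/idP/existsP => [et|[i /eqP ti]].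
  have h : steps e t.+1 < (steps e N.-1).+1 by rewrite ltnS; apply: steps_mono; lia.
  exists (Ordinal h) => /=; rewrite eqn_leq block_start_levelP // stepsS et addn1 ltnSn /=.
  by rewrite leqNgt block_start_levelP // stepsS et addn1 ltnn.
have h1 : t < block_start (level_size e N) i by rewrite -ti.
have h2 : ~~ (t.+1 < block_start (level_size e N) i) by rewrite -ti ltnn.
by move: h1 h2; rewrite !block_start_levelP // stepsS; case: (e t) => //; rewrite addn0 => ->.
Qed.

(** The path starts at its top right box; step [t] goes down if [d t], otherwise left. The first
    clause of [follows_path] keeps the subtraction from truncating. *)
Definition path_box (a b : nat) (d : nat -> bool) (t : nat) : nat * nat :=
  (a + steps d t, b - steps (fun s => ~~ d s) t).

Definition follows_path (A : skew_shape) (a b : nat) (d : nat -> bool) : Prop :=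
  (forall t, t < size (boxes A) -> steps (fun s => ~~ d s) t <= b) /\
  perm_eq (boxes A) [seq path_box a b d t | t <- iota 0 (size (boxes A))].

Lemma perm_iota_downward (s : seq nat) : uniq s ->
  (forall t, t.+1 \in s -> t \in s) -> perm_eq s (iota 0 (size s)).
Proof.
move=> us dn.
have dn' t u : t <= u -> u \in s -> t \in s.
  elim: u => [|u IH]; first by rewrite leqn0 => /eqP ->.
  by rewrite leq_eqVlt ltnS => /predU1P [-> //|/IH h /dn].
have lt : {subset s <= iota 0 (size s)}.
  move=> x xs; rewrite mem_iota /= add0n -[X in X <= _](size_iota 0 x.+1).
  by apply: uniq_leq_size (iota_uniq _ _) _ => y; rewrite mem_iota ltnS => /= yx; apply: dn' yx xs.
have [|_ E] := uniq_min_size us lt; first by rewrite size_iota.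
by apply: uniq_perm; rewrite ?iota_uniq.
Qed.

Lemma ribbon_path A : ribbon A -> 0 < size (boxes A) -> exists a b d, follows_path A a b d.
Proof.
move=> [cn ns0] A0; have {}ns0 : ~ has_square A by move=> [i [j h]]; apply: ns0; exists i, j.
have exr : exists i, i \in rows A.
  case E : (boxes A) A0 => [//|x s] _; exists x.1; apply: box_rows; by rewrite E mem_head.
case: (ex_minnP exr) => a ha mina; pose b := (out A a).-1.
have ha' := ha; rewrite mem_rows in ha'.
have out_inn i x : x \in boxes A -> a <= i -> i < x.1 -> out A i.+1 = (inn A i).+1.
  move=> hx ai ix; apply/eqP; rewrite eqn_leq no_square_out //=.
  apply: (@connected_no_gap A i (a, inn A a) x) => //=.
  by rewrite mem_boxes leqnn.
pose next (x : nat * nat) := if inn A x.1 < x.2 then (x.1, x.2.-1) else (x.1.+1, x.2).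
pose bx t := iter t next (a, b).
pose d t := ~~ (inn A (bx t).1 < (bx t).2).
have bxE t : bx t = path_box a b d t /\ steps (fun s => ~~ d s) t <= b.
  elim: t => [|t [IH le]]; first by rewrite /path_box !steps0 addn0 subn0.
  rewrite /bx iterS -/(bx t) /path_box !stepsS /next {2 4 6}/d negbK IH /=.
  case: ltnP => h /=; last by rewrite addn1 addn0 addnS.
  rewrite addn0 addn1 subnS; split=> //; lia.
pose idx (x : nat * nat) := (x.1 - a) + (b - x.2).
have inA x : x \in boxes A -> a <= x.1 /\ x.2 <= b.
  move=> hx; have h := mina _ (box_rows hx); split=> //.
  by move: hx; rewrite mem_boxesE /b; have := out_anti A h; lia.
(* A box other than the first is preceded by the box to its right or, at the end of its row, by the
   one above. So the distances from the start fill an initial segment. *)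
have pred_ex x t : x \in boxes A -> idx x = t.+1 ->
    exists y, [/\ y \in boxes A, idx y = t & next y = x].
  case: x => i j hx; have [/= ai jb] := inA _ hx; rewrite /idx /= => e.
  have hx' := hx; rewrite mem_boxes in hx'.
  case: (boolP ((i, j.+1) \in boxes A)) => hy.
    exists (i, j.+1); split=> //=; last by rewrite /next /= ifT //; lia.
    by have [_ /= jb'] := inA _ hy; lia.
  have oj : out A i = j.+1 by move: hy; rewrite mem_boxes; lia.
  have ia : a < i.
    by rewrite ltn_neqAle ai andbT; apply/eqP => ai'; move: e oj; rewrite -ai' /b; lia.
  have ie : i = i.-1.+1 by lia.
  have oi := @out_inn i.-1 (i, j) hx ltac:(lia) ltac:(rewrite /=; lia).
  rewrite -ie oj in oi; case: oi => oi.
  exists (i.-1, j); split.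
  - by rewrite mem_boxes oi leqnn /=; have := out_anti A (leq_pred i); lia.
  - by rewrite /=; lia.
  - by rewrite /next /= oi ltnn -ie.
have all_bx t x : x \in boxes A -> idx x = t -> x = bx t.
  elim: t x => [|t IH] x hx e.
    case: x hx e => i j hx; have [/= h1 h2] := inA _ hx; rewrite /idx /= => e.
    by congr (_, _); lia.
  have [y [hy ey <-]] := pred_ex _ _ hx e.
  by rewrite /bx iterS -/(bx t) (IH _ hy ey).
have P : perm_eq [seq idx x | x <- boxes A] (iota 0 (size (boxes A))).
  rewrite -(size_map idx); apply: perm_iota_downward.
    rewrite map_inj_in_uniq ?boxes_uniq // => x y hx hy e.
    by rewrite (all_bx _ _ hx erefl) (all_bx _ _ hy erefl) e.
  move=> t /mapP [x hx e]; have [y [hy ey _]] := pred_ex _ _ hx (esym e).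
  by apply/mapP; exists y.
exists a, b, d; split; first by move=> t _; case: (bxE t).
have -> : boxes A = [seq path_box a b d t | t <- [seq idx x | x <- boxes A]].
  rewrite -map_comp -[LHS]map_id; apply/eq_in_map => x hx /=.
  by have [<- _] := bxE (idx x); apply: all_bx.
by apply: perm_map; rewrite size_map size_map.
Qed.

Lemma count_iota (P : pred nat) N : count P (iota 0 N) = \sum_(t < N) P t.
Proof.
elim: N => [|N IH]; first by rewrite big_ord0.
have -> : iota 0 N.+1 = iota 0 N ++ [:: N] by rewrite -addn1 iotaD.
by rewrite count_cat IH big_ord_recr /= addn0.
Qed.

Notation lefts d := (steps (fun s => ~~ d s)).

Section FollowsPath.
Variables (A : skew_shape) (a b : nat) (d : nat -> bool).
Hypothesis path : follows_path A a b d.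
Let N := size (boxes A).

Lemma path_le t : t < N -> lefts d t <= b.
Proof. by case: path => h _; apply: h. Qed.

Lemma path_perm : perm_eq (boxes A) [seq path_box a b d t | t <- iota 0 N].
Proof. by case: path. Qed.

Lemma path_ex x : x \in boxes A -> exists2 t, t < N & x = path_box a b d t.
Proof.
by rewrite (perm_mem path_perm) => /mapP [t]; rewrite mem_iota /= => tN ->; exists t.
Qed.

Lemma path_mem t : t < N -> path_box a b d t \in boxes A.
Proof. by move=> tN; rewrite (perm_mem path_perm); apply: map_f; rewrite mem_iota. Qed.

Lemma count_path (P : pred (nat * nat)) :
  count P (boxes A) = count (fun t => P (path_box a b d t)) (iota 0 N).
Proof. by rewrite (seq.permP path_perm) count_map. Qed.

Lemma path_row_length i : row_length A (a + i) = level_size d N i.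
Proof.
rewrite /row_length count_path count_iota; apply: eq_bigr => t _ /=.
by rewrite eqn_add2l.
Qed.

Lemma path_col_length k : k <= b -> col_length A (b - k) = level_size (fun s => ~~ d s) N k.
Proof.
move=> kb; rewrite /col_length count_path count_iota; apply: eq_bigr => t _ /=.
by have := path_le (ltn_ord t); move: (lefts d t) => z; lia.
Qed.

Hypothesis N0 : 0 < N.

Lemma path_nrows : nrows A = (steps d N.-1).+1.
Proof.
rewrite -(size_iota a (steps d N.-1).+1); apply: perm_size; apply: uniq_perm.
- exact: rows_uniq.
- exact: iota_uniq.
move=> i; rewrite -/(rows A) mem_iota; apply/idP/idP.
  rewrite mem_undup => /mapP [x /path_ex [t tN ->] ->] /=; rewrite leq_addr /= addnS ltnS leq_add2l.
  by apply: steps_mono; lia.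
move=> /andP[ai]; rewrite addnS ltnS => h.
have [|s sN es] := @steps_surj d N.-1 (i - a); first lia.
have -> : i = (path_box a b d s).1 by rewrite /= es subnKC.
by apply: box_rows; apply: path_mem; lia.
Qed.

Lemma path_ncols : ncols A = (lefts d N.-1).+1.
Proof.
have hb : lefts d N.-1 <= b by apply: path_le; lia.
rewrite -(size_iota (b - lefts d N.-1) (lefts d N.-1).+1); apply: perm_size; apply: uniq_perm.
- exact: cols_uniq.
- exact: iota_uniq.
move=> j; rewrite -/(cols A) mem_iota; apply/idP/idP.
  rewrite mem_undup => /mapP [x /path_ex [t tN ->] ->] /=.
  have : lefts d t <= lefts d N.-1 by apply: steps_mono; lia.
  by have := path_le tN; move: (lefts d t) => z; lia.
move=> h.
have [|s sN es] := @steps_surj (fun s => ~~ d s) N.-1 (b - j); first lia.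
have -> : j = (path_box a b d s).2 by rewrite /= es subKn //; lia.
by apply: box_cols; apply: path_mem; lia.
Qed.

Lemma level_size_gt0 i : i <= steps d N.-1 -> 0 < level_size d N i.
Proof.
move=> h; have [s sN es] := steps_surj h.
have sN' : s < N by lia.
by rewrite /level_size (bigD1 (Ordinal sN')) //= es eqxx.
Qed.

Lemma level_size_lefts_gt0 k : k <= lefts d N.-1 -> 0 < level_size (fun s => ~~ d s) N k.
Proof.
move=> h; have [s sN es] := steps_surj h.
have sN' : s < N by lia.
by rewrite /level_size (bigD1 (Ordinal sN')) //= es eqxx.
Qed.

(** The distance from the top right box recovers the time at which the path visits [x]. *)
Definition path_filling (w : seq nat) (x : nat * nat) : nat := nth 0 w ((x.1 - a) + (b - x.2)).

Lemma path_fillingE w t : t < N -> path_filling w (path_box a b d t) = nth 0 w t.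
Proof.
move=> tN; rewrite /path_filling /= addKn subKn ?path_le //; congr nth; exact: steps_compl.
Qed.

(** Rows are runs of left steps, where the word does not ascend, and columns are runs of down steps,
    where it does. The boxes from column [j] on form a prefix of the path, so ballot means
    lattice. *)
Lemma path_lr (lam : intpart) w : size w = N -> ballot w -> (forall v, count_mem v w = nth 0 lam v) ->
  (forall t, t.+1 < N -> (nth 0 w t < nth 0 w t.+1) = d t) ->
  lr_function A lam (path_filling w).
Proof.
move=> sw bw cw dw.
have down t u : t <= u -> u < N -> (forall s, t <= s < u -> ~~ d s) -> nth 0 w u <= nth 0 w t.
  elim: u => [|u IH]; first by rewrite leqn0 => /eqP ->.
  rewrite leq_eqVlt ltnS => /predU1P [-> //|tu] uN H.
  apply: leq_trans (IH tu (ltnW uN) _); last by move=> s hs; apply: H; lia.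
  by rewrite leqNgt dw // H // tu ltnSn.
have up t u : t < u -> u < N -> (forall s, t <= s < u -> d s) -> nth 0 w t < nth 0 w u.
  elim: u => // u IH; rewrite ltnS leq_eqVlt => /predU1P [->|tu] uN H.
    by rewrite dw // H // leqnn ltnSn.
  apply: ltn_trans (IH tu (ltnW uN) _) _; first by move=> s hs; apply: H; lia.
  by rewrite dw // H // ltnSn (ltnW tu).
split.
- move=> x y /path_ex [t tN ->] /path_ex [u uN ->]; rewrite !path_fillingE //=.
  have kt := path_le tN; have ku := path_le uN.
  have ct := steps_compl d t; have cu := steps_compl d u.
  split=> [/eqP|e2 /=].
    rewrite eqn_add2l => /eqP e1 le; have ut : u <= t by lia.
    apply: down => // s hs; apply/negP => ds.
    have : steps d u <= steps d s by apply: steps_mono; lia.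
    have : steps d s.+1 <= steps d t by apply: steps_mono; lia.
    by rewrite stepsS ds; lia.
  rewrite ltn_add2l => lt; have kk : lefts d t = lefts d u by lia.
  have tu : t < u by lia.
  apply: up => // s hs; apply/negPn/negP => ds.
  have : lefts d t <= lefts d s by apply: steps_mono; lia.
  have : lefts d s.+1 <= lefts d u by apply: steps_mono; lia.
  by rewrite stepsS ds; lia.
- move=> j v.
  have [t0 t0N Ht0] := @initial_segment (fun t => j <= b - lefts d t) 0 N (leq0n N)
    (fun c e _ ce _ h => leq_trans h (leq_sub2l b (steps_mono _ ce))).
  suff E u : right_count A (path_filling w) j u = count_mem u (take t0 w) by rewrite !E.
  rewrite /right_count count_path.
  rewrite [LHS](eq_in_count (a2 := fun t => (t < t0) && (nth 0 w t == u))); last first.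
    by move=> t; rewrite mem_iota /= => tN; rewrite path_fillingE // Ht0.
  rewrite -(subnKC (proj2 (andP t0N))) iotaD count_cat [X in _ + X](_ : _ = 0) ?addn0.
    have -> : take t0 w = [seq nth 0 w t | t <- iota 0 t0].
      by rewrite map_nth_iota0 // sw; case/andP: t0N.
    by rewrite count_map; apply: eq_in_count => t; rewrite mem_iota /= => ->.
  apply/eqP; rewrite -leqn0 leqNgt -has_count; apply/hasP => -[t].
  by rewrite mem_iota; lia.
- move=> v; rewrite /weight count_path -cw -[in RHS](mkseq_nth 0 w) count_map sw.
  by apply: eq_in_count => t; rewrite mem_iota /= => tN; rewrite path_fillingE.
Qed.
End FollowsPath.

Lemma level_size_ge3 e N t : t.+2 < N -> ~~ e t -> ~~ e t.+1 -> 3 <= level_size e N (steps e t).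
Proof.
move=> tN /negPf e0 /negPf e1; rewrite /level_size -(count_iota (fun s => steps e s == steps e t)).
rewrite -[3]/(size [:: t; t.+1; t.+2]) -size_filter; apply: uniq_leq_size.
  by rewrite /= !inE; lia.
by move=> s; rewrite !inE mem_filter mem_iota => /or3P [] /eqP ->; rewrite ?stepsS ?e0 ?e1 ?addn0 ?eqxx /=; lia.
Qed.

(** Level [k] consists of the times [k.*2] and [k.*2.+1] below [N], so a level of size one is the
    last one. *)
Lemma zigzag_admissible e N i : (forall s, s.+1 < N -> e s = odd s) ->
  level_size e N i = 1 -> i <= steps e N.-1 ->
  admissible_blocks (level_size e N) (steps e N.-1).
Proof.
move=> eo li iN.
have sE t : t < N -> steps e t = t./2.
  elim: t => [|t IH] tN; first by rewrite steps0.
  by rewrite stepsS IH ?(ltnW tN) // eo // -[t.+1./2]/(uphalf t) uphalf_half addnC.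
have lE k : level_size e N k = minn 2 (N - k.*2).
  rewrite /level_size (eq_bigr (fun t : 'I_N => nat_of_bool (t./2 == k))); last by move=> t _; rewrite sE.
  elim: (N) => [|n IH]; first by rewrite big_ord0; lia.
  by rewrite big_ord_recr /= IH; lia.
have N0 : 0 < N by move: li; rewrite lE; lia.
rewrite sE ?prednK //; right; rewrite lE in li; split=> [k kN|]; rewrite lE; lia.
Qed.

Lemma balanced_admissible (alpha : nat -> nat) l : (forall i, i <= l -> 2 <= alpha i) ->
  (forall i j, i <= l -> j <= l -> alpha i <= (alpha j).+1) -> admissible_blocks alpha l.
Proof.
move=> H1 H2; left.
have [i0 _ mi] := @arg_minnP _ (ord0 : 'I_l.+1) xpredT alpha isT.
exists (alpha i0); first by apply: H1; rewrite -ltnS.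
by move=> i il; rewrite (mi (Ordinal il)) //= H2 // -ltnS.
Qed.

(** If a row and a column both have length one, all lengths are at most two and the path alternates;
    its first step decides which reading has blocks 2, ..., 2, 1. *)
Lemma equitable_blocks A a b d : follows_path A a b d -> equitable_ribbon A -> 0 < size (boxes A) ->
  let N := size (boxes A) in
  admissible_blocks (level_size d N) (steps d N.-1) \/
  admissible_blocks (level_size (fun s => ~~ d s) N) (lefts d N.-1).
Proof.
move=> path [rb rowE colE] N0 N.
have rE i j : i <= steps d N.-1 -> j <= steps d N.-1 -> level_size d N i <= (level_size d N j).+1.
  move=> hi hj; rewrite -!(path_row_length path); apply: rowE; rewrite (path_row_length path) //;
  exact: level_size_gt0.
have lb : lefts d N.-1 <= b by apply: (path_le path); rewrite -/N; lia.
have cE i j : i <= lefts d N.-1 -> j <= lefts d N.-1 ->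
    level_size (fun s => ~~ d s) N i <= (level_size (fun s => ~~ d s) N j).+1.
  move=> hi hj; rewrite -!(path_col_length path) ?(leq_trans _ lb) //.
  by apply: colE; rewrite (path_col_length path) ?(leq_trans _ lb) //; exact: level_size_lefts_gt0.
case: (boolP (all (fun i => 2 <= level_size d N i) (iota 0 (steps d N.-1).+1))) => [/allP h|].
  by left; apply: balanced_admissible rE => i hi; apply: h; rewrite mem_iota.
rewrite -has_predC => /hasP [i1]; rewrite mem_iota /= -ltnNge ltnS => i1N li1.
case: (boolP (all (fun i => 2 <= level_size (fun s => ~~ d s) N i) (iota 0 (lefts d N.-1).+1))) => [/allP h|].
  by right; apply: balanced_admissible cE => i hi; apply: h; rewrite mem_iota.
rewrite -has_predC => /hasP [k1]; rewrite mem_iota /= -ltnNge ltnS => k1N lk1.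
have {}li1 : level_size d N i1 = 1.
  by apply/eqP; rewrite eqn_leq; apply/andP; split; [rewrite -ltnS|apply: level_size_gt0].
have {}lk1 : level_size (fun s => ~~ d s) N k1 = 1.
  by apply/eqP; rewrite eqn_leq; apply/andP; split; [rewrite -ltnS|apply: level_size_lefts_gt0].
have alt t : t.+2 < N -> d t.+1 = ~~ d t.
  move=> tN; case d0 : (d t); case d1 : (d t.+1) => //.
    have := @level_size_ge3 (fun s => ~~ d s) N t tN; rewrite d0 d1 => /(_ isT isT).
    have := cE (lefts d t) k1; rewrite lk1 => h1 h2; suff : lefts d t <= lefts d N.-1 by move=> /h1 /(_ k1N); lia.
    by apply: steps_mono; lia.
  have := @level_size_ge3 d N t tN; rewrite d0 d1 => /(_ isT isT).
  have := rE (steps d t) i1; rewrite li1 => h1 h2; suff : steps d t <= steps d N.-1 by move=> /h1 /(_ i1N); lia.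
  by apply: steps_mono; lia.
have dE t : t.+1 < N -> d t = odd t (+) d 0.
  elim: t => [|t IH] tN //; rewrite alt // IH ?(ltnW tN) //=.
  by rewrite addNb.
case d0 : (d 0); [right|left].
  by apply: zigzag_admissible lk1 k1N => s sN; rewrite dE // d0 addbT negbK.
by apply: zigzag_admissible li1 i1N => s sN; rewrite dE // d0 addbF.
Qed.

Lemma equitable_lr A lam : equitable_ribbon A -> 0 < size (boxes A) ->
  sumn (parts lam) = size (boxes A) -> size lam <= nrows A -> nth 0 lam 0 <= ncols A ->
  exists f, lr_function A lam f.
Proof.
move=> eq N0 sl hr hc; have [a [b [d path]]] := ribbon_path (let: And3 r _ _ := eq in r) N0.
rewrite (path_nrows path N0) in hr; rewrite (path_ncols path N0) in hc.
have cp := steps_compl d (size (boxes A)).-1.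
case: (equitable_blocks path eq N0) => adm.
  have [||| w [[ws wst] wb wc]] := row_word adm (lam := lam).
  - by rewrite sl block_start_full.
  - by [].
  - by rewrite sl; lia.
  rewrite block_start_full // in ws.
  exists (path_filling a b w); apply: (path_lr path) => // t tN.
  by rewrite wst ?ws // -step_block_start.
have [||| w [ws wb wc wst]] := column_row_word adm (lam := lam).
- by rewrite sl block_start_full.
- by [].
- by rewrite sl; lia.
exists (path_filling a b w); apply: (path_lr path) => //; first by rewrite ws.
move=> t tN; rewrite wst ?ws ?sl // -step_block_start //; exact: negbK.
Qed.

(** * Equitable ribbons exist *)

Lemma level_size_bound N e i : 0 < level_size e N i -> i <= steps e N.-1.
Proof.
rewrite /level_size -(count_iota (fun t => steps e t == i)) -has_count => /hasP [t].
by rewrite mem_iota /= => tN /eqP <-; apply: steps_mono; lia.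
Qed.

Section RibbonOfPath.
Variables (N : nat) (d : nat -> bool).
Hypothesis N0 : 0 < N.

Let l := (steps d N.-1).+1.
Let b := lefts d N.-1.

(* The number of steps to the left made in rows above row [i]. *)
Let L i := count (fun t => ~~ d t && (steps d t < i)) (iota 0 N.-1).

Let leftsE t : lefts d t = count (fun s => ~~ d s) (iota 0 t).
Proof. by rewrite count_iota. Qed.

Let L_mono i i' : i <= i' -> L i <= L i'.
Proof. by move=> ii; apply: sub_count => t /andP[-> h] /=; apply: leq_trans h ii. Qed.

Let L_le i : L i <= b.
Proof. by rewrite /b leftsE; apply: sub_count => t /andP[]. Qed.

Let L_full : L l = b.
Proof.
rewrite /b leftsE; apply: eq_in_count => t; rewrite mem_iota /= => tN.
by rewrite ltnS steps_mono ?andbT // ltnW.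
Qed.

Let L0 : L 0 = 0.
Proof. by apply/eqP; rewrite -leqn0 leqNgt -has_count; apply/hasP => -[t _ /andP[_]]. Qed.

Let L_path t : t < N -> L (steps d t) <= lefts d t <= L (steps d t).+1.
Proof.
move=> tN; rewrite leftsE /L.
have -> : iota 0 N.-1 = iota 0 t ++ iota t (N.-1 - t) by rewrite -{1}(subnKC (_ : t <= N.-1)) ?iotaD //; lia.
rewrite !count_cat; apply/andP; split.
  rewrite [X in _ + X](_ : _ = 0) ?addn0; first by apply: sub_count => s /andP[].
  apply/eqP; rewrite -leqn0 leqNgt -has_count; apply/hasP => -[s].
  rewrite mem_iota => /andP[ts _] /andP[_]; rewrite ltnNge => /negP; apply; exact: steps_mono.
apply: leq_trans (leq_addr _ _); rewrite -!size_filter; apply: uniq_leq_size.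
  by rewrite filter_uniq ?iota_uniq.
move=> s; rewrite !mem_filter mem_iota /= => /andP[-> st]; rewrite st /= andbT ltnS.
by apply: steps_mono; lia.
Qed.

Lemma ribbon_of_path : exists A, [/\ ribbon A, size (boxes A) = N & follows_path A 0 b d].
Proof.
(* Row [i] occupies the columns from [b - L i.+1] to [b - L i], so that consecutive rows overlap in
   one column. *)
have [|||| A [Ao Ai]] := @mk_skew (fun i => if i < l then b.+1 - L i else 0)
  (fun i => if i < l then b - L i.+1 else 0) l.
- by move=> i j ij; have := L_mono ij; case: (ltnP i l); case: (ltnP j l) => //; lia.
- move=> i j ij; have ij' : i.+1 <= j.+1 by [].
  by have := L_mono ij'; case: (ltnP i l); case: (ltnP j l) => //; lia.
- by move=> i; case: (i < l) => //; have := L_mono (leqnSn i); lia.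
- by rewrite ltnn.
have outS i : i.+1 < l -> out A i.+1 = (inn A i).+1.
  by move=> il; rewrite Ao Ai il (ltnW il); have := L_le i.+1; lia.
have lastrow i : l <= i -> out A i = 0 by move=> h; rewrite Ao ltnNge h.
have rb : ribbon A.
  split.
    apply: no_gap_connected => i x y _ hy _ iy; rewrite outS //.
    apply: leq_ltn_trans iy _; rewrite ltnNge; apply/negP => h.
    by move: hy; rewrite mem_boxesE lastrow // ltn0 andbF.
  apply: no_square_in => i; case: (ltnP i.+1 l) => h; first by rewrite outS.
  by rewrite lastrow.
have szo : size (outer A) = l.
  apply/eqP; rewrite eqn_leq; apply/andP; split.
    by rewrite leqNgt -part_nth_gt0 lastrow // .
  rewrite leqNgt; apply/negP => h; have := part_nth_gt0 (outer A) (size (outer A)).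
  by rewrite ltnn Ao h; have := L_le (size (outer A)); lia.
have sz : size (boxes A) = N.
  rewrite -(count_predT (boxes A)) count_boxes szo.
  have H k : k <= l -> \sum_(i < k) \sum_(inn A i <= c < out A i) true = L k + k.
    elim: k => [|k IH] kl; first by rewrite big_ord0 L0.
    rewrite big_ord_recr /= IH ?(ltnW kl) // sum_nat_const_nat muln1 Ao Ai kl.
    by have := L_mono (leqnSn k); have := L_le k.+1; lia.
  by rewrite H // L_full /l; have := steps_compl d N.-1; rewrite -/b; lia.
exists A; split=> //; rewrite /follows_path sz; split.
  by move=> t tN; apply: steps_mono; lia.
have mem t : t < N -> path_box 0 b d t \in boxes A.
  move=> tN; have h : steps d t < l by rewrite ltnS; apply: steps_mono; lia.
  rewrite mem_boxesE /= add0n Ao Ai h; have := L_path tN; have := L_le (steps d t).+1.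
  have : lefts d t <= b by apply: steps_mono; lia.
  by move: (lefts d t) => z; lia.
rewrite perm_sym; apply: uniq_perm (boxes_uniq A) _.
  rewrite map_inj_in_uniq ?iota_uniq // => t u; rewrite !mem_iota /= => tN uN.
  have : lefts d t <= b by apply: steps_mono; lia.
  have : lefts d u <= b by apply: steps_mono; lia.
  have := steps_compl d t; have := steps_compl d u; rewrite /path_box => h1 h2 h3 h4 [].
  by move: h1 h2 h3 h4; move: (lefts d t) (lefts d u) => y z; lia.
have U : uniq [seq path_box 0 b d t | t <- iota 0 N].
  rewrite map_inj_in_uniq ?iota_uniq // => t u; rewrite !mem_iota /= => tN uN.
  have : lefts d t <= b by apply: steps_mono; lia.
  have : lefts d u <= b by apply: steps_mono; lia.
  have := steps_compl d t; have := steps_compl d u; rewrite /path_box => h1 h2 h3 h4 [].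
  by move: h1 h2 h3 h4; move: (lefts d t) (lefts d u) => y z; lia.
have S : {subset [seq path_box 0 b d t | t <- iota 0 N] <= boxes A}.
  by move=> x /mapP [t]; rewrite mem_iota /= => tN ->; apply: mem.
by have [|_ E] := uniq_min_size U S; rewrite ?size_map ?size_iota ?sz.
Qed.

Lemma equitable_of_levels :
  (forall i j, 0 < level_size d N i -> 0 < level_size d N j ->
     level_size d N i <= (level_size d N j).+1) ->
  (forall i j, 0 < level_size (fun s => ~~ d s) N i -> 0 < level_size (fun s => ~~ d s) N j ->
     level_size (fun s => ~~ d s) N i <= (level_size (fun s => ~~ d s) N j).+1) ->
  exists A, [/\ equitable_ribbon A, size (boxes A) = N & nrows A = (steps d N.-1).+1].
Proof.
move=> rE cE; have [A [rb sz path]] := ribbon_of_path; exists A; split=> //; last first.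
  by rewrite (path_nrows path) sz.
have jb j : 0 < col_length A j -> j <= b.
  rewrite /col_length -has_count => /hasP [x hx /eqP <-].
  by have [t _ ->] := path_ex path hx; rewrite /= leq_subr.
split=> // [i j|i j ci cj].
  by rewrite -[i]add0n -[j]add0n !(path_row_length path) sz; apply: rE.
have ib := jb i ci; have jb' := jb j cj; move: ci cj.
rewrite -(subKn ib) -(subKn jb') !(path_col_length path) ?leq_subr // sz; exact: cE.
Qed.
End RibbonOfPath.

Lemma level_size_le2 e N k : (forall t, t.+2 < N -> e t || e t.+1) -> level_size e N k <= 2.
Proof.
move=> H; rewrite leqNgt; apply/negP => h.
have eS : level_size e N k = block_start (level_size e N) k.+1 - block_start (level_size e N) k.
  by rewrite block_startS addKn.
set u := block_start _ k in eS; set v := block_start _ k.+1 in eS.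
have vN : v <= N.
  rewrite /v block_start_level -[X in _ <= X](card_ord N) -sum1_card; apply: leq_sum => t _.
  by case: (_ < _).
have lev t : u <= t -> t < v -> steps e t = k.
  move=> ut tv; have tN : t < N by apply: leq_trans tv vN.
  have := block_start_levelP e k.+1 tN; have := block_start_levelP e k tN.
  by rewrite -/u -/v; lia.
have h0 := lev u ltac:(lia) ltac:(lia); have h1 := lev u.+1 ltac:(lia) ltac:(lia).
have h2 := lev u.+2 ltac:(lia) ltac:(lia).
have := H u ltac:(lia); move: h1 h2; rewrite !stepsS h0.
by case: (e u); case: (e u.+1) => //=; lia.
Qed.

(** * Evenly spaced steps *)

Section EvenMarks.
Variables (N m : nat).
Hypotheses (m0 : 0 < m) (mN : m.*2.-1 <= N).

(** Rounded multiples of the average length; their gaps differ by at most one. *)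
Let g i := (i * N) %/ m.

Definition even_mark (t : nat) : bool := [exists i : 'I_m, t.+1 == g i].

Let Nge : m <= N. Proof. lia. Qed.

Let gS i : g i.+1 = g i + N %/ m + (m <= (i * N) %% m + N %% m).
Proof. by rewrite /g mulSn addnC divnD. Qed.

Let g0 : g 0 = 0. Proof. by rewrite /g div0n. Qed.

Let gm : g m = N. Proof. by rewrite /g mulKn. Qed.

Let gap1 : 0 < N %/ m. Proof. by rewrite divn_gt0. Qed.

Let g_lt i j : i < j -> g i < g j.
Proof.
elim: j => // j IH; rewrite ltnS leq_eqVlt => /predU1P [->|/IH h]; first by rewrite gS; lia.
by apply: ltn_trans h _; rewrite gS; lia.
Qed.

(** Only the first gap can be one, and only for [N = m.*2.-1]. Since [g 0] is not the position of a
    mark, no two marks are adjacent. *)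
Let gap2 i : 0 < i -> i < m -> (g i).+2 <= g i.+1.
Proof.
move=> i0 im; case: (leqP m.*2 N) => h.
  have : 2 <= N %/ m by rewrite leq_divRL // mul2n.
  by rewrite gS; lia.
have NE : N = m.*2.-1 by lia.
have gE k : 0 < k -> k <= m -> g k = k.*2.-1.
  move=> k0 km; rewrite /g; have -> : k * N = k.*2.-1 * m + (m - k).
    rewrite NE -!muln2; case: (k) k0 km => // k' _ km; case: (m) m0 km => // m' _ km.
    by rewrite !muln2 /= !mulSn !mulnS -!addnn; nia.
  by rewrite divnMDl // divn_small ?addn0 //; lia.
by rewrite !gE //; lia.
Qed.

Let mark_steps t : t < N -> forall i, i < m -> g i <= t < g i.+1 -> steps even_mark t = i.
Proof.
elim: t => [|t IH] tN i im ht.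
  rewrite steps0; case: i im ht => // i im; have := g_lt (ltn0Sn i); lia.
rewrite stepsS; case: (eqVneq (g i) t.+1) => e.
  have i0 : 0 < i by case: (i) e => //; rewrite g0.
  have -> : even_mark t by apply/existsP; exists (Ordinal im); rewrite /= e.
  rewrite (IH (ltnW tN) i.-1); [lia|lia|].
  have := @g_lt i.-1 i ltac:(lia); rewrite prednK // e; lia.
have -> : even_mark t = false.
  apply/negbTE/negP => /existsP [k /eqP ek]; move: ht; rewrite ek.
  case: (ltngtP (nat_of_ord k) i) => h.
  - by have := g_lt h; lia.
  - by rewrite ltnNge; case: (ltngtP k i.+1) h => // [h' _|-> _]; [have := g_lt h'; lia|rewrite leqnn andbF].
  - by move: e; rewrite -h ek eqxx.
by rewrite (IH (ltnW tN) i) ?addn0 //; move: ht; lia.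
Qed.

Let mark_ex t : t < N -> exists2 i, i < m & g i <= t < g i.+1.
Proof.
move=> tN; have ex : exists i, t < g i by exists m; rewrite gm.
case: (ex_minnP ex) => i ti mini; have i0 : 0 < i by case: (i) ti => //; rewrite g0.
exists i.-1; first by have := mini m; rewrite gm => /(_ tN); lia.
rewrite prednK // ti andbT leqNgt; apply/negP => /mini; lia.
Qed.

Lemma even_mark_steps : steps even_mark N.-1 = m.-1.
Proof.
apply: mark_steps; [lia|lia|]; rewrite (prednK m0) gm.
have := @g_lt m.-1 m ltac:(lia); rewrite gm; lia.
Qed.

Lemma even_mark_level i : i < m -> level_size even_mark N i = g i.+1 - g i.
Proof.
move=> im; rewrite /level_size -(big_mkord xpredT (fun t => nat_of_bool (steps even_mark t == i))).
have gN : g i.+1 <= N by rewrite -gm; case: (ltngtP i.+1 m) im => // [h _|-> //]; apply: ltnW; apply: g_lt.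
rewrite (sum_range (P := fun t => steps even_mark t == i) (u := g i) (v := g i.+1)) //.
  by apply: ltnW; apply: g_lt.
move=> t /= tN; have [k km hk] := mark_ex tN; rewrite (mark_steps tN km hk).
apply/eqP/idP => [<-//|hi]; case: (ltngtP k i) => // h.
- by have : g k.+1 <= g i; [case: (ltngtP k.+1 i) h => // [h' _|-> //]; apply: ltnW; apply: g_lt|lia].
- by have : g i.+1 <= g k; [case: (ltngtP i.+1 k) h => // [h' _|-> //]; apply: ltnW; apply: g_lt|lia].
Qed.

Lemma even_mark_levels i j : 0 < level_size even_mark N i -> 0 < level_size even_mark N j ->
  level_size even_mark N i <= (level_size even_mark N j).+1.
Proof.
have N0 : 0 < N by lia.
move=> /level_size_bound hi /level_size_bound hj; rewrite even_mark_steps in hi hj.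
by rewrite !even_mark_level ?gS; lia.
Qed.

Lemma even_mark_isolated t : even_mark t -> even_mark t.+1 -> False.
Proof.
move=> /existsP [i /eqP ei] /existsP [j /eqP ej].
have i0 : 0 < i by case: (posnP i) => // i0; rewrite i0 g0 in ei.
have ij : i < j.
  by rewrite ltnNge; apply/negP => h; case: (ltngtP j i) h => // [h _|h _]; [have := g_lt h|move: ei ej; rewrite h]; lia.
have := gap2 i0 (ltn_ord i); have : g i.+1 <= g j.
  by case: (ltngtP i.+1 j) ij => // [h _|-> //]; apply: ltnW; apply: g_lt.
lia.
Qed.
End EvenMarks.

(** The rarer kind of step is spaced evenly: the down steps if [l.*2.-1 <= N], otherwise the left
    steps, for [N - l.-1] columns. As these steps are isolated, the lengths in the other direction
    are one or two. *)
Lemma equitable_ribbon_ex N l : 1 <= l <= N ->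
  exists A, [/\ equitable_ribbon A, size (boxes A) = N & nrows A = l].
Proof.
move=> hl; have N0 : 0 < N by lia.
have small e i j : (forall t, ~~ e t -> ~~ e t.+1 -> False) ->
    0 < level_size e N i -> 0 < level_size e N j -> level_size e N i <= (level_size e N j).+1.
  move=> iso _ h; apply: leq_trans (_ : 2 <= _) => //; apply: level_size_le2 => t _.
  by case e0: (e t) => //; case e1 : (e t.+1) => //; have := iso t; rewrite e0 e1 => /(_ isT isT).
case: (leqP l.*2.-1 N) => h.
  have [||A [h1 h2 h3]] := @equitable_of_levels N (even_mark N l) N0.
  - by apply: even_mark_levels => //; lia.
  - move=> i j; apply: small => t; rewrite !negbK; apply: even_mark_isolated => //; lia.
  exists A; split=> //; rewrite h3 even_mark_steps //; lia.
pose c := N - l.-1.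
have dd : (fun s => ~~ ~~ even_mark N c s) = even_mark N c by apply/funext => s; rewrite negbK.
have [||A [h1 h2 h3]] := @equitable_of_levels N (fun s => ~~ even_mark N c s) N0.
- move=> i j; apply: small => t; rewrite !negbK; apply: even_mark_isolated; rewrite /c; lia.
- rewrite dd; apply: even_mark_levels; rewrite /c; lia.
exists A; split=> //; rewrite h3.
have := steps_compl (even_mark N c) N.-1; rewrite even_mark_steps; rewrite /c; lia.
Qed.

(** * Maximal supports *)

Lemma support_lr A (lam : intpart) : in_support A lam <-> exists f, lr_function A lam f.
Proof. exact: in_support_lr. Qed.

Lemma nrows_straight (lam : intpart) : nrows (straight lam) = size lam.
Proof.
rewrite -(size_iota 0 (size lam)); apply: perm_size; apply: uniq_perm.
- exact: rows_uniq.
- exact: iota_uniq.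
by move=> i; rewrite -/(rows (straight lam)) mem_rows /= nth_nil part_nth_gt0 mem_iota.
Qed.

Lemma ncols_straight (lam : intpart) : ncols (straight lam) = nth 0 lam 0.
Proof.
rewrite -(size_iota 0 (nth 0 lam 0)); apply: perm_size; apply: uniq_perm.
- exact: cols_uniq.
- exact: iota_uniq.
move=> j; rewrite -/(cols (straight lam)) mem_iota add0n /=; apply/idP/idP.
  move=> /mem_cols [i]; rewrite mem_straight /= => /leq_trans; apply; exact: part_nth_anti.
move=> h; have hb : (0, j) \in boxes (straight lam) by rewrite mem_straight.
exact: (box_cols hb).
Qed.

(** * Partitions used to test a support *)

Lemma sumn_part_le (lam : intpart) K : size lam <= K -> sumn lam = \sum_(i < K) nth 0 lam i.
Proof.
move=> h; rewrite sumn_part -(big_mkord xpredT (fun i => nth 0 lam i)).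
rewrite -(big_mkord xpredT (fun i => nth 0 lam i)) (big_cat_nat (n := size lam) (p := K)) //=.
rewrite [X in _ = _ + X]big_nat_cond [X in _ = _ + X]big1 ?addn0 //.
by move=> i /andP[/andP[hi _] _]; rewrite nth_default.
Qed.

Lemma mk_part (g : nat -> nat) m : (forall i j, i <= j -> g j <= g i) -> g m = 0 ->
  exists lam : intpart, [/\ forall i, nth 0 lam i = g i, size lam <= m & sumn lam = \sum_(i < m) g i].
Proof.
move=> ga gm; have E i := nth_part_of i ga gm.
have sz : size (part_of g m) <= m by rewrite leqNgt -part_nth_gt0 E gm.
by exists (part_of g m); split=> //; rewrite (sumn_part_le sz); apply: eq_bigr => i _.
Qed.

(** Extreme in both directions, this hook tells the sets [in_box N l] apart for different [l]; its
    parts of size one serve to exclude squares. *)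
Lemma mk_hook N l : 1 <= l <= N -> exists lam : intpart,
  [/\ size lam = l, nth 0 lam 0 = N - l.-1, sumn lam = N & forall v, nth 0 lam v.+1 <= 1].
Proof.
move=> hl; have [||lam [E sz sm]] := @mk_part (fun i => if i == 0 then N - l.-1 else i < l) l.
- by move=> [|i] [|j] //= ij; [case: (ltnP j.+1 l)|case: (ltnP j.+1 l); case: (ltnP i.+1 l)]; lia.
- by case: (l) hl => // l' _; rewrite /= ltnn.
exists lam; split.
- apply/eqP; rewrite eqn_leq sz /=; have : 0 < nth 0 lam l.-1 by rewrite E; case: eqP; lia.
  by rewrite part_nth_gt0; lia.
- by rewrite E.
- rewrite sm; case: (l) hl => // l' hl; rewrite big_ord_recl /=.
  rewrite (eq_bigr (fun=> 1)) ?sum_nat_const ?card_ord; first lia.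
  by move=> i _; rewrite /bump /= add1n ltnS ltn_ord.
- by move=> v; rewrite E /=; case: (_ < _).
Qed.

(* [q] copies of [c] and a remainder: the conjugate of an equitable composition. *)
Lemma mk_column_part N c : 1 <= c <= N -> exists lam : intpart,
  [/\ nth 0 lam 0 = c, sumn lam = N, size lam <= (N %/ c).+1, size lam + c.-1 <= N
    & forall v, v < N %/ c -> nth 0 lam v = c].
Proof.
move=> hc; have c0 : 0 < c by lia.
have := divn_eq N c; have := ltn_pmod N c0; have : 0 < N %/ c by rewrite divn_gt0 //; lia.
move: (N %/ c) (N %% c) => q r q0 rc NE.
have [||lam [E sz sm]] := @mk_part (fun i => if i < q then c else if i == q then r else 0) q.+1.
- by move=> i j ij; case: (ltnP i q) => hi; case: (ltnP j q) => hj; case: (eqVneq i q) => ei; case: (eqVneq j q) => ej; lia.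
- by rewrite ltnNge leqnSn /=; case: eqP; lia.
have h0 : nth 0 lam 0 = c by rewrite E q0.
exists lam; split=> //.
- rewrite sm big_ord_recr /= ltnn eqxx NE; congr (_ + _).
  by rewrite (eq_bigr (fun=> c)) ?sum_nat_const ?card_ord // => i _; rewrite ltn_ord.
- have hs : size lam <= q + (0 < r).
    rewrite leqNgt -part_nth_gt0 E; case: (ltnP (q + (0 < r)) q) => [|_]; first lia.
    by case: eqP => //; case: (r) => [|r'] /=; lia.
  have : q + c.-1 <= q * c by case: (q) (c) q0 c0 => // q' [] // c' _ _; rewrite /= mulSn mulnS; lia.
  by rewrite NE; move: hs; case: (r) => [|r'] /=; lia.
- by move=> v vq; rewrite E vq.
Qed.

(** The parts are as equal as possible; by the bounds of row lengths by the first and the last part,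
    the rows are then equitable. *)
Lemma mk_row_part N l : 1 <= l <= N -> exists lam : intpart,
  [/\ size lam = l, sumn lam = N, nth 0 lam 0 + l.-1 <= N & nth 0 lam 0 <= (nth 0 lam l.-1).+1].
Proof.
move=> hl; have l0 : 0 < l by lia.
have := divn_eq N l; have := ltn_pmod N l0; have : 0 < N %/ l by rewrite divn_gt0 //; lia.
move: (N %/ l) (N %% l) => q r q0 rl NE.
have [||lam [E sz sm]] := @mk_part (fun i => if i < l then q + (i < r) else 0) l.
- by move=> i j ij; case: (ltnP j l); case: (ltnP i l); case: (ltnP i r); case: (ltnP j r); lia.
- by rewrite ltnn.
exists lam; split.
- apply/eqP; rewrite eqn_leq sz /=; have : 0 < nth 0 lam l.-1 by rewrite E prednK // leqnn; lia.
  by rewrite part_nth_gt0; lia.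
- rewrite sm (eq_bigr (fun i : 'I_l => q + (i < r))); last by move=> i _; rewrite ltn_ord.
  rewrite big_split /= sum_nat_const card_ord NE mulnC; congr (_ + _).
  rewrite -(big_mkord xpredT (fun i => nat_of_bool (i < r))).
  by rewrite (sum_range (P := fun i => i < r) (u := 0) (v := r)) ?subn0 //; lia.
- rewrite E l0; have : q + l.-1 <= q * l.
    by case: (q) (l) q0 l0 => // q' [] // l' _ _; rewrite /= mulSn mulnS; lia.
  by rewrite NE; case: (r) => [|r'] /=; lia.
- by rewrite !E l0 prednK // leqnn; case: (0 < r); lia.
Qed.

Lemma ribbon_rows_cols A : ribbon A -> 0 < size (boxes A) -> nrows A + ncols A = (size (boxes A)).+1.
Proof.
move=> rb A0; have [a [b [d path]]] := ribbon_path rb A0.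
rewrite (path_nrows path A0) (path_ncols path A0).
by have := steps_compl d (size (boxes A)).-1; lia.
Qed.

(** A ribbon with [N] boxes and [l] rows has [N.+1 - l] columns; the bound on the first part is
    written additively to avoid truncation. *)
Definition in_box (N l : nat) (lam : intpart) : Prop :=
  [/\ sumn lam = N, size lam <= l & nth 0 lam 0 + l <= N.+1].

Lemma support_connected A (lam : intpart) : connected A -> in_support A lam ->
  in_box (size (boxes A)) (nrows A) lam.
Proof.
move=> cn /support_lr [f lr]; split; [exact: lr_sumn lr|exact: lr_size_le lr|].
by have := connected_rows_cols cn; have := lr_head_le lr; lia.
Qed.

Lemma support_equitable A (lam : intpart) : equitable_ribbon A -> 0 < size (boxes A) ->
  in_support A lam <-> in_box (size (boxes A)) (nrows A) lam.
Proof.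
move=> eq A0; have rb : ribbon A by case: eq.
split; first by apply: support_connected; case: rb.
have := ribbon_rows_cols rb A0 => rc [sl sr sc]; apply/support_lr.
by apply: equitable_lr => //; lia.
Qed.

Lemma support_box_equitable A l : 1 <= l <= size (boxes A) ->
  (forall lam, in_support A lam <-> in_box (size (boxes A)) l lam) ->
  equitable_ribbon A /\ nrows A = l.
Proof.
set N := size (boxes A) => hl H.
have A0 : 0 < size (boxes A) by rewrite -/N; lia.
have [hook [hs h0 hN hk]] := mk_hook hl.
have /support_lr [f lrf] : in_support A hook by apply/H; split; rewrite ?hs ?h0; lia.
have ns := hook_no_square lrf hk.
have l_le : l <= nrows A by rewrite -hs; exact: lr_size_le lrf.
(* The hook gives one inequality; the shape of [hook_filling] has at least [nrows A] parts and gives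
   the other. *)
have nr : nrows A = l.
  apply/eqP; rewrite eqn_leq l_le andbT.
  pose f1 := hook_filling A; have s1 := hook_filling_ssyt ns; have la1 := @hook_filling_lattice A.
  have : in_support A (lr_shape A f1).
    by apply/support_lr; exists f1; split=> // v; rewrite nth_lr_shape.
  case/H => _ sz _; have := hook_filling_rows A0; rewrite -nth_lr_shape // part_nth_gt0 => h; by move: (leq_trans h sz); lia.
have nc : ncols A + l <= N.+1.
  pose f2 := column_filling A; have s2 := @column_filling_ssyt A; have la2 := @column_filling_lattice A.
  have : in_support A (lr_shape A f2).
    by apply/support_lr; exists f2; split=> // v; rewrite nth_lr_shape.
  case/H => _ _; rewrite nth_lr_shape // => h.
  by apply: leq_trans h; rewrite leq_add2r; apply: column_filling_weight0.
have cn : connected A by apply: no_square_connected => //; rewrite nr; lia.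
have rb : ribbon A by split.
have rc := ribbon_rows_cols rb A0; rewrite nr -/N in rc.
split=> //; split=> //.
  have [lam [ls lN l0 le]] := mk_row_part hl.
  have /support_lr [g lrg] : in_support A lam by apply/H; split; rewrite ?ls; lia.
  have rl i : 0 < row_length A i -> i \in rows A.
    by rewrite -has_count => /hasP [b hb /eqP <-]; apply: box_rows.
  move=> i j _ /rl hj; apply: leq_trans (row_length_le_head lrg i) _; apply: leq_trans le _.
  by rewrite ltnS -nr; apply: (row_length_ge_last lrg); rewrite ?ls.
have hc : 1 <= ncols A <= N by lia.
have [lam [l0 lN ls lsN lq]] := mk_column_part hc.
have /support_lr [g lrg] : in_support A lam by apply/H; split; rewrite ?l0; lia.
have cl j : 0 < col_length A j -> j \in cols A.
  by rewrite -has_count => /hasP [b hb /eqP <-]; apply: box_cols.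
move=> i j _ /cl hj; apply: leq_trans (col_length_le lrg i) _; apply: leq_trans ls _.
by rewrite ltnS; apply: (col_length_ge lrg).
Qed.

Theorem theorem1p5 (N : nat) (N_gt0 : 0 < N) :
  (* (a) *)
  ((exists s : seq (Supp N),
      [/\ uniq s, size s = N & forall x, x \in s <-> max_connected x]) /\
   (forall l, 1 <= l <= N ->
      exists! x : Supp N, max_connected x /\ class_nrows x l)) /\
  (* (b) *)
  (forall l, 1 <= l <= N ->
     forall x : Supp N, max_connected x -> class_nrows x l ->
       forall A : skew_of_size N,
         supp_class A = x <-> equitable_ribbon A /\ nrows A = l) /\
  (* (c) *)
  (forall R : skew_of_size N, equitable_ribbon R ->
     forall lam : intpart,
       in_support R lam <->
       [/\ sumn lam = N,
           nrows (straight lam) <= nrows R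
         & ncols (straight lam) <= ncols R]).
Proof.
have szA (A : skew_of_size N) : size (boxes A) = N by apply/eqP; exact: valP A.
have supE (A : skew_of_size N) : equitable_ribbon A ->
    forall lam, in_support A lam <-> in_box N (nrows A) lam.
  by move=> eq lam; have := @support_equitable A lam eq; rewrite szA; apply.
have supC (A : skew_of_size N) lam : connected A -> in_support A lam -> in_box N (nrows A) lam.
  by move=> cn h; have := support_connected cn h; rewrite szA.
have nrb (A : skew_of_size N) : connected A -> 1 <= nrows A <= N.
  move=> cn; have := connected_rows_cols cn; rewrite szA => h.
  have [x hx] : exists x, x \in boxes A.
    by case E : (boxes A) (szA A) => [|x s]; [move=> /= e; move: N_gt0; rewrite -e|exists x; rewrite mem_head].
  have := rank_lt_nrows (box_rows hx).
  have : 0 < ncols A by have := box_cols hx; rewrite /ncols -/(cols A); case: (cols A).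
  by lia.
(* Stated for all [l] so that [choice] applies; out of range, a ribbon with one row serves as a
   dummy. *)
have exR l : exists A : skew_of_size N, 1 <= l <= N -> equitable_ribbon A /\ nrows A = l.
  have [l0 hl0] : exists l0, 1 <= l0 <= N /\ (1 <= l <= N -> l0 = l).
    by case: (boolP (1 <= l <= N)) => h; [exists l|exists 1; split=> //; lia].
  case: hl0 => hl0 e; have [A [h1 h2 h3]] := equitable_ribbon_ex hl0.
  have h2' : size (boxes A) == N by apply/eqP.
  by exists (SkewOfSize h2') => /e <-.
have [R RP] := choice exR.
pose X l := supp_class (R l).
have connR l : 1 <= l <= N -> connected (R l) by move=> /RP [[[? ?] ? ?] ?].
have leX (A : skew_of_size N) : connected A -> (supp_class A <= X (nrows A))%O.
  move=> cn; apply/supp_class_leP => lam /(supC _ _ cn) h.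
  by have [eq nr] := RP _ (nrb _ cn); apply/supE => //; rewrite nr.
(* The hook with [l] rows and [N - l.-1] columns fits only the set for [l], so the [X l] are
   pairwise incomparable. *)
have Xinj l l' : 1 <= l <= N -> 1 <= l' <= N -> (X l <= X l')%O -> l = l'.
  move=> hl hl' /supp_class_leP h.
  have [hook [hs h0 hN _]] := mk_hook hl.
  have [eq nr] := RP _ hl; have [eq' nr'] := RP _ hl'.
  have : in_support (R l) hook by apply/supE => //; split; rewrite ?nr ?hs ?h0; lia.
  by move/h/(supE _ eq'); rewrite nr' => -[_]; rewrite hs h0; lia.
have maxX l : 1 <= l <= N -> max_connected (X l).
  move=> hl; split; first by exists (R l) => //; apply: connR.
  move=> y [B -> cB] le; have le' := leX B cB; have hB := nrb _ cB.
  have e := Xinj _ _ hl hB (Order.POrderTheory.le_trans le le').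
  by apply/Order.POrderTheory.le_anti; rewrite le andbT /X e.
have maxE x : max_connected x -> exists2 l, 1 <= l <= N & x = X l.
  move=> [[A -> cA] mx]; exists (nrows A); first exact: nrb.
  apply/esym; apply: mx; last exact: leX.
  by exists (R (nrows A)) => //; apply: connR; apply: nrb.
have classX l : 1 <= l <= N -> forall A : skew_of_size N,
    supp_class A = X l <-> equitable_ribbon A /\ nrows A = l.
  move=> hl A; have [eq nr] := RP _ hl; split=> [/supp_class_eqP h|[eqA nrA]].
    apply: support_box_equitable; rewrite szA // => lam.
    by rewrite h supE // nr.
  by apply/supp_class_eqP => lam; rewrite !supE // nr nrA.
have nrX l : 1 <= l <= N -> class_nrows (X l) l.
  by move=> hl A /esym /(classX l hl) [].
have nrXE l l' : 1 <= l' <= N -> class_nrows (X l') l -> l' = l.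
  by move=> hl' /(_ (R l') erefl) <-; case: (RP _ hl').
split; [split|split].
- exists [seq X l | l <- iota 1 N]; split.
  + rewrite map_inj_in_uniq ?iota_uniq // => l l'; rewrite !mem_iota => hl hl' e.
    by apply: Xinj; rewrite ?e ?Order.POrderTheory.lexx //; lia.
  + by rewrite size_map size_iota.
  move=> x; split=> [/mapP [l]|/maxE [l hl ->]].
    by rewrite mem_iota => hl ->; apply: maxX; lia.
  by apply: map_f; rewrite mem_iota; lia.
- move=> l hl; exists (X l); split; first by split; [apply: maxX|apply: nrX].
  by move=> y [/maxE [l' hl' ->] /(nrXE _ _ hl') ->].
- move=> l hl x /maxE [l' hl' ->] /(nrXE _ _ hl') e; subst l'; exact: classX.
- move=> A eq lam; rewrite nrows_straight ncols_straight supE //.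
  have rb : ribbon A by case: eq.
  have rc : nrows A + ncols A = N.+1 by rewrite ribbon_rows_cols ?szA.
  by split=> -[h1 h2 h3]; split=> //; move: h3 rc; clear; lia.
Qed.
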